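(* Let $X$ be a real separable Hilbert space and let $\mu=\mathcal N(0,Q_\mu)$, $\nu=\mathcal N(0,Q_\nu)$ be centered Gaussian measures on $X$ with Cameron–Martin spaces $H_\mu$ and $H_\nu$. Let $T\in\mathscr L(H_\mu,H_\nu)$ with $0<\|T\|_{\mathscr L(H_\mu,H_\nu)}<1$, let $p\in[1,\infty)$ and set $q_0:=1+(p-1)\|T\|^{-2}_{\mathscr L(H_\mu,H_\nu)}$. Then $\Gamma_{\nu,\mu}(T)$ is a contraction from $L^p(X,\mu)$ into $L^q(X,\nu)$ for every $1\le q\le q_0$. Moreover, if $q>q_0$ then there exists $f\in L^p(X,\mu)$ such that $\Gamma_{\nu,\mu}(T)f\notin L^q(X,\nu)$.
   Context: For $\gamma=\mathcal N(0,Q_\gamma)$, the Cameron–Martin space is $H_\gamma=Q_\gamma^{1/2}(X)$ with $\langle h,k\rangle_{H_\gamma}=\langle Q_\gamma^{-1/2}h,Q_\gamma^{-1/2}k\rangle_X$, where $Q_\gamma^{-1/2}h$ is the unique $z\in(\ker Q_\gamma^{1/2})^\perp$ with $Q_\gamma^{1/2}z=h$. For $T\in\mathscr L(H_\mu,H_\nu)$ let $(f_k)$ be an orthonormal basis (finite or countable) of $(\ker Q_\mu)^\perp$ consisting of eigenvectors of $Q_\mu$ and let $\pi_m$ be the orthogonal projection of $X$ onto $\mathrm{span}\{f_1,\dots,f_m\}\subseteq H_\mu$. $T_\infty^{\nu,\mu}$ is the limit (it exists) of $T\pi_m$ in $L^2(X,\mu;X)$, for which a linear measurable version is fixed; $T_\infty^\mu:=T_\infty^{\mu,\mu}$.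 For $\|T\|_{\mathscr L(H_\mu,H_\nu)}\le1$ and $f:X\to\mathbb R$ measurable with $|f(x)|\le Me^{c\|x\|_X}$ for some $M,c>0$, $$(\Gamma_{\nu,\mu}(T)f)(x)=\int_Xf\big[(T^\star)_\infty^{\mu,\nu}x+((I-T^\star T)^{1/2})_\infty^\mu y\big]\mu(dy),$$ where $T^\star\in\mathscr L(H_\nu,H_\mu)$ is the adjoint of $T$. For every $p\in[1,\infty)$ it extends by density to a bounded operator $L^p(X,\mu)\to L^p(X,\nu)$ of norm $1$, denoted in the same way. A contraction is an operator of norm at most $1$. *)

(* Defs.v *)
From HB Require Import structures.
From mathcomp Require Import all_boot all_order all_algebra sesquilinear.
From mathcomp Require Import all_classical all_reals all_analysis.

Set Implicit Arguments.
Unset Strict Implicit.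
Unset Printing Implicit Defensive.

Import Order.TTheory GRing.Theory Num.Theory.
Import numFieldNormedType.Exports.

Local Open Scope classical_set_scope.
Local Open Scope ring_scope.

HB.mixin Record NormedModule_isHilbert (R : realType) X
    of CompleteNormedModule R X := {
  inner : {dot X for idfun} ;
  inner_norm : forall x : X, inner x x = `|x| ^+ 2
}.

#[short(type="hilbertType")]
HB.structure Definition Hilbert (R : realType) :=
  {X of CompleteNormedModule R X & NormedModule_isHilbert R X}.

Definition separable_space (X : topologicalType) : Prop :=
  exists2 D : set X, countable D & dense D.

Definition borel (X : topologicalType) := g_sigma_algebraType (@open X).

Section operators.
Context {R : realType} {X : hilbertType R}.

(* A linear subspace of X with an inner product of its own, used for X itself
   and for Cameron-Martin spaces. Operators between such spaces are encoded as
   functions X -> X, of which only the values on the carrier of the domain are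
   meaningful. *)
Record ipspace := IPSpace {
  carrier : set X ;
  ip : X -> X -> R
}.

Implicit Types (H K : ipspace) (T P Q S : X -> X).

Definition ambient : ipspace := IPSpace setT (@inner R X).

Definition ipnorm H (x : X) : R := Num.sqrt (ip H x x).

Definition bounded_operator H K T : Prop :=
  [/\ forall x, carrier H x -> carrier K (T x),
      forall (a : R) x y, carrier H x -> carrier H y ->
        T (a *: x + y) = a *: T x + T y
    & exists M : R, forall x, carrier H x ->
        ipnorm K (T x) <= M * ipnorm H x].

Definition opnorm H K T : R :=
  sup [set ipnorm K (T x) | x in [set x | carrier H x /\ ipnorm H x <= 1]].

Definition adjoint H K T : X -> X :=
  get [set S : X -> X | bounded_operator K H S /\
    forall x y, carrier H x -> carrier K y ->
      ip K (T x) y = ip H x (S y)].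

Definition nonneg_operator H P : Prop :=
  [/\ bounded_operator H H P,
      forall x y, carrier H x -> carrier H y -> ip H (P x) y = ip H x (P y)
    & forall x, carrier H x -> 0 <= ip H (P x) x].

Definition sqrt_operator H P : X -> X :=
  get [set S : X -> X | nonneg_operator H S /\
    forall x, carrier H x -> S (S x) = P x].

Definition kernel_orth Q : set X :=
  [set x | forall z, Q z = 0 -> inner x z = 0].

Definition pseudo_inverse Q (h : X) : X :=
  get [set z | kernel_orth Q z /\ Q z = h].

Definition cameron_martin Q : ipspace :=
  let Qh := sqrt_operator ambient Q in
  IPSpace (range Qh)
    (fun h k => inner (pseudo_inverse Qh h) (pseudo_inverse Qh k)).

Definition partial_proj (f : nat -> X) (m : nat) (x : X) : X :=
  \sum_(k < m) inner x (f k) *: f k.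

(* Some of the f k may be 0: this covers finite bases (padded with zeros) and
   infinite ones, and partial_proj f m is in both cases the orthogonal
   projection onto the span of the first m vectors. *)
Definition orthonormal_basis (V : set X) (f : nat -> X) : Prop :=
  [/\ forall k, V (f k),
      forall k, `|f k| = 1 \/ f k = 0,
      forall j k, j != k -> inner (f j) (f k) = 0
    & forall x, V x -> partial_proj f m x @[m --> \oo] --> x].

Definition eigenbasis Q (f : nat -> X) : Prop :=
  orthonormal_basis (kernel_orth Q) f /\
  forall k, exists lambda : R, Q (f k) = lambda *: f k.

(* For a nonnegative Q the trace does not depend on the basis. *)
Definition trace_class Q : Prop :=
  exists2 e : nat -> X, orthonormal_basis setT e &
    cvgn (series (fun k => inner (Q (e k)) (e k))).

End operators.
Arguments ipspace {R} X.

Section gaussian.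
Context {R : realType} {X : hilbertType R}.
Implicit Types (mu nu : probability (borel X) R) (Q T A B : X -> X).

(* mu = N(0, Q): the characteristic function of mu at h is
   exp (- <Q h, h> / 2), written with its real and imaginary parts. *)
Definition centered_gaussian mu Q : Prop :=
  [/\ nonneg_operator ambient Q,
      trace_class Q,
      forall h : X, (\int[mu]_x (cos (inner h x))%:E =
                     (expR (- (inner (Q h) h / 2)))%:E)%E
    & forall h : X, (\int[mu]_x (sin (inner h x))%:E = 0)%E].

(* A is a linear measurable version of the limit in L^2(X, mu; X) of T pi_m,
   where mu = N(0, Q). A Borel linear map defined on all of X would be
   continuous, so a Borel version is linear on a Borel subspace of full
   measure. *)
Definition linear_version mu Q T A : Prop :=
  [/\ measurable_fun [set: borel X] (A : borel X -> borel X),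
      exists V : set (borel X),
        [/\ measurable V, mu V = 1%E, V (0 : X),
            forall (a : R) (x y : X), V x -> V y -> V (a *: x + y)
          & forall (a : R) (x y : X), V x -> V y ->
              A (a *: x + y) = a *: A x + A y]
    & exists2 f : nat -> X, eigenbasis Q f &
        (\int[mu]_x (`|A x - T (partial_proj f m x)| ^+ 2)%:E)%E
          @[m --> \oo] --> 0%E].

Definition exp_growth (f : borel X -> R) : Prop :=
  measurable_fun [set: borel X] f /\
  exists M c : R, [/\ 0 < M, 0 < c &
    forall x : X, `|f x| <= M * expR (c * `|x|)].

(* Gamma_{nu,mu}(T) on functions of exponential growth, with A and B the chosen
   versions of (T^* )_oo and of ((I - T^* T)^{1/2})_oo. *)
Definition second_quantization mu A B (f : borel X -> R) : borel X -> R :=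
  fun x => \int[mu]_y f (A x + B y).

(* g is (a version of) the image of f under the extension by density of
   Gamma_{nu,mu}(T) to an operator L^p(X, mu) -> L^p(X, nu). *)
Definition second_quantization_Lp mu nu A B (p : R) (f g : borel X -> R) :
    Prop :=
  [/\ f \in Lfun mu p%:E, g \in Lfun nu p%:E &
    exists u : nat -> borel X -> R,
      [/\ forall n, exp_growth (u n),
          'N[mu]_p%:E[EFin \o (u n \- f)%R]%E @[n --> \oo] --> 0%E
        & 'N[nu]_p%:E[EFin \o (second_quantization mu A B (u n) \- g)%R]%E
            @[n --> \oo] --> 0%E]].

End gaussian.

(* Main.v *)
Require Import Defs.
From HB Require Import structures.
From mathcomp Require Import all_boot all_order all_algebra sesquilinear.
From mathcomp Require Import all_classical all_reals all_analysis.
From mathcomp Require Import measurable_realfun.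
From mathcomp Require Import ring lra.

Set Implicit Arguments.
Unset Strict Implicit.
Unset Printing Implicit Defensive.

Import Order.TTheory GRing.Theory Num.Theory.
Import numFieldNormedType.Exports.

Local Open Scope classical_set_scope.
Local Open Scope ring_scope.


(** On nu x mu the pair (x, A x + B y) couples nu and mu: its second entry has law mu
    ([pair_out_law]), and Gamma(T) f is the conditional expectation of f (A x + B y) given x. Let r
    be the norm of T.

    Contraction. By duality it is enough to prove the two-function inequality
    E[F(x)^al G(A x + B y)^be] <= (E F)^al (E G)^be whenever r^2 al be <= (1 - al)(1 - be)
    ([pair_hypercontractive]). For al = 1 - 1/q, be = 1/p, F = (Gamma f)^q and G = f^p the condition
    reads r^2 (q - 1) <= p - 1, that is q <= q0, and dividing by a power of E F leaves the norm
    bound ([gamma_powR_bound]).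

    The two-function inequality is infinitesimal. For nearly constant functions, expanding to second
    order about the means leaves a quadratic form in the deviations, nonpositive because the
    correlation is at most r, and a cubic error ([one_step_ineq]). The coupling is stable: the sum
    of two independent copies has the law of sqrt 2 times one copy ([pair_stable]). So an inequality
    at scale a with error c gives one at scale sqrt 2 a with error 2 c ([hyper_double]). Starting at
    scale 2^(-n/2), where the error is o(2^-n), n doublings reach scale 1 with error o(1)
    ([hypercontractive_lipschitz]).

    The correlation bound is the Gebelein inequality ([gebelein]). On trigonometric polynomials the
    variances are quadratic forms in the kernels cosh - 1 and sinh of Gram matrices; these power
    series have nonnegative coefficients and no constant term, so Schur products carry the bound |Z
    h| <= r |W h| over to them ([kle_series]). Trigonometric polynomials are dense because linear
    combinations and bounded limits of cos and sin of functionals exhaust the bounded Borel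
    functions ([bmf_trigc]); the same fact gives uniqueness of characteristic functions.

    The Gaussian input is obtained by reading T on X as L = Qnu^(-1/2) T Qmu^(1/2) ([lift_op]): in
    the direction h, A x has variance |L Qmu^(1/2) h|^2 and B y has the complementary one
    ([version_cos], [norm_sqrt_defect]).

    Sharpness. If q > q0, take h with |W h| = 1 and z = |Z h|^2 so close to r^2 that p < 1 + (q - 1)
    z ([opnorm_approx]). For th between 1 / (1 + (q - 1) z) and 1 / p, the function exp(th <h, x>^2
    / 2) is in L^p(mu) and its image is not in L^q(nu) ([gaussian_peak_blow_up]). *)

(** * Bounded measurable functions on a probability space *)

Section bounded_measurable.
Context d {T : measurableType d} {R : realType}.
Implicit Types f g : T -> R.

Definition bmf f : Prop :=
  measurable_fun setT f /\ exists M : R, forall x, `|f x| <= M.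

Lemma bmf_cst (c : R) : bmf (fun=> c).
Proof. by split; [exact: measurable_cst | exists `|c|]. Qed.

Lemma bmfD f g : bmf f -> bmf g -> bmf (fun x => f x + g x).
Proof.
move=> [mf [M fM]] [mg [N gN]]; split; first exact: measurable_funD.
by exists (M + N) => x; rewrite (le_trans (ler_normD _ _))// lerD.
Qed.

Lemma bmfM f g : bmf f -> bmf g -> bmf (fun x => f x * g x).
Proof.
move=> [mf [M fM]] [mg [N gN]]; split; first exact: measurable_funM.
by exists (M * N) => x; rewrite normrM ler_pM.
Qed.

Lemma bmfZ (c : R) f : bmf f -> bmf (fun x => c * f x).
Proof. by move=> ?; apply: bmfM => //; exact: bmf_cst. Qed.

Lemma bmfN f : bmf f -> bmf (fun x => - f x).
Proof.
by move=> /(bmfZ (-1)); under eq_fun do rewrite mulN1r.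
Qed.

Lemma bmfB f g : bmf f -> bmf g -> bmf (fun x => f x - g x).
Proof. by move=> bf bg; apply: bmfD => //; exact: bmfN. Qed.

Lemma bmfX f n : bmf f -> bmf (fun x => f x ^+ n).
Proof.
move=> bf; elim: n => [|n ih]; first by under eq_fun do rewrite expr0; exact: bmf_cst.
by under eq_fun do rewrite exprS; exact: bmfM.
Qed.

Lemma bmf_norm f : bmf f -> bmf (fun x => `|f x|).
Proof.
move=> [mf [M fM]]; split; first exact: measurableT_comp.
by exists M => x; rewrite normr_id.
Qed.

Lemma bmf_sum I (s : seq I) (F : I -> T -> R) : (forall i, bmf (F i)) ->
  bmf (fun x => \sum_(i <- s) F i x).
Proof.
move=> bF; elim: s => [|i s ih].
  by under eq_fun do rewrite big_nil; exact: bmf_cst.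
by under eq_fun do rewrite big_cons; exact: bmfD.
Qed.

Lemma bmf_cos f : measurable_fun setT f -> bmf (fun x => cos (f x)).
Proof.
move=> mf; split.
  have mc : measurable_fun setT (@cos R) by apply: continuous_measurable_fun; exact: continuous_cos.
  exact: measurableT_comp mc mf.
by exists 1 => x; rewrite ler_norml cos_geN1 cos_le1.
Qed.

Lemma bmf_sin f : measurable_fun setT f -> bmf (fun x => sin (f x)).
Proof.
move=> mf; split.
  have mc : measurable_fun setT (@sin R) by apply: continuous_measurable_fun; exact: continuous_sin.
  exact: measurableT_comp mc mf.
by exists 1 => x; rewrite ler_norml sin_geN1 sin_le1.
Qed.

Lemma bmf_comp d' (T' : measurableType d') (h : T' -> R) (k : T -> T') :
  measurable_fun setT k -> measurable_fun setT h /\ (exists M : R, forall x, `|h x| <= M) -> bmf (fun x => h (k x)).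
Proof.
move=> mk [mh [M hM]]; split; first exact: measurableT_comp.
by exists M => x.
Qed.

Lemma bmf_powR f (p : R) : 0 <= p -> (forall x, 0 <= f x) -> bmf f ->
  bmf (fun x => f x `^ p).
Proof.
move=> p0 f0 [mf [M fM]]; split.
  exact: (measurableT_comp (measurable_powR p) mf).
exists (M `^ p) => x; rewrite ger0_norm ?powR_ge0//.
have fxM : f x <= M by rewrite (le_trans (ler_norm _)).
by apply: ge0_ler_powR => //; rewrite nnegrE// (le_trans (f0 x)).
Qed.

Lemma bmf_cvg (F : nat -> T -> R) f (M : R) :
  (forall n, measurable_fun setT (F n)) -> (forall n x, `|F n x| <= M) ->
  (forall x, F n x @[n --> \oo] --> f x) -> bmf f.
Proof.
move=> mF FM Ff; split.
  by apply: (@measurable_fun_cvg _ _ _ _ F f) => // x _; exact: Ff.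
exists M => x.
have /cvg_norm h := Ff x; have := cvg_lim _ h => <- //.
apply: limr_le; first by apply/cvg_ex; exists `|f x|.
exact: nearW.
Qed.

Context {P : probability T R}.

Lemma bmf_integrable f : bmf f -> P.-integrable setT (EFin \o f).
Proof.
move=> [mf [M fM]]; apply: measurable_bounded_integrable => //.
  by rewrite (@le_lt_trans _ _ 1%E) ?ltry//; exact: probability_le1.
exists M; split; first by rewrite num_real.
by move=> x Mx y _ /=; rewrite (le_trans (fM y))// ltW.
Qed.

Lemma bmf_EFin_int f : bmf f ->
  (\int[P]_x (f x)%:E)%E = (\int[P]_x f x)%:E.
Proof.
move=> bf; rewrite /Rintegral fineK//.
exact: integrable_fin_num (bmf_integrable bf).
Qed.

Lemma bmf_intD f g : bmf f -> bmf g ->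
  \int[P]_x (f x + g x) = \int[P]_x f x + \int[P]_x g x.
Proof. by move=> bf bg; rewrite RintegralD//; exact: bmf_integrable. Qed.

Lemma bmf_intB f g : bmf f -> bmf g ->
  \int[P]_x (f x - g x) = \int[P]_x f x - \int[P]_x g x.
Proof. by move=> bf bg; rewrite RintegralB//; exact: bmf_integrable. Qed.

Lemma bmf_intZ c f : bmf f -> \int[P]_x (c * f x) = c * \int[P]_x f x.
Proof. by move=> bf; rewrite RintegralZl//; exact: bmf_integrable. Qed.

Lemma prob_int_cst (c : R) : \int[P]_x c = c.
Proof. by rewrite Rintegral_cst// [X in fine X]probability_setT mulr1. Qed.

Lemma bmf_int_sum I (s : seq I) (F : I -> T -> R) : (forall i, bmf (F i)) ->
  \int[P]_x (\sum_(i <- s) F i x) = \sum_(i <- s) \int[P]_x F i x.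
Proof.
move=> bF; elim: s => [|i s ih].
  rewrite big_nil; under eq_Rintegral do rewrite big_nil.
  exact: prob_int_cst.
rewrite big_cons -ih -bmf_intD//; last exact: bmf_sum.
by apply: eq_Rintegral => x _; rewrite big_cons.
Qed.

Lemma bmf_int_le f g : bmf f -> bmf g -> (forall x, f x <= g x) ->
  \int[P]_x f x <= \int[P]_x g x.
Proof. by move=> bf bg fg; apply: le_Rintegral => //; exact: bmf_integrable. Qed.

Lemma bmf_norm_int f : bmf f -> `|\int[P]_x f x| <= \int[P]_x `|f x|.
Proof. by move=> bf; apply: le_normr_Rintegral => //; exact: bmf_integrable. Qed.

Lemma bmf_int_bound f (M : R) : bmf f -> (forall x, `|f x| <= M) ->
  `|\int[P]_x f x| <= M.
Proof.
move=> bf fM; rewrite (le_trans (bmf_norm_int bf))//.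
rewrite -[leRHS]prob_int_cst; apply: bmf_int_le => //; first exact: bmf_norm.
exact: bmf_cst.
Qed.

Lemma bmf_cvg_int (F : nat -> T -> R) f (M : R) :
  (forall n, measurable_fun setT (F n)) -> (forall n x, `|F n x| <= M) ->
  (forall x, F n x @[n --> \oo] --> f x) ->
  \int[P]_x F n x @[n --> \oo] --> \int[P]_x f x.
Proof.
move=> mF FM Ff; have bf := bmf_cvg mF FM Ff; have mf := bf.1.
have [] := @dominated_convergence _ T R P setT measurableT
  (fun n => EFin \o F n) (EFin \o f) (EFin \o cst M).
- by move=> n; exact/measurable_EFinP.
- exact/measurable_EFinP.
- by apply: aeW => x _; apply: cvg_EFin; [exact: nearW|exact: Ff].
- exact/bmf_integrable/bmf_cst.
- by apply: aeW => x n _ /=; rewrite lee_fin.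
move=> _ _ h.
have {}h : (fun n => (\int[P]_x F n x)%:E) @ \oo --> (\int[P]_x f x)%:E.
  rewrite -bmf_EFin_int//.
  apply: cvg_trans h; apply: near_eq_cvg; near=> n.
  by rewrite /= bmf_EFin_int//; split => //; exists M.
exact: fine_cvg h.
Unshelve. all: by end_near. Qed.

Lemma bmf_cauchy_schwarz f g : bmf f -> bmf g ->
  (\int[P]_x (f x * g x)) ^+ 2 <= (\int[P]_x f x ^+ 2) * (\int[P]_x g x ^+ 2).
Proof.
move=> bf bg; set a := \int[P]_x f x ^+ 2; set b := \int[P]_x _ ^+ 2.
set c := \int[P]_x _.
have key s t : 0 <= s ^+ 2 * a + 2 * s * t * c + t ^+ 2 * b.
  have -> : s ^+ 2 * a + 2 * s * t * c + t ^+ 2 * b =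
      \int[P]_x (s * f x + t * g x) ^+ 2.
    rewrite -!bmf_intZ//; try exact: bmfX; try exact: bmfM.
    rewrite -!bmf_intD//; do ?[apply: bmfD|apply: bmfZ|exact: bmfX|exact: bmfM].
    by apply: eq_Rintegral => x _; ring.
  by apply: Rintegral_ge0 => x _; exact: sqr_ge0.
have a0 : 0 <= a by apply: Rintegral_ge0 => x _; exact: sqr_ge0.
have b0 : 0 <= b by apply: Rintegral_ge0 => x _; exact: sqr_ge0.
have [b00|bN0] := eqVneq b 0.
  have [c0|cN0] := eqVneq c 0; first by rewrite c0 expr0n mulr_ge0.
  (* With b = 0 the form is affine in t; at this t it would equal -1. *)
  have := key 1 (- (a + 1) / (2 * c)).
  rewrite b00 mulr0 addr0 expr1n !mul1r mulr1.
  have -> : 2 * (- (a + 1) / (2 * c)) * c = - (a + 1) by field.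
  lra.
have := key b (- c).
have bp : 0 < b by rewrite lt_def bN0.
have -> : b ^+ 2 * a + 2 * b * - c * c + (- c) ^+ 2 * b =
  b * (a * b - c ^+ 2) by ring.
by rewrite pmulr_rge0// subr_ge0.
Qed.

End bounded_measurable.
Arguments bmf {d T R} f.

Ltac bmf_auto := solve [repeat first
  [ assumption | exact: bmf_cst | apply: bmfD | apply: bmfB | apply: bmfN
  | apply: bmf_norm | apply: bmfX | apply: bmfM ]].

(** * Fubini for bounded functions and real-valued integrals *)

Section bounded_fubini.
Context d1 d2 {T1 : measurableType d1} {T2 : measurableType d2} {R : realType}.
Context {P1 : probability T1 R} {P2 : probability T2 R}.
Variable f : T1 * T2 -> R.
Hypothesis bf : bmf f.

Let prod_int : (P1 \x P2)%E.-integrable setT (EFin \o f).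
Proof. exact: bmf_integrable. Qed.

Lemma bmf_pair1 x : bmf (fun y => f (x, y)).
Proof. by apply: bmf_comp => //; exact: measurable_pair1. Qed.

Lemma bmf_pair2 y : bmf (fun x => f (x, y)).
Proof. by apply: bmf_comp => //; exact: measurable_pair2. Qed.

Lemma bmf_int1 : bmf (fun x => \int[P2]_y f (x, y)).
Proof.
split.
  apply/measurable_EFinP.
  have := measurable_fubini_F (m1 := P1) (m2 := P2) prod_int.
  rewrite /fubini_F; apply: eq_measurable_fun => x _ /=.
  by rewrite bmf_EFin_int//; exact: bmf_pair1.
have [_ [M fM]] := bf; exists M => x; apply: bmf_int_bound => //; exact: bmf_pair1.
Qed.

Lemma bmf_int2 : bmf (fun y => \int[P1]_x f (x, y)).
Proof.
split.
  apply/measurable_EFinP.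
  have := measurable_fubini_G (m1 := P1) (m2 := P2) prod_int.
  rewrite /fubini_G; apply: eq_measurable_fun => x _ /=.
  by rewrite bmf_EFin_int//; exact: bmf_pair2.
have [_ [M fM]] := bf; exists M => x; apply: bmf_int_bound => //; exact: bmf_pair2.
Qed.

Lemma bmf_fubini1 :
  \int[(P1 \x P2)%E]_z f z = \int[P1]_x \int[P2]_y f (x, y).
Proof.
apply: EFin_inj; rewrite -[LHS](bmf_EFin_int bf).
apply: etrans; first exact: (esym (integral12_prod_meas1 prod_int)).
rewrite -[RHS](bmf_EFin_int bmf_int1).
by apply: eq_integral => x _; rewrite /fubini_F/= bmf_EFin_int//; exact: bmf_pair1.
Qed.

Lemma bmf_fubini2 :
  \int[(P1 \x P2)%E]_z f z = \int[P2]_y \int[P1]_x f (x, y).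
Proof.
apply: EFin_inj; rewrite -[LHS](bmf_EFin_int bf).
apply: etrans; first exact: (esym (integral21_prod_meas1 prod_int)).
rewrite -[RHS](bmf_EFin_int bmf_int2).
by apply: eq_integral => x _; rewrite /fubini_G/= bmf_EFin_int//; exact: bmf_pair2.
Qed.

End bounded_fubini.


(** * Inner product and Borel measurability on a separable Hilbert space *)

Section hilbert_basics.
Context {R : realType} {X : hilbertType R}.
Implicit Types x y z h : X.

Local Notation "<< x , y >>" := (@inner R X x y).

Lemma innerC x y : inner x y = inner y x.
Proof. by rewrite hermC expr0 mul1r. Qed.

Lemma innerDl x y z : inner (x + y) z = inner x z + inner y z.
Proof. exact: linearDl. Qed.

Lemma innerDr x y z : inner x (y + z) = inner x y + inner x z.
Proof. exact: linearDr. Qed.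

Lemma innerNl x y : inner (- x) y = - inner x y.
Proof. exact: linearNl. Qed.

Lemma innerNr x y : inner x (- y) = - inner x y.
Proof. exact: linearNr. Qed.

Lemma innerBl x y z : inner (x - y) z = inner x z - inner y z.
Proof. exact: linearBl. Qed.

Lemma innerBr x y z : inner x (y - z) = inner x y - inner x z.
Proof. exact: linearBr. Qed.

Lemma innerZl a x y : inner (a *: x) y = a * inner x y.
Proof. exact: linearZl_LR. Qed.

Lemma innerZr a x y : inner x (a *: y) = a * inner x y.
Proof. exact: linearZr_LR. Qed.

Lemma inner0l x : inner 0 x = 0.
Proof. exact: linear0l. Qed.

Lemma inner0r x : inner x 0 = 0.
Proof. exact: linear0r. Qed.

Lemma inner_suml I (s : seq I) (F : I -> X) x :
  inner (\sum_(i <- s) F i) x = \sum_(i <- s) inner (F i) x.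
Proof. exact: linear_sumlz. Qed.

Lemma inner_sumr I (s : seq I) (F : I -> X) x :
  inner x (\sum_(i <- s) F i) = \sum_(i <- s) inner x (F i).
Proof. exact: linear_sumr. Qed.

Lemma inner_self_ge0 x : 0 <= inner x x.
Proof. by rewrite inner_norm sqr_ge0. Qed.

Lemma inner_self_eq0 x : inner x x = 0 -> x = 0.
Proof. by rewrite inner_norm => /eqP; rewrite sqrf_eq0 normr_eq0 => /eqP. Qed.

Lemma cauchy_schwarz x y : `|inner x y| <= `|x| * `|y|.
Proof.
rewrite -ler_sqr ?nnegrE ?mulr_ge0// exprMn real_normK ?num_real//.
rewrite -!inner_norm.
have [y0|y0] := eqVneq y 0; first by rewrite y0 !inner0r expr0n mulr0.
have yy : 0 < inner y y by rewrite inner_norm exprn_gt0// normr_gt0.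
have := inner_self_ge0 (inner y y *: x - inner x y *: y).
rewrite (_ : inner _ _ = inner y y * (inner x x * inner y y - inner x y ^+ 2)).
  by rewrite pmulr_rge0// subr_ge0.
rewrite innerBl !innerBr !innerZl !innerZr (innerC y x); ring.
Qed.

Lemma inner_le x y : inner x y <= `|x| * `|y|.
Proof. exact: le_trans (ler_norm _) (cauchy_schwarz _ _). Qed.

Lemma inner_continuous h : continuous (fun x : X => inner h x).
Proof.
move=> x; apply/cvgrPdist_lt => e e0; near=> y.
rewrite -innerBr (le_lt_trans (cauchy_schwarz _ _))//.
rewrite (@le_lt_trans _ _ ((`|h| + 1) * `|x - y|))//.
  by rewrite ler_wpM2r// lerDl.
rewrite mulrC -ltr_pdivlMr ?ltr_wpDl//.
near: y; apply/nbhs_ballP; exists (e / (`|h| + 1)) => /=.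
  by rewrite divr_gt0// ltr_wpDl.
by move=> y; rewrite -ball_normE.
Unshelve. all: by end_near. Qed.

Lemma cvg_inner T (F : set_system T) {FF : Filter F} (u : T -> X) x h :
  u @ F --> x -> inner h (u t) @[t --> F] --> inner h x.
Proof. by move=> ux; apply: (cvg_comp _ _ ux); exact: inner_continuous. Qed.

Hypothesis hX : separable_space X.

Lemma dense_sequence : exists e : nat -> X,
  forall x (r : R), 0 < r -> exists k, `|x - e k| < r.
Proof.
have [D /countable_injP[f finj] dD] := hX.
(* At an index that no point of [D] has, [get] returns some arbitrary point; this does no harm to
   density. *)
exists (fun n => get [set x | D x /\ f x = n]) => x r r0.
have [] := dD (ball x r).
- by exists x; exact: ballxx.
- exact: ball_open.
move=> y [bxy Dy]; exists (f y).
have [Dz fz] : [set x | D x /\ f x = f y] (get [set x | D x /\ f x = f y]).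
  by apply: getPex; exists y.
by rewrite (finj _ _ _ _ fz) ?inE// -ball_normE in bxy *.
Qed.

Lemma open_measurable_borel (U : set X) : open U ->
  measurable (U : set (borel X)).
Proof. exact: sub_sigma_algebra. Qed.

Lemma measurable_to_borel d (T : measurableType d) (f : T -> borel X) :
  (forall U : set X, open U -> measurable (f @^-1` U)) ->
  measurable_fun setT f.
Proof.
move=> h; apply: (@measurability _ _ T (borel X) setT f (@open X)) => //.
by move=> _ [U oU <-]; rewrite setTI; exact: h.
Qed.

Lemma measurable_from_borel (f : borel X -> R) :
  continuous (f : X -> R) -> measurable_fun setT f.
Proof.
move=> cf; apply: (measurability _ (RGenOInfty.measurableE R)) => //.
move=> _ [_ [a ->] <-]; rewrite setTI; apply: open_measurable_borel.
by apply: open_comp => //; move=> x _; exact: cf.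
Qed.

Lemma measurable_borel_borel (f : borel X -> borel X) :
  continuous (f : X -> X) -> measurable_fun setT f.
Proof.
move=> cf; apply: measurable_to_borel => U oU; apply: open_measurable_borel.
by apply: open_comp => // x _; exact: cf.
Qed.

Lemma measurable_inner (h : X) :
  measurable_fun setT (fun x : borel X => inner h x).
Proof. apply: measurable_from_borel; exact: inner_continuous. Qed.

Lemma measurable_hnorm : measurable_fun setT (fun x : borel X => `|x : X|).
Proof. apply: measurable_from_borel; exact: norm_continuous. Qed.

Lemma measurable_hscale (a : R) :
  measurable_fun setT (fun x : borel X => (a *: (x : X) : borel X)).
Proof. apply: measurable_borel_borel; exact: scaler_continuous. Qed.

(** Separability makes addition measurable for the product of the Borel structures: the preimage of
    an open set is a countable union, over pairs of balls centred in the dense sequence whose sum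
    stays in U. *)
Lemma measurable_hadd d (T : measurableType d) (f g : T -> borel X) :
  measurable_fun setT f -> measurable_fun setT g ->
  measurable_fun setT (fun t => ((f t : X) + (g t : X) : borel X)).
Proof.
move=> mf mg; apply: measurable_to_borel => U oU.
have [e de] := dense_sequence.
pose r n : R := n.+1%:R^-1.
pose B k n : set (borel X) := ball (e k : X) (r n).
have mB k n : measurable (B k n).
  by apply: open_measurable_borel; exact: ball_open.
rewrite (_ : _ @^-1` U = \bigcup_(p in [set p : nat * nat * nat |
    forall x y, B p.1.1 p.2 x -> B p.1.2 p.2 y -> U (x + y)])
    (f @^-1` B p.1.1 p.2 `&` g @^-1` B p.1.2 p.2)).
  rewrite bigcup_mkcond; apply: countable_bigcupT_measurable => // -[[j k] n].
  case: ifP => _ //=.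
  by apply: measurableI; rewrite -[X in measurable X]setTI; [exact: mf|exact: mg].
apply/seteqP; split => t /=; last first.
  by move=> [[[j k] n] /= h [fB gB]]; exact: h.
move=> Ufg.
have : nbhs (f t + g t : X) U by exact: open_nbhs_nbhs.
move=> /nbhs_ballP[s/= s0 sU].
(* Each of the two summands moves by at most two radii, one to the centre of its ball and one away
   from it. *)
have [n nh] : exists n, r n < s / 4.
  have s4 : 0 < s / 4 by rewrite divr_gt0.
  have := @near_infty_natSinv_lt R (PosNum s4) => -[n _ /(_ n (leqnn n)) h].
  by exists n.
have rn0 : 0 < r n by rewrite invr_gt0.
have [j hj] := de (f t) (r n) rn0.
have [k hk] := de (g t) (r n) rn0.
exists (j, k, n) => /=; last first.
  by split; rewrite /B -ball_normE /ball_/= distrC.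
move=> x y; rewrite /B -!ball_normE /ball_/= => xj yk.
apply: sU; rewrite -ball_normE /ball_/=.
have -> : f t + g t - (x + y) =
  (f t - e j) + (e j - x) + ((g t - e k) + (e k - y)) :> X.
  by rewrite !(addrA _ (e _)) !subrK [RHS]addrACA -opprD.
rewrite (le_lt_trans (ler_normD _ _))// (@lt_trans _ _ (2 * r n + 2 * r n))//.
  rewrite ltrD// (le_lt_trans (ler_normD _ _))// mulr_natl mulr2n ltrD//.
by move: nh rn0; clear; move: (r n) => q; lra.
Qed.

End hilbert_basics.

(** * A polynomial iteration converging to the sign *)

Section sign_iteration.
Context {R : realType}.

(** The Newton-Schulz iteration. Being polynomial, it stays inside any algebra of functions, so that
    the sign of a function with values in [-1, 1] becomes a bounded pointwise limit of elements of
    the algebra. *)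
Definition sign_step (s : R) := (3 * s - s ^+ 3) / 2.

(** The gap satisfies 1 - [sign_step t] = (1 - t) (1 - t)(2 + t) / 2, and the factor (1 - t)(2 + t)
    / 2 is at most 1 - s / 2 once t >= s, which holds because the iterates increase. *)
Lemma sign_step_iter n (s : R) : 0 < s <= 1 ->
  s <= iter n sign_step s <= 1 /\
  1 - iter n sign_step s <= (1 - s / 2) ^+ n.
Proof.
move=> /andP[s0 s1]; elim: n => [|n [/andP[ih1 ih2] ih3]] /=.
  by rewrite lexx s1 expr0; split => //; rewrite lerBlDr lerDl ltW.
set t := iter n _ s in ih1 ih2 ih3 *.
have t0 : 0 < t by exact: lt_le_trans s0 ih1.
have E : 1 - sign_step t = (1 - t) * ((1 - t) * (2 + t) / 2).
  by rewrite /sign_step; field.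
have le2 : sign_step t <= 1.
  by rewrite -subr_ge0 E; rewrite mulr_ge0 ?subr_ge0// divr_ge0// mulr_ge0 ?subr_ge0// addr_ge0// ltW.
have le1 : t <= sign_step t.
  rewrite -subr_ge0 (_ : _ - t = t * (1 - t) * (1 + t) / 2); last by rewrite /sign_step; field.
  by rewrite divr_ge0// !mulr_ge0 ?subr_ge0 ?addr_ge0// ltW.
rewrite (le_trans ih1 le1) le2; split => //.
rewrite E exprSr ler_pM// ?subr_ge0//.
  by rewrite divr_ge0// mulr_ge0 ?subr_ge0// addr_ge0// ltW.
nra.
Qed.

Lemma sign_stepN n (s : R) : iter n sign_step (- s) = - iter n sign_step s.
Proof. by elim: n => //= n ->; rewrite /sign_step; field. Qed.

Lemma sign_step0 n : iter n sign_step (0 : R) = 0.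
Proof. by elim: n => //= n ->; rewrite /sign_step expr0n/= mulr0 subr0 mul0r. Qed.

Lemma sign_step_bound n (s : R) : `|s| <= 1 -> `|iter n sign_step s| <= 1.
Proof.
have [s0|s0|<-] := ltgtP 0 s.
- move=> s1; rewrite gtr0_norm// in s1.
  have [/andP[h1 h2] _] := @sign_step_iter n s (introT andP (conj s0 s1)).
  by rewrite ger0_norm// (le_trans _ h1)// ltW.
- move=> s1; rewrite ltr0_norm// in s1.
  have s0' : 0 < - s by rewrite oppr_gt0.
  have [/andP[h1 h2] _] := @sign_step_iter n (- s) (introT andP (conj s0' s1)).
  by rewrite -(opprK s) sign_stepN normrN ger0_norm// (le_trans _ h1)// ltW.
- by rewrite sign_step0 normr0.
Qed.

Lemma sign_step_cvg_pos (s : R) : 0 < s <= 1 ->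
  iter n sign_step s @[n --> \oo] --> (1 : R).
Proof.
move=> s01; have /andP[s0 s1] := s01.
apply/cvgrPdist_le => e e0.
have h : (1 - s / 2) ^+ n @[n --> \oo] --> (0 : R).
  apply: cvg_expr; rewrite ger0_norm; lra.
move/cvgrPdist_le : h => /(_ e e0); apply: filterS => n.
rewrite sub0r normrN => h.
have [/andP[h1 h2] h3] := @sign_step_iter n s s01.
rewrite ger0_norm ?subr_ge0// (le_trans h3)// (le_trans _ h)//; exact: ler_norm.
Qed.

Lemma sign_step_cvg (s : R) : `|s| <= 1 ->
  iter n sign_step s @[n --> \oo] --> Num.sg s.
Proof.
have [s0|s0|<-] := ltgtP 0 s.
- move=> s1; rewrite gtr0_norm// in s1; rewrite gtr0_sg//.
  by apply: sign_step_cvg_pos; rewrite s0.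
- move=> s1; rewrite ltr0_norm// in s1; rewrite ltr0_sg//.
  under eq_fun do rewrite -[s in iter _ _ s]opprK sign_stepN.
  by apply: cvgN; apply: sign_step_cvg_pos; rewrite oppr_gt0 s0.
- move=> _; rewrite sgr0; under eq_fun do rewrite sign_step0; exact: cvg_cst.
Qed.

End sign_iteration.

(** * Trigonometric functions generate all bounded Borel functions *)

Section trigonometric_class.
Context {R : realType} {X : hilbertType R}.
Implicit Types f g : borel X -> R.

(** The clauses are those that an identity between integrals survives, so induction on [trigc]
    proves such identities from characteristic functions. Stability under products is derived
    ([trigcM]) rather than imposed, which keeps the induction principle strong. *)
Inductive trigc : (borel X -> R) -> Prop :=
| trigc_cos h : trigc (fun x => cos (inner h x))
| trigc_sin h : trigc (fun x => sin (inner h x))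
| trigcD f g : trigc f -> trigc g -> trigc (fun x => f x + g x)
| trigcZ c f : trigc f -> trigc (fun x => c * f x)
| trigc_lim (F : nat -> borel X -> R) f (M : R) : (forall n, trigc (F n)) ->
    (forall n x, `|F n x| <= M) ->
    (forall x, F n x @[n --> \oo] --> f x) -> trigc f.

Lemma trigc_ext f g : (forall x, f x = g x) -> trigc f -> trigc g.
Proof. by move=> /funext ->. Qed.

Lemma trigc_cst c : trigc (fun=> c).
Proof.
apply: trigc_ext (trigcZ c (trigc_cos 0)) => x.
by rewrite inner0l cos0 mulr1.
Qed.

Lemma trigc_bmf f : trigc f -> bmf f.
Proof.
elim => {f} [h|h|f g _ bf _ bg|c f _ bf|F f M _ bF FM Ff].
- by apply: bmf_cos; exact: measurable_inner.
- by apply: bmf_sin; exact: measurable_inner.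
- exact: bmfD.
- exact: bmfZ.
- apply: (bmf_cvg (F := F) (M := M)) => // n; exact: (bF n).1.
Qed.

Lemma trigc_bound f : trigc f -> exists M : R, forall x, `|f x| <= M.
Proof. by move=> /trigc_bmf[]. Qed.

(** Product-to-sum formulas settle the generators; the other clauses commute with multiplication by
    a fixed bounded function. *)
Lemma trigc_cosM h g : trigc g -> trigc (fun x => cos (inner h x) * g x).
Proof.
elim => {g} [k|k|f g _ tf _ tg|c f _ tf|F f M _ tF FM Ff].
- apply: trigc_ext (trigcD (trigcZ (1 / 2) (trigc_cos (h - k)))
    (trigcZ (1 / 2) (trigc_cos (h + k)))) => x.
  by rewrite innerBl innerDl cosB cosD; field.
- apply: trigc_ext (trigcD (trigcZ (1 / 2) (trigc_sin (h + k)))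
    (trigcZ (- (1 / 2)) (trigc_sin (h - k)))) => x.
  by rewrite innerBl innerDl sinB sinD; field.
- by apply: trigc_ext (trigcD tf tg) => x; ring.
- by apply: trigc_ext (trigcZ c tf) => x; ring.
- apply: (trigc_lim (M := M) tF) => [n x|x].
    rewrite normrM -[leRHS]mul1r ler_pM//.
    by rewrite ler_norml cos_geN1 cos_le1.
  by apply: cvgM; [exact: cvg_cst|exact: Ff].
Qed.

Lemma trigc_sinM h g : trigc g -> trigc (fun x => sin (inner h x) * g x).
Proof.
elim => {g} [k|k|f g _ tf _ tg|c f _ tf|F f M _ tF FM Ff].
- apply: trigc_ext (trigcD (trigcZ (1 / 2) (trigc_sin (h + k)))
    (trigcZ (1 / 2) (trigc_sin (h - k)))) => x.
  by rewrite innerBl innerDl sinB sinD; field.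
- apply: trigc_ext (trigcD (trigcZ (1 / 2) (trigc_cos (h - k)))
    (trigcZ (- (1 / 2)) (trigc_cos (h + k)))) => x.
  by rewrite innerBl innerDl cosB cosD; field.
- by apply: trigc_ext (trigcD tf tg) => x; ring.
- by apply: trigc_ext (trigcZ c tf) => x; ring.
- apply: (trigc_lim (M := M) tF) => [n x|x].
    rewrite normrM -[leRHS]mul1r ler_pM//.
    by rewrite ler_norml sin_geN1 sin_le1.
  by apply: cvgM; [exact: cvg_cst|exact: Ff].
Qed.

Lemma trigcM f g : trigc f -> trigc g -> trigc (fun x => f x * g x).
Proof.
move=> tf tg; elim: tf => {f} [h|h|f k _ tf _ tk|c f _ tf|F f M _ tF FM Ff].
- exact: trigc_cosM.
- exact: trigc_sinM.
- by apply: trigc_ext (trigcD tf tk) => x; ring.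
- by apply: trigc_ext (trigcZ c tf) => x; ring.
- have [N gN] := trigc_bound tg.
  apply: (trigc_lim (M := M * N) tF) => [n x|x].
    by rewrite normrM ler_pM.
  by apply: cvgM; [exact: Ff|exact: cvg_cst].
Qed.

Lemma trigcB f g : trigc f -> trigc g -> trigc (fun x => f x - g x).
Proof.
by move=> tf tg; apply: trigc_ext (trigcD tf (trigcZ (-1) tg)) => x; ring.
Qed.

Lemma trigc_sum I (s : seq I) (F : I -> borel X -> R) :
  (forall i, trigc (F i)) -> trigc (fun x => \sum_(i <- s) F i x).
Proof.
move=> tF; elim: s => [|i s ih].
  by apply: trigc_ext (trigc_cst 0) => x; rewrite big_nil.
by apply: trigc_ext (trigcD (tF i) ih) => x; rewrite big_cons.
Qed.

Lemma trigc_prod I (s : seq I) (F : I -> borel X -> R) :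
  (forall i, trigc (F i)) -> trigc (fun x => \prod_(i <- s) F i x).
Proof.
move=> tF; elim: s => [|i s ih].
  by apply: trigc_ext (trigc_cst 1) => x; rewrite big_nil.
by apply: trigc_ext (trigcM (tF i) ih) => x; rewrite big_cons.
Qed.

Lemma trigc_sg_sin h (a : R) :
  trigc (fun x => Num.sg (sin (inner h x - a))).
Proof.
have s1 x : `|sin (inner h x - a)| <= 1.
  by rewrite ler_norml sin_geN1 sin_le1.
apply: (trigc_lim (F := fun n x => iter n sign_step (sin (inner h x - a)))
                  (M := 1)) => [n|n x|x].
- elim: n => [|n ih] /=.
    apply: trigc_ext (trigcB (trigcZ (cos a) (trigc_sin h))
      (trigcZ (sin a) (trigc_cos h))) => x.
    by rewrite sinB; ring.
  apply: trigc_ext (trigcB (trigcZ (3 / 2) ih)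
    (trigcZ (1 / 2) (trigcM ih (trigcM ih ih)))) => x.
  by rewrite /sign_step; field.
- exact: sign_step_bound.
- exact: sign_step_cvg.
Qed.

(** Dividing the argument by n + 1 eventually brings it into (-pi, pi), where sin has the sign of
    its argument; the sequence of signs is then stationary. *)
Lemma trigc_sg h (a : R) : trigc (fun x => Num.sg (inner h x - a)).
Proof.
apply: (trigc_lim (F := fun n x =>
  Num.sg (sin (inner (n.+1%:R^-1 *: h) x - n.+1%:R^-1 * a))) (M := 1)) => [n|n x|x].
- exact: trigc_sg_sin.
- by case: sgrP => _; rewrite ?normr0 ?normr1 ?normrN ?normr1.
- apply: cvg_near_cst.
  have [n0 hn0] : exists n0 : nat, `|inner h x - a| < n0%:R :> R.
    by exists (Num.bound `|inner h x - a|); rewrite archi_boundP.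
  exists n0 => // n /= n0n.
  rewrite innerZl -mulrBr.
  have n0' : 0 < n.+1%:R^-1 :> R by rewrite invr_gt0.
  have small : n.+1%:R^-1 * `|inner h x - a| < pi.
    rewrite (@lt_trans _ _ 1)//.
      rewrite mulrC ltr_pdivrMr// mul1r (lt_le_trans hn0)//.
      by rewrite ler_nat ltnW.
    by rewrite (@lt_le_trans _ _ 2) ?ltr1n ?pi_ge2.
  have [t0|t0|t0] := ltgtP 0 (inner h x - a).
  + rewrite (gtr0_sg t0) gtr0_sg// sin_gt0_pi// mulr_gt0//=.
    by rewrite gtr0_norm in small.
  + rewrite (ltr0_sg t0) ltr0_sg// -oppr_gt0 -sinN sin_gt0_pi//.
    rewrite -mulrN mulr_gt0 ?oppr_gt0//=.
    by rewrite ltr0_norm in small.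
  + by rewrite -t0 mulr0 sin0.
Qed.

Definition trig_set : set (set X) := [set A | trigc (\1_A : X -> R)].

Lemma trig_setC A : trig_set A -> trig_set (~` A).
Proof.
move=> tA; apply: trigc_ext (trigcB (trigc_cst 1) tA) => x.
by rewrite !indicE in_setC; case: (x \in A); rewrite ?subrr ?subr0.
Qed.

Lemma trig_set_bigcup (F : nat -> set X) :
  (forall n, trig_set (F n)) -> trig_set (\bigcup_n F n).
Proof.
move=> tF.
(* This is the indicator of the union of the first n sets. *)
have tG n : trigc (fun x => 1 - \prod_(k < n) (1 - \1_(F k) x)).
  apply: trigcB; first exact: trigc_cst.
  by apply: trigc_prod => k; apply: trigcB; [exact: trigc_cst|exact: tF].
apply: (trigc_lim (M := 1) tG) => [n x|x].
  set q := \prod_(_ < _) _.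
  have q0 : 0 <= q.
    by apply: prodr_ge0 => k _; rewrite indicE; case: (_ \in _); rewrite ?subrr ?subr0.
  have q1 : q <= 1.
    apply: numdomain.Num.Theory.prodr_ile1 => k _; rewrite indicE.
    by case: (_ \in _); rewrite ?subrr ?subr0 ?lexx ?ler01.
  by rewrite ger0_norm ?subr_ge0// lerBlDr lerDl.
apply: cvg_near_cst.
have [[m _ Fm]|nF] := pselect ((\bigcup_n F n) x).
  exists m.+1 => // n /= mn.
  rewrite (bigD1 (Ordinal mn))//= !indicE [in RHS]mem_set; last by exists m.
  by rewrite mem_set// subrr mul0r subr0.
apply: nearW => n; rewrite [RHS]indicE memNset//.
rewrite big1 ?subrr// => k _; rewrite indicE memNset ?subr0// => Fk.
by apply: nF; exists k.
Qed.

Lemma trig_set0 : trig_set set0.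
Proof. by apply: trigc_ext (trigc_cst 0) => x; rewrite indic0. Qed.

Lemma trig_set_bigcap (F : nat -> set X) :
  (forall n, trig_set (F n)) -> trig_set (\bigcap_n F n).
Proof.
move=> tF; rewrite -(setCK (\bigcap_n F n)) setC_bigcap; apply: trig_setC.
by apply: trig_set_bigcup => n; exact: trig_setC.
Qed.

Lemma trig_set_halfspace h (a : R) : trig_set [set x | inner h x <= a].
Proof.
rewrite (_ : [set _ | _] = ~` [set x | a < inner h x]); last first.
  by apply/seteqP; split => x /=; rewrite leNgt => /negP.
apply: trig_setC.
(* With s the sign, (s + s^2) / 2 is 1 if s = 1 and 0 if s is 0 or -1. *)
apply: trigc_ext (trigcZ (1 / 2) (trigcD (trigc_sg h a)
   (trigcM (trigc_sg h a) (trigc_sg h a)))) => x.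
rewrite indicE; have [t0|t0|t0] := ltgtP a (inner h x).
- by rewrite gtr0_sg ?subr_gt0// mem_set//=; field.
- by rewrite ltr0_sg ?subr_lt0// memNset/=; [field|apply/negP; rewrite -leNgt ltW].
- by rewrite -t0 subrr sgr0 memNset/=; [field|by rewrite t0 ltxx].
Qed.

Hypothesis hX : separable_space X.

(** A closed ball is a countable intersection of half-spaces with normals in the dense sequence: a
    point y = x - c with |y| > r is separated by a normal close to y itself. *)
Lemma trig_set_cball (c : X) (r : R) : 0 <= r -> trig_set [set x | `|x - c| <= r].
Proof.
move=> r0; have [e de] := dense_sequence hX.
rewrite (_ : [set _ | _] =
    \bigcap_k [set x | inner (e k) x <= r * `|e k| + inner (e k) c]).
  by apply: trig_set_bigcap => k; exact: trig_set_halfspace.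
apply/seteqP; split => x /=.
  move=> xr k _ /=; rewrite -lerBlDr -innerBr (le_trans (inner_le _ _))//.
  by rewrite mulrC ler_wpM2r.
move=> h; rewrite leNgt; apply/negP => rx.
set y := x - c in rx *.
have y0 : 0 < `|y| by exact: le_lt_trans rx.
(* With this distance d to the normal e, <e, y> >= |y|^2 - d |y| exceeds r (|y| + d) >= r |e|,
   because |y| - r = 4 d and r < |y|. *)
have d0 : 0 < (`|y| - r) / 4 by rewrite divr_gt0// subr_gt0.
have [k hk] := de y _ d0.
have := h k I; rewrite /= -lerBlDr -innerBr -/y.
apply/negP; rewrite -ltNge.
have -> : inner (e k) y = inner y y - inner (y - e k) y.
  by rewrite (innerBl y (e k)) subKr.
rewrite inner_norm.
set d := (`|y| - r) / 4 in hk d0.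
have h1 : inner (y - e k) y <= d * `|y|.
  by rewrite (le_trans (inner_le _ _))// ler_wpM2r// ltW.
have h2 : `|e k| <= `|y| + d.
  have -> : e k = y - (y - e k) by rewrite subKr.
  by rewrite (le_trans (ler_normB _ _))// lerD2l ltW.
have h3 : r * `|e k| <= r * (`|y| + d) by rewrite ler_wpM2l.
have rE : r = `|y| - 4 * d by rewrite /d; field.
move: rx r0 h1 h3; rewrite rE.
move: (inner _ _) (`|e k|) (`|y|) y0 d d0 {h2 hk rE h} => i u v v0 d d0.
nra.
Qed.

Lemma trig_set_open U : open U -> trig_set U.
Proof.
move=> oU; have [e de] := dense_sequence hX.
pose B (p : nat * nat) := [set x : X | `|x - e p.1| <= p.2.+1%:R^-1].
rewrite (_ : U = \bigcup_n if unpickle n is Some p then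
   if `[< B p `<=` U >] then B p else set0 else set0).
  apply: trig_set_bigcup => n; case: unpickle => [p|]; last exact: trig_set0.
  by case: asboolP => _; [exact: trig_set_cball|exact: trig_set0].
apply/seteqP; split => x; last first.
  move=> [n _]; case: unpickle => // p; case: asboolP => // BU; exact: BU.
move=> Ux.
have /nbhs_ballP[s/= s0 sU] : nbhs x U by exact: open_nbhs_nbhs.
have [n nh] : exists n, n.+1%:R^-1 < s / 2.
  have s2 : 0 < s / 2 by rewrite divr_gt0.
  have := @near_infty_natSinv_lt R (PosNum s2) => -[n _ /(_ n (leqnn n)) h].
  by exists n.
have n0 : 0 < n.+1%:R^-1 :> R by rewrite invr_gt0.
have [k hk] := de x _ n0.
exists (pickle (k, n)) => //; rewrite pickleK.
case: asboolP => [_|[]]; first by rewrite /B /= ltW.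
move=> y; rewrite /B /= => yk; apply: sU; rewrite -ball_normE /ball_/=.
have -> : x - y = (x - e k) - (y - e k) by rewrite opprB addrA subrK.
rewrite (le_lt_trans (ler_normB _ _))//.
move: hk yk nh; move: (n.+1%:R^-1) => q; lra.
Qed.

Lemma trig_set_measurable (A : set (borel X)) : measurable A -> trig_set A.
Proof.
have sT : @sigma_algebra X setT trig_set.
  split; first exact: trig_set0.
    by move=> B tB; rewrite setTD; exact: trig_setC.
  by move=> F tF; exact: trig_set_bigcup.
move: A; apply: smallest_sub => //.
by move=> U oU; exact: trig_set_open.
Qed.

Import HBNNSimple.

(** After a shift by the bound, f is nonnegative and hence a bounded increasing limit of simple
    functions, whose level sets are in [trig_set]. *)
Lemma bmf_trigc f : bmf f -> trigc f.
Proof.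
move=> [mf [M fM]].
pose g (x : borel X) := (f x + M)%:E.
have g0 x : (0 <= g x)%E.
  by rewrite lee_fin -lerBlDr sub0r; have := fM x; rewrite ler_norml => /andP[].
have mg : measurable_fun setT g.
  by apply/measurable_EFinP; apply: measurable_funD => //; exact: measurable_cst.
pose a := nnsfun_approx (measurableT : measurable [set: borel X]) mg.
have ta n : trigc (fun x => a n x).
  have E x : \sum_(y <- finmap.enum_fset (fset_set (range (a n))))
      y * \1_(a n @^-1` [set y]) x = a n x.
    by rewrite [RHS]fimfunE fsbig_finite.
  apply: trigc_ext E _; apply: trigc_sum => y; apply: trigcZ.
  apply: trig_set_measurable.
  exact: measurable_funPTI.
have ag n x : (a n x <= f x + M).
  rewrite -lee_fin -/(g x) nnsfun_approxE.
  by apply: le_approx => // z _; exact: g0.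
apply: trigc_ext (trigcB (trigc_lim (F := fun n x => a n x) (M := M + M) ta (f := fun x => f x + M) _ _)
  (trigc_cst M)).
- by move=> x; rewrite addrK.
- move=> n x; rewrite ger0_norm// (le_trans (ag n x))// lerD2r.
  exact: le_trans (ler_norm _) (fM x).
- move=> x; have := @cvg_nnsfun_approx _ _ _ _ (measurableT : measurable [set: borel X]) g mg
    (fun x _ => g0 x) x I.
  by move=> /fine_cvg.
Qed.

End trigonometric_class.

(** The equality of integrals passes through every clause of [trigc], the last one by bounded
    convergence, and [bmf_trigc] says that this reaches all bounded Borel functions. *)
Lemma charfun_unique d1 d2 (T1 : measurableType d1) (T2 : measurableType d2)
    (R : realType) (X : hilbertType R) (P : probability T1 R) (Q : probability T2 R)
    (v : T1 -> borel X) (w : T2 -> borel X) : separable_space X ->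
  measurable_fun setT v -> measurable_fun setT w ->
  (forall h, \int[P]_x cos (inner h (v x)) = \int[Q]_x cos (inner h (w x))) ->
  (forall h, \int[P]_x sin (inner h (v x)) = \int[Q]_x sin (inner h (w x))) ->
  forall f : borel X -> R, bmf f -> \int[P]_x f (v x) = \int[Q]_x f (w x).
Proof.
move=> hX mv mw Pc Ps f /(bmf_trigc hX).
have bv g : trigc g -> bmf (fun x => g (v x)).
  by move=> /trigc_bmf ?; exact: bmf_comp.
have bw g : trigc g -> bmf (fun x => g (w x)).
  by move=> /trigc_bmf ?; exact: bmf_comp.
elim => {f} // [f g tf ef tg eg|c f tf ef|F f M tF eF FM Ff].
- by rewrite !bmf_intD ?ef ?eg//; try exact: bv; exact: bw.
- by rewrite !bmf_intZ ?ef//; [exact: bw|exact: bv].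
- have hP := bmf_cvg_int (P := P) (fun n => (bv _ (tF n)).1)
    (fun n x => FM n (v x)) (fun x => Ff (v x)).
  have hQ := bmf_cvg_int (P := Q) (fun n => (bw _ (tF n)).1)
    (fun n x => FM n (w x)) (fun x => Ff (w x)).
  have E : (fun n => \int[P]_x F n (v x)) = (fun n => \int[Q]_x F n (w x)).
    by apply/funext => n; exact: eF.
  rewrite E in hP.
  by rewrite -(cvg_lim _ hP)// -(cvg_lim _ hQ).
Qed.

(** * Second-order estimates for powers with exponent in (0, 1) *)

Section powR_estimates.
Context {R : realType}.
Implicit Types a b s t x y : R.

Lemma powR_neg_tangent y c : 0 < y -> 0 <= c -> 1 - c * (y - 1) <= y `^ (- c).
Proof.
move=> y0 c0; rewrite /powR gt_eqF// (le_trans _ (expR_ge1Dx _))//.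
rewrite mulNr lerD2l lerN2 ler_wpM2l//.
have := @le_ln1Dx R (y - 1); rewrite subrKC; apply.
by rewrite ltrBrDl subrr.
Qed.

(** Young's inequality for y^a and 1, with exponents 1 / a and 1 / (1 - a). *)
Lemma powR_le_tangent y a : 0 <= y -> 0 < a < 1 -> y `^ a <= 1 + a * (y - 1).
Proof.
move=> y0 /andP[a0 a1].
have := @conjugate_powR R (y `^ a) 1 a^-1 (1 - a)^-1 (powR_ge0 _ _) ler01.
rewrite !invr_gt0 a0 subr_gt0 a1 !invrK subrKC => /(_ isT isT erefl).
rewrite mulr1 -powRrM mulfV ?gt_eqF// powRr1// powR1.
by move=> /le_trans; apply; lra.
Qed.

Lemma powR_neg_le y c : 1 <= y -> 0 < c < 1 ->
  y `^ (- c) <= 1 - c * (y - 1) + c * (1 + c) * (y - 1) ^+ 2.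
Proof.
move=> y1 /andP[c0 c1]; have y0 : 0 < y by exact: lt_le_trans y1.
have yc : 0 < y `^ c by rewrite powR_gt0.
(* The tangent bound at 1 / y; taking reciprocals turns it into an upper bound for the negative
   power. *)
have h : 1 + c * ((y - 1) / y) <= y `^ c.
  have := @powR_neg_tangent y^-1 c; rewrite invr_gt0 y0 (ltW c0) => /(_ isT isT).
  rewrite -powR_inv1 ?(ltW y0)// -powRrM mulN1r opprK.
  apply: le_trans; rewrite powR_inv1 ?(ltW y0)//.
  rewrite (_ : (y - 1) / y = 1 - y^-1); first by lra.
  by rewrite mulrBl divff ?gt_eqF// mul1r.
have D0 : 0 < 1 - c * (y - 1) + c * (1 + c) * (y - 1) ^+ 2.
  have := mulr_ge0 (ltW c0) (sqr_ge0 (y - 1 - 1 / 2)).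
  have := sqr_ge0 (c * (y - 1)).
  nra.
rewrite powRN invf_ple ?posrE//.
apply: le_trans h; rewrite -[_^-1]mul1r ler_pdivrMr//.
have q0 : 0 <= (y - 1) / y by rewrite divr_ge0 ?subr_ge0// ltW.
set q := (y - 1) / y in q0 *.
have -> : y - 1 = q * y by rewrite /q divfK ?gt_eqF.
have qy : q * y = y - 1 by rewrite /q divfK ?gt_eqF.
rewrite qy.
have -> : (1 + c * q) * (1 - c * (y - 1) + c * (1 + c) * (y - 1) ^+ 2) =
  1 + c * (q - (y - 1) + (1 + c) * (y - 1) ^+ 2 - c * q * (y - 1)) +
   c * q * (c * (1 + c) * (y - 1) ^+ 2) by ring.
have e1 : q - (y - 1) = - (q * (y - 1)) by rewrite -qy; rewrite -{1}[q]mulr1 -mulrBr -opprB mulrN; congr (- (_ * _)).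
rewrite e1.
have h1 : q * (y - 1) <= (y - 1) ^+ 2.
  by rewrite expr2 ler_wpM2r ?subr_ge0// -qy ler_peMr.
have h2 : 0 <= c * q * (c * (1 + c) * (y - 1) ^+ 2).
  have c0' := ltW c0; have c2 := sqr_ge0 (y - 1); have c3 : 0 <= 1 + c by lra.
  exact: (mulr_ge0 (mulr_ge0 c0' q0) (mulr_ge0 (mulr_ge0 c0' c3) c2)).
have h3 : 0 <= c * (- (q * (y - 1)) + (1 + c) * (y - 1) ^+ 2 - c * q * (y - 1)).
  apply: mulr_ge0; first exact: ltW.
  rewrite (_ : _ - _ = (1 + c) * ((y - 1) ^+ 2 - q * (y - 1))); last by ring.
  by rewrite mulr_ge0 ?subr_ge0// addr_ge0// ltW.
lra.
Qed.

(** The cubic coefficient [e] is taken 1 to the right of 1 and 0 to the left, where the quadratic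
    part alone already dominates the power. *)
Let taylor_poly a (e : R) : {poly R} := 1%:P + a *: ('X - 1%:P)
  - (a * (1 - a) / 2) *: ('X - 1%:P) ^+ 2 + e *: ('X - 1%:P) ^+ 3.

Let taylor_deriv a e y : 0 < y ->
  is_derive y 1 (fun z => (taylor_poly a e).[z] - z `^ a)
   (a - a * (1 - a) * (y - 1) + 3 * e * (y - 1) ^+ 2 - a * y `^ (- (1 - a))).
Proof.
move=> y0; have dp := is_derive_poly (taylor_poly a e) y.
have := is_deriveB dp (is_derive1_powR a y0).
move=> /is_derive_eq; apply.
rewrite opprB; congr (_ - _).
rewrite /taylor_poly !poly.derivE !hornerE/=.
by field.
Qed.

(** The mean value theorem for the Taylor polynomial minus the power: the sign of its derivative
    follows from the first-order bounds on y^(a - 1), [powR_neg_le] right of 1 and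
    [powR_neg_tangent] left of 1. *)
Lemma powR_taylor2 s a : -1 < s -> 0 < a < 1 ->
  (1 + s) `^ a <= 1 + a * s - a * (1 - a) / 2 * s ^+ 2 + `|s| ^+ 3.
Proof.
move=> s1 a01; have /andP[a0 a1] := a01.
have c01 : 0 < 1 - a < 1 by rewrite subr_gt0 a1 ltrBlDr ltrDl.
have y0 : 0 < 1 + s by rewrite -ltrBlDl sub0r.
have G1 e : (taylor_poly a e).[1] - 1 `^ a = 0.
  by rewrite powR1 /taylor_poly !hornerE/=; field.
have GE e : (taylor_poly a e).[1 + s] =
    1 + a * s - a * (1 - a) / 2 * s ^+ 2 + e * s ^+ 3.
  by rewrite /taylor_poly !hornerE/=; field.
have cG e p q : 0 < p ->
    {within `[p, q], continuous (fun z => (taylor_poly a e).[z] - z `^ a)}.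
  move=> p0; apply: derivable_within_continuous => z; rewrite in_itv/= => /andP[pz _].
  by have [] := @taylor_deriv a e z (lt_le_trans p0 pz).
have [s0|s0|<-] := ltgtP 0 s.
- have ys : 1 < 1 + s by rewrite ltrDl.
  have [|c cI] := @MVT R (fun z => (taylor_poly a 1).[z] - z `^ a) (fun y => a - a * (1 - a) * (y - 1) + 3 * 1 * (y - 1) ^+ 2 - a * y `^ (- (1 - a))) 1 (1 + s) ys _ (cG 1 _ (1 + s) ltr01).
    move=> c; rewrite in_itv/= => /andP[c0 _].
    exact: (@taylor_deriv a 1 c (lt_trans ltr01 c0)).
  rewrite G1 GE; move: cI; rewrite in_itv/= => /andP[c1 cs].
  have := @powR_neg_le c (1 - a) (ltW c1) c01.
  set w := c `^ _ => hw hM.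
  rewrite gtr0_norm//.
  have h4 : 0 <= (a - a * (1 - a) * (c - 1) + 3 * 1 * (c - 1) ^+ 2 - a * w) *
     (1 + s - 1).
    rewrite mulr_ge0//; last by lra.
    have : a * w <= a * (1 - (1 - a) * (c - 1) + (1 - a) * (1 + (1 - a)) * (c - 1) ^+ 2).
      by rewrite ler_wpM2l// ltW.
    have : a * ((1 - a) * (1 + (1 - a))) * (c - 1) ^+ 2 <= 3 * (c - 1) ^+ 2.
      rewrite ler_wpM2r ?sqr_ge0//; nra.
    lra.
  lra.
- have ys : 1 + s < 1 by rewrite gtrDl.
  have [|c cI] := @MVT R (fun z => (taylor_poly a 0).[z] - z `^ a) (fun y => a - a * (1 - a) * (y - 1) + 3 * 0 * (y - 1) ^+ 2 - a * y `^ (- (1 - a))) (1 + s) 1 ys _ (cG 0 _ 1 y0).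
    move=> c; rewrite in_itv/= => /andP[c0 _].
    exact: (@taylor_deriv a 0 c (lt_trans y0 c0)).
  rewrite G1 GE; move: cI; rewrite in_itv/= => /andP[cs c1].
  have := @powR_neg_tangent c (1 - a) (lt_trans y0 cs) (ltW (andP c01).1).
  set w := c `^ _ => hw hM.
  have h3 : 0 <= `|s| ^+ 3 by rewrite exprn_ge0.
  have h4 : (a - a * (1 - a) * (c - 1) + 3 * 0 * (c - 1) ^+ 2 - a * w) *
     (1 - (1 + s)) <= 0.
    rewrite (_ : _ * _ = a * (1 - (1 - a) * (c - 1) - w) * (- s)); last by ring.
    by rewrite mulr_le0_ge0 ?oppr_ge0 ?(ltW s0)// mulr_ge0_le0 ?(ltW a0)// subr_le0.
  lra.
- by rewrite !addr0 normr0 !expr0n/= !mulr0 !addr0 subr0 powR1.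
Qed.

Lemma powR_lipschitz (m x y a : R) : 0 < m -> m <= x -> m <= y -> 0 < a < 1 ->
  `|x `^ a - y `^ a| <= m `^ (a - 1) * `|x - y|.
Proof.
move=> m0; wlog xy : x y / y <= x => [H mx my a01|mx my a01].
  have [h|h] := leP y x; first exact: H.
  by rewrite distrC (distrC x y); apply: H => //; exact: ltW.
have /andP[a0 a1] := a01.
have y0 : 0 < y by exact: lt_le_trans my.
have x0 : 0 <= x by apply: le_trans xy; exact: ltW.
rewrite !ger0_norm ?subr_ge0//; last by rewrite ge0_ler_powR ?nnegrE ?(ltW a0)// ltW.
have h := @powR_le_tangent (x / y) a (divr_ge0 x0 (ltW y0)) a01.
have xE : x `^ a = y `^ a * (x / y) `^ a.
  by rewrite -powRM ?(ltW y0) ?divr_ge0 ?(ltW y0)// mulrC divfK ?gt_eqF.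
have yE : y `^ a = y `^ (a - 1) * y.
  by rewrite mulrC mulr_powRB1// ltW.
apply: (@le_trans _ _ (y `^ (a - 1) * (x - y))).
  rewrite xE -[X in _ - X]mulr1 -mulrBr yE -mulrA ler_wpM2l ?powR_ge0//.
  rewrite (@le_trans _ _ (y * (a * (x / y - 1))))//.
    by rewrite ler_wpM2l ?(ltW y0)// lerBlDl.
  rewrite mulrCA mulrBr mulr1 mulrCA divff ?gt_eqF// mulr1.
  by rewrite ler_piMl ?subr_ge0 ?(ltW a1).
rewrite ler_wpM2r ?subr_ge0//.
rewrite -(opprB 1 a) !powRN lef_pV2 ?posrE ?powR_gt0//.
by rewrite ge0_ler_powR ?nnegrE ?subr_ge0 ?(ltW a1) ?(ltW m0) ?(ltW y0).
Qed.

Lemma powR_subadditive (x y a : R) : 0 <= x -> 0 <= y -> 0 < a < 1 ->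
  (x + y) `^ a <= x `^ a + y `^ a.
Proof.
move=> x0 y0 /andP[a0 a1].
have [->|x1] := eqVneq x 0; first by rewrite add0r lerDr powR_ge0.
have xp : 0 < x by rewrite lt_def x1.
have s0 : 0 < x + y by rewrite ltr_pwDl.
have key z : 0 <= z -> z <= x + y -> (x + y) `^ a * (z / (x + y)) <= z `^ a.
  move=> z0 zs.
  have [->|z1] := eqVneq z 0; first by rewrite mul0r mulr0 powR_ge0.
  have -> : z `^ a = (x + y) `^ a * (z / (x + y)) `^ a.
    by rewrite -powRM ?(ltW s0) ?divr_ge0 ?(ltW s0)// mulrC divfK ?gt_eqF.
  rewrite ler_wpM2l ?powR_ge0// ger1_powR ?(ltW a1)//.
  have zp : 0 < z by rewrite lt_def z1.
  by rewrite divr_gt0//= ler_pdivrMr// mul1r.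
apply: le_trans (lerD (key x x0 _) (key y y0 _)); rewrite ?lerDl ?lerDr//.
by rewrite -mulrDr -mulrDl divff ?gt_eqF// mulr1.
Qed.

End powR_estimates.

(** * The two-function inequality up to a cubic error *)

Section one_step.
Context d {T : measurableType d} {R : realType} {P : probability T R}.
Variables (al be r : R).
Hypothesis al01 : 0 < al < 1.
Hypothesis be01 : 0 < be < 1.
Hypothesis alber : r ^+ 2 * (al * be) <= (1 - al) * (1 - be).

(** Absorbs the monomials of degree at least three produced by multiplying two second-order
    expansions. *)
Local Lemma cube_remainder (K x y : R) : 0 <= x <= K -> 0 <= y <= K -> 0 <= K ->
  x * y ^+ 2 + x * y ^+ 3 + x ^+ 2 * y + x ^+ 2 * y ^+ 2 + x ^+ 3 * y +
    x ^+ 3 * y ^+ 3 + x ^+ 3 + y ^+ 3 <= (4 + 4 * K + K ^+ 3) * (x ^+ 3 + y ^+ 3).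
Proof.
move=> /andP[x0 xK] /andP[y0 yK] K0.
have x3 : 0 <= x ^+ 3 by rewrite exprn_ge0.
have y3 : 0 <= y ^+ 3 by rewrite exprn_ge0.
have h1 : x * y ^+ 2 + x ^+ 2 * y <= x ^+ 3 + y ^+ 3.
  rewrite -subr_ge0 (_ : _ - _ = (x + y) * (x - y) ^+ 2); last by ring.
  by rewrite mulr_ge0 ?sqr_ge0// addr_ge0.
have xy0 : 0 <= x * y ^+ 2 by rewrite mulr_ge0// sqr_ge0.
have xy1 : 0 <= x ^+ 2 * y by rewrite mulr_ge0// sqr_ge0.
have h2 : x * y ^+ 3 <= K * y ^+ 3 by rewrite ler_wpM2r.
have h3 : x ^+ 3 * y <= K * x ^+ 3 by rewrite mulrC ler_wpM2r.
have h4 : x ^+ 2 * y ^+ 2 <= K * (x ^+ 3 + y ^+ 3).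
  rewrite (@le_trans _ _ (K * (x * y ^+ 2)))//.
    by rewrite expr2 -mulrA ler_wpM2r.
  by rewrite ler_wpM2l//; lra.
have h5 : x ^+ 3 * y ^+ 3 <= K ^+ 3 * y ^+ 3.
  by rewrite ler_wpM2r// lerXn2r// nnegrE.
have h6 : 0 <= K * x ^+ 3 by rewrite mulr_ge0.
have h7 : 0 <= K * y ^+ 3 by rewrite mulr_ge0.
have h8 : 0 <= K ^+ 3 * x ^+ 3 by rewrite mulr_ge0// exprn_ge0.
lra.
Qed.

Local Lemma product_taylor (K s t : R) : -1 < s -> -1 < t -> `|s| <= K -> `|t| <= K ->
  (1 + s) `^ al * (1 + t) `^ be <=
  1 + al * s + be * t + al * be * (s * t)
   - al * (1 - al) / 2 * s ^+ 2 - be * (1 - be) / 2 * t ^+ 2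
   + (4 + 4 * K + K ^+ 3) * (`|s| ^+ 3 + `|t| ^+ 3).
Proof.
move=> s1 t1 sK tK; have /andP[a0 a1] := al01; have /andP[b0 b1] := be01.
have K0 : 0 <= K by exact: le_trans sK.
have := cube_remainder (K := K) (x := `|s|) (y := `|t|); rewrite !normr_ge0 sK tK K0.
move=> /(_ isT isT isT).
have := powR_taylor2 s1 al01; have := powR_taylor2 t1 be01.
have := powR_ge0 (1 + s) al; have := powR_ge0 (1 + t) be.
set u := _ `^ al; set v := _ `^ be => v0 u0 hv hu hK.
have := ler_pM u0 v0 hu hv.
move=> /le_trans; apply.
have sx : `|s| ^+ 2 = s ^+ 2 by rewrite real_normK ?num_real.
have ty : `|t| ^+ 2 = t ^+ 2 by rewrite real_normK ?num_real.
have kle (k z : R) : 0 <= k <= 1 -> k * z <= `|z|.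
  move=> /andP[k0 k1]; rewrite (le_trans (ler_norm _))// normrM ger0_norm//.
  by rewrite ler_piMl.
move: hK; rewrite -sx -ty; set p := al * (1 - al) / 2; set q := be * (1 - be) / 2.
have p01 : 0 <= p <= 1 by apply/andP; rewrite /p; split; nra.
have q01 : 0 <= q <= 1 by apply/andP; rewrite /q; split; nra.
have e1 : (al * q) * (- s) <= `|s|.
  by rewrite -(normrN s) kle//; move: q01 => /andP[q0 q1]; rewrite mulr_ge0 ?(ltW a0)//= mulr_ile1// ltW.
have e2 : al * s <= `|s| by rewrite kle// (ltW a0) (ltW a1).
have e3 : (p * be) * (- t) <= `|t|.
  by rewrite -(normrN t) kle//; move: p01 => /andP[p0 p1]; rewrite mulr_ge0 ?(ltW b0)//= mulr_ile1// ltW.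
have e4 : be * t <= `|t| by rewrite kle// (ltW b0) (ltW b1).
move: p01 q01 => /andP[p0 p1] /andP[q0 q1].
move: (normr_ge0 s) (normr_ge0 t) e1 e2 e3 e4; move: `|s| `|t| => x y x0 y0 e1 e2 e3 e4 hK.
have x2 := sqr_ge0 x; have y2 := sqr_ge0 y.
have x3 : 0 <= x ^+ 3 by rewrite exprn_ge0.
have y3 : 0 <= y ^+ 3 by rewrite exprn_ge0.
have f1 := ler_wpM2r y2 e1; have f2 := ler_wpM2r y3 e2.
have f3 := ler_wpM2l x2 e3; have f4 := ler_wpM2l x3 e4.
have f5 : p * q * (x ^+ 2 * y ^+ 2) <= x ^+ 2 * y ^+ 2.
  by rewrite ler_piMl ?mulr_ge0// mulr_ile1.
have f6 : 0 <= p * (x ^+ 2 * y ^+ 3) := mulr_ge0 p0 (mulr_ge0 x2 y3).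
have f7 : 0 <= q * (x ^+ 3 * y ^+ 2) := mulr_ge0 q0 (mulr_ge0 x3 y2).
rewrite (_ : (1 + al * s - p * x ^+ 2 + x ^+ 3) * (1 + be * t - q * y ^+ 2 + y ^+ 3) =
  1 + al * s + be * t + al * be * (s * t) - p * x ^+ 2 - q * y ^+ 2 + x ^+ 3 + y ^+ 3
  + al * q * - s * y ^+ 2 + al * s * y ^+ 3 + x ^+ 2 * (p * be * - t)
  + x ^+ 3 * (be * t) + p * q * (x ^+ 2 * y ^+ 2) - p * (x ^+ 2 * y ^+ 3)
  - q * (x ^+ 3 * y ^+ 2) + x ^+ 3 * y ^+ 3); last by ring.
lra.
Qed.

Variables (U V : T -> R) (m M : R).
Hypothesis m0 : 0 < m.
Hypotheses (bU : bmf U) (bV : bmf V).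
Hypotheses (UmM : forall x, m <= U x <= M) (VmM : forall x, m <= V x <= M).
Let u0 := \int[P]_x U x.
Let v0 := \int[P]_x V x.
Hypothesis corUV : (\int[P]_x ((U x - u0) * (V x - v0))) ^+ 2 <=
  r ^+ 2 * ((\int[P]_x (U x - u0) ^+ 2) * (\int[P]_x (V x - v0) ^+ 2)).

Let int_mM W : bmf W -> (forall x, m <= W x <= M) -> m <= \int[P]_x W x <= M.
Proof.
move=> bW h; rewrite -{1}(prob_int_cst (P := P) m) -(prob_int_cst (P := P) M).
by rewrite !bmf_int_le//; try exact: bmf_cst; move=> x; have /andP[] := h x.
Qed.

(** [M / m] bounds the relative deviations from the means, [m ^+ 3] bounds the cubes of the means
    from below, and the powers of [M] bound the leading factor. *)
Definition one_step_cst : R :=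
  M `^ al * M `^ be * ((4 + 4 * (M / m) + (M / m) ^+ 3) / m ^+ 3).

(** Expand both powers about the means. Linear terms integrate to zero. The mixed term is at most r
    times the product of the standard deviations, and [alber] is exactly the discriminant condition
    under which the two negative square terms absorb it. Only cubes of the deviations remain. *)
Lemma one_step_ineq :
  \int[P]_x (U x `^ al * V x `^ be) <= u0 `^ al * v0 `^ be
   + one_step_cst * (\int[P]_x `|U x - u0| ^+ 3 + \int[P]_x `|V x - v0| ^+ 3).
Proof.
have /andP[a0 a1] := al01; have /andP[b0 b1] := be01.
have /andP[mu0 u0M] : m <= u0 <= M := int_mM bU UmM.
have /andP[mv0 v0M] : m <= v0 <= M := int_mM bV VmM.
have up : 0 < u0 by exact: lt_le_trans mu0.
have vp : 0 < v0 by exact: lt_le_trans mv0.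
have mM : m <= M by exact: le_trans u0M.
have Mp : 0 < M by exact: lt_le_trans mM.
pose K := M / m.
pose C := 4 + 4 * K + K ^+ 3.
have K0 : 0 <= K by rewrite divr_ge0 ?ltW.
have C0 : 0 <= C by rewrite /C; have := exprn_ge0 3 K0; lra.
pose s x := (U x - u0) / u0; pose t x := (V x - v0) / v0.
have dev (W : T -> R) (w : R) x : (forall x, m <= W x <= M) -> m <= w <= M ->
    `|(W x - w) / w| <= K.
  move=> WmM /andP[mw wM]; have w0 : 0 < w by exact: lt_le_trans mw.
  rewrite normrM normfV (gtr0_norm w0) ler_pM ?invr_ge0 ?(ltW w0)//; last first.
    by rewrite lef_pV2.
  have /andP[mWx WxM] := WmM x.
  rewrite ler_norml; apply/andP; split.
    by move: m0; lra.
  by move: m0; lra.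
have gtN1 (W : T -> R) (w : R) x : (forall x, m <= W x <= M) -> 0 < w -> -1 < (W x - w) / w.
  move=> WmM w0; rewrite ltr_pdivlMr// mulN1r ltrBrDl subrr.
  by have /andP[mWx _] := WmM x; exact: lt_le_trans mWx.
have UE x : U x `^ al = u0 `^ al * (1 + s x) `^ al.
  rewrite -powRM ?(ltW up)//; last first.
    by have := gtN1 U u0 x UmM up; rewrite /s => ?; lra.
  by congr (_ `^ _); rewrite /s; field; rewrite gt_eqF.
have VE x : V x `^ be = v0 `^ be * (1 + t x) `^ be.
  rewrite -powRM ?(ltW vp)//; last first.
    by have := gtN1 V v0 x VmM vp; rewrite /t => ?; lra.
  by congr (_ `^ _); rewrite /t; field; rewrite gt_eqF.
have U0 x : 0 <= U x by have /andP[h _] := UmM x; apply: le_trans h; exact: ltW.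
have V0 x : 0 <= V x by have /andP[h _] := VmM x; apply: le_trans h; exact: ltW.
have bUc : bmf (fun x => U x - u0) by apply: bmfB => //; exact: bmf_cst.
have bVc : bmf (fun x => V x - v0) by apply: bmfB => //; exact: bmf_cst.
have EU0 : \int[P]_x (U x - u0) = 0.
  by rewrite bmf_intB ?prob_int_cst ?subrr//; exact: bmf_cst.
have EV0 : \int[P]_x (V x - v0) = 0.
  by rewrite bmf_intB ?prob_int_cst ?subrr//; exact: bmf_cst.
pose S := \int[P]_x (U x - u0) ^+ 2; pose S' := \int[P]_x (V x - v0) ^+ 2.
pose c := \int[P]_x ((U x - u0) * (V x - v0)).
pose S3 := \int[P]_x `|U x - u0| ^+ 3; pose S3' := \int[P]_x `|V x - v0| ^+ 3.
have b3 : bmf (fun x => `|U x - u0| ^+ 3) by apply: bmfX; exact: bmf_norm.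
have b3' : bmf (fun x => `|V x - v0| ^+ 3) by apply: bmfX; exact: bmf_norm.
pose J := u0 `^ al * v0 `^ be.
have J0 : 0 <= J by rewrite mulr_ge0 ?powR_ge0.
have pt x : U x `^ al * V x `^ be <= J * (1 + (al / u0) * (U x - u0)
  + (be / v0) * (V x - v0) + (al * be / (u0 * v0)) * ((U x - u0) * (V x - v0))
  - (al * (1 - al) / 2 / u0 ^+ 2) * (U x - u0) ^+ 2
  - (be * (1 - be) / 2 / v0 ^+ 2) * (V x - v0) ^+ 2
  + (C / m ^+ 3) * (`|U x - u0| ^+ 3 + `|V x - v0| ^+ 3)).
  rewrite UE VE mulrACA -/J ler_wpM2l//.
  have := @product_taylor K (s x) (t x) (gtN1 _ _ _ UmM up) (gtN1 _ _ _ VmM vp).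
  rewrite /s /t dev//; last by rewrite mu0.
  rewrite dev//; last by rewrite mv0.
  move=> /(_ isT isT) /le_trans; apply.
  rewrite -/C (_ : C / m ^+ 3 * _ = C * ((`|U x - u0| / m) ^+ 3 + (`|V x - v0| / m) ^+ 3)); last first.
    by field; rewrite gt_eqF.
  apply: lerD.
    rewrite le_eqVlt; apply/orP; left; apply/eqP.
    by field; rewrite !gt_eqF.
  rewrite ler_wpM2l// lerD// lerXn2r ?nnegrE ?divr_ge0 ?(ltW m0)// normrM ler_wpM2l//.
    by rewrite normfV gtr0_norm// lef_pV2.
  by rewrite normfV gtr0_norm// lef_pV2.
have quad : (al * be / (u0 * v0)) * c <=
    (al * (1 - al) / 2 / u0 ^+ 2) * S + (be * (1 - be) / 2 / v0 ^+ 2) * S'.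
  set pp := al * (1 - al) / 2 / u0 ^+ 2; set qq := be * (1 - be) / 2 / v0 ^+ 2.
  set k := al * be / (u0 * v0).
  have S0 : 0 <= S by apply: Rintegral_ge0 => x _; exact: sqr_ge0.
  have S0' : 0 <= S' by apply: Rintegral_ge0 => x _; exact: sqr_ge0.
  have pp0 : 0 <= pp.
    by rewrite divr_ge0 ?sqr_ge0// divr_ge0// mulr_ge0 ?subr_ge0 ?ltW.
  have qq0 : 0 <= qq.
    by rewrite divr_ge0 ?sqr_ge0// divr_ge0// mulr_ge0 ?subr_ge0 ?ltW.
  (* Here [alber] enters; the arithmetic-geometric mean inequality for [pp * S] and [qq * S'] then
     dominates the mixed term. *)
  have kab : k ^+ 2 * r ^+ 2 <= 4 * pp * qq.
    have -> : k ^+ 2 * r ^+ 2 = (al * be) * (r ^+ 2 * (al * be)) / (u0 * v0) ^+ 2.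
      by rewrite /k; field; rewrite !gt_eqF.
    have -> : 4 * pp * qq = (al * be) * ((1 - al) * (1 - be)) / (u0 * v0) ^+ 2.
      by rewrite /pp /qq; field; rewrite !gt_eqF.
    by rewrite ler_wpM2r ?invr_ge0 ?sqr_ge0// ler_wpM2l// mulr_ge0 ?(ltW a0) ?(ltW b0).
  have Q0 : 0 <= pp * S + qq * S' by rewrite addr_ge0// mulr_ge0.
  have sq : (k * c) ^+ 2 <= (pp * S + qq * S') ^+ 2.
    rewrite (@le_trans _ _ (4 * pp * qq * (S * S')))//; last first.
      rewrite -subr_ge0 (_ : _ - _ = (pp * S - qq * S') ^+ 2) ?sqr_ge0//; ring.
    rewrite exprMn (@le_trans _ _ (k ^+ 2 * (r ^+ 2 * (S * S'))))//.
      by rewrite ler_wpM2l ?sqr_ge0.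
    by rewrite mulrA ler_wpM2r// mulr_ge0.
  rewrite leNgt; apply/negP => lt1.
  by move: sq; rewrite leNgt => /negP; apply; rewrite ltrXn2r ?nnegrE// (le_trans Q0 (ltW lt1)).
apply: (@le_trans _ _ (J * (1 + C / m ^+ 3 * (S3 + S3')))).
  rewrite (@le_trans _ _ (J * (1 + (al / u0) * 0 + (be / v0) * 0
    + (al * be / (u0 * v0)) * c - (al * (1 - al) / 2 / u0 ^+ 2) * S
    - (be * (1 - be) / 2 / v0 ^+ 2) * S' + (C / m ^+ 3) * (S3 + S3'))))//.
    apply: le_trans (bmf_int_le _ _ pt) _.
    - apply: bmfM; apply: bmf_powR => //; exact: ltW.
    - bmf_auto.
    rewrite bmf_intZ; last by bmf_auto.
    rewrite bmf_intD; [|by bmf_auto..].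
    rewrite bmf_intB; [|by bmf_auto..].
    rewrite bmf_intB; [|by bmf_auto..].
    rewrite bmf_intD; [|by bmf_auto..].
    rewrite bmf_intD; [|by bmf_auto..].
    rewrite bmf_intD; [|by bmf_auto..].
    do ![rewrite bmf_intZ; last by bmf_auto].
    by rewrite (bmf_intD b3 b3') prob_int_cst EU0 EV0.
  by rewrite ler_wpM2l// lerD2r; lra.
rewrite mulrDr mulr1 lerD2l mulrA ler_wpM2r//.
  by rewrite addr_ge0// Rintegral_ge0// => x _; rewrite exprn_ge0.
rewrite /one_step_cst -/K -/C ler_wpM2r//.
  by rewrite divr_ge0// exprn_ge0// ltW.
by rewrite ler_pM ?powR_ge0// ge0_ler_powR ?nnegrE// ?ltW// ?(lt_le_trans up)// ?(lt_le_trans vp).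
Qed.

End one_step.

(** * From infinitesimal scale to scale one by doubling a stable coupling *)

Section hypercontractive_coupling.
Context d {T : measurableType d} {R : realType} {P : probability T R}.
Context {X : hilbertType R}.
Variables (xi zeta : T -> borel X).
Hypothesis hX : separable_space X.
Hypotheses (mxi : measurable_fun setT xi) (mzeta : measurable_fun setT zeta).
Variables (al be r : R).
Hypothesis al01 : 0 < al < 1.
Hypothesis be01 : 0 < be < 1.
Hypothesis alber : r ^+ 2 * (al * be) <= (1 - al) * (1 - be).

Let add (x y : borel X) : borel X := ((x : X) + (y : X)).
Let scale (a : R) (x : borel X) : borel X := (a *: (x : X)).

Hypothesis stable : forall f g : borel X -> R, bmf f -> bmf g ->
  \int[P]_s \int[P]_t (f (add (xi s) (xi t)) * g (add (zeta s) (zeta t))) =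
  \int[P]_t (f (scale (Num.sqrt 2) (xi t)) * g (scale (Num.sqrt 2) (zeta t))).
Hypothesis correlation : forall f g : borel X -> R, bmf f -> bmf g ->
  \int[P]_t f (xi t) = 0 -> \int[P]_t g (zeta t) = 0 ->
  (\int[P]_t (f (xi t) * g (zeta t))) ^+ 2 <=
  r ^+ 2 * ((\int[P]_t f (xi t) ^+ 2) * (\int[P]_t g (zeta t) ^+ 2)).
Hypothesis xi2 : P.-integrable setT (fun t => (`|xi t : X| ^+ 2)%:E).
Hypothesis zeta2 : P.-integrable setT (fun t => (`|zeta t : X| ^+ 2)%:E).

Variables (L m M : R).
Hypotheses (L0 : 0 <= L) (m0 : 0 < m).

(** The constants are fixed for the whole section because averaging preserves them ([good_avg]), so
    one error bound serves at every doubling. *)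
Definition good (f : borel X -> R) := (forall x, m <= f x <= M) /\
  (forall x y : X, `|f x - f y| <= L * `|x - y|).

Lemma good_bmf f : good f -> bmf f.
Proof.
move=> [fmM fL]; split.
  apply: measurable_from_borel => x; apply/cvgrPdist_lt => e e0.
  apply/nbhs_ballP; exists (e / (L + 1)) => /=; first by rewrite divr_gt0// ltr_wpDl.
  move=> y; rewrite -ball_normE /ball_/= => xy.
  rewrite (le_lt_trans (fL x y))// (@le_lt_trans _ _ ((L + 1) * `|x - y|))//.
    by rewrite ler_wpM2r// lerDl.
  by rewrite mulrC -ltr_pdivlMr// ltr_wpDl.
exists M => x; have /andP[fm fM] := fmM x.
by rewrite ger0_norm// (le_trans _ fm)// ltW.
Qed.

Lemma bmf_shift (f : borel X -> R) (w : T -> borel X) (u : X) (a : R) :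
  measurable_fun setT w -> bmf f -> bmf (fun t => f (add u (scale a (w t)))).
Proof.
move=> mw bf; apply: bmf_comp => //.
apply: measurable_hadd => //.
exact: (measurableT_comp (measurable_hscale a) mw).
Qed.

Lemma bmf_shift_borel (f : borel X -> R) (u : X) (a : R) :
  bmf f -> bmf (fun x => f (add u (scale a x))).
Proof.
move=> bf; apply: bmf_comp => //.
apply: measurable_hadd => //; exact: measurable_hscale.
Qed.

Definition avg (w : T -> borel X) (a : R) (f : borel X -> R) : borel X -> R :=
  fun u => \int[P]_t f (add u (scale a (w t))).

Lemma good_avg (w : T -> borel X) (a : R) f : measurable_fun setT w ->
  good f -> good (avg w a f).
Proof.
move=> mw gf; have bf := good_bmf gf; have [fmM fL] := gf.
have bs u : bmf (fun t => f (add u (scale a (w t)))) by exact: bmf_shift.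
split => [x|x y].
  rewrite -{1}(prob_int_cst (P := P) m) -(prob_int_cst (P := P) M).
  by rewrite !bmf_int_le//; try exact: bmf_cst; move=> t; have /andP[] := fmM (add x (scale a (w t))).
rewrite /avg -bmf_intB//; apply: bmf_int_bound; first exact: bmfB.
move=> t; rewrite (le_trans (fL _ _))//.
by rewrite /add opprD addrACA subrr addr0.
Qed.

(** Quantifying over the base points [u] and [v] lets the inequality be applied conditionally on an
    earlier increment. *)
Definition hyper_at (a c : R) := forall f g, good f -> good g -> forall u v : X,
  \int[P]_t (f (add u (scale a (xi t))) `^ al * g (add v (scale a (zeta t))) `^ be)
  <= avg xi a f u `^ al * avg zeta a g v `^ be + c.

Lemma good_ge0 f x : good f -> 0 <= f x.
Proof. by move=> [/(_ x)/andP[fm _] _]; apply: le_trans fm; exact: ltW. Qed.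

Lemma good_powR f p : 0 <= p -> good f -> bmf (fun x => f x `^ p).
Proof.
move=> p0 gf; apply: bmf_powR => //; last exact: good_bmf.
by move=> x; exact: good_ge0.
Qed.

Lemma stable_shift f g (u v : X) (a : R) : bmf f -> bmf g ->
  \int[P]_t (f (add u (scale (Num.sqrt 2 * a) (xi t))) *
             g (add v (scale (Num.sqrt 2 * a) (zeta t)))) =
  \int[P]_s \int[P]_t (f (add (add u (scale a (xi s))) (scale a (xi t))) *
             g (add (add v (scale a (zeta s))) (scale a (zeta t)))).
Proof.
move=> bf bg.
have := stable (bmf_shift_borel u a bf) (bmf_shift_borel v a bg).
have E (x y z : X) : add x (scale a (add y z)) = add (add x (scale a y)) (scale a z).
  by rewrite /add /scale scalerDr addrA.
under eq_Rintegral do under eq_Rintegral do rewrite !E.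
move=> ->; apply: eq_Rintegral => t _.
by rewrite /scale !scalerA !(mulrC a).
Qed.

(** By [stable], an increment of scale sqrt 2 a is a sum of two independent increments of scale a.
    The inequality is used for the second increment at base points shifted by the first, then for
    the first increment and the averaged functions; the errors add. *)
Lemma hyper_double a c : hyper_at a c -> hyper_at (Num.sqrt 2 * a) (2 * c).
Proof.
move=> h f g gf gg u v.
have /andP[a0 _] := al01; have /andP[b0 _] := be01.
have bf := good_bmf gf; have bg := good_bmf gg.
have bfp := good_powR (ltW a0) gf; have bgp := good_powR (ltW b0) gg.
rewrite (stable_shift u v a bfp bgp).
(* Stability of the first marginal alone, obtained with the other function equal to 1. *)
have avg2 : avg xi (Num.sqrt 2 * a) f u = avg xi a (avg xi a f) u.
  have := @stable_shift f (fun=> 1) u 0 a bf (bmf_cst 1).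
  rewrite /avg; under eq_Rintegral do rewrite mulr1.
  by under [in X in _ = X]eq_Rintegral do under eq_Rintegral do rewrite mulr1.
have avg2' : avg zeta (Num.sqrt 2 * a) g v = avg zeta a (avg zeta a g) v.
  have := @stable_shift (fun=> 1) g 0 v a (bmf_cst 1) bg.
  rewrite /avg; under eq_Rintegral do rewrite mul1r.
  by under [in X in _ = X]eq_Rintegral do under eq_Rintegral do rewrite mul1r.
rewrite avg2 avg2'.
have gf' := good_avg a mxi gf; have gg' := good_avg a mzeta gg.
rewrite mulr2n mulrDl mul1r addrA.
have bprod : bmf (fun s => avg xi a f (add u (scale a (xi s))) `^ al *
    avg zeta a g (add v (scale a (zeta s))) `^ be).
  apply: bmfM.
    exact: (bmf_shift u a mxi (good_powR (ltW a0) gf')).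
  exact: (bmf_shift v a mzeta (good_powR (ltW b0) gg')).
apply: le_trans (lerD (h _ _ gf' gg' u v) (lexx c)).
rewrite -[X in _ <= _ + X](prob_int_cst (P := P) c) -bmf_intD//; last exact: bmf_cst.
apply: bmf_int_le; last by move=> s; exact: h.
  pose F (st : T * T) :=
    f (add (add u (scale a (xi st.1))) (scale a (xi st.2))) `^ al *
    g (add (add v (scale a (zeta st.1))) (scale a (zeta st.2))) `^ be.
  suff bF : bmf F by exact: (bmf_int1 bF (P2 := P)).
  have mw (w : T -> borel X) (x : X) : measurable_fun setT w -> measurable_fun setT
      (fun st : T * T => add (add x (scale a (w st.1))) (scale a (w st.2))).
    move=> w0; apply: measurable_hadd => //; first apply: measurable_hadd => //.
      exact: measurableT_comp (measurable_hscale a) (measurableT_comp w0 measurable_fst).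
    exact: measurableT_comp (measurable_hscale a) (measurableT_comp w0 measurable_snd).
  apply: bmfM; first exact: (bmf_comp (mw _ u mxi) bfp).
  exact: (bmf_comp (mw _ v mzeta) bgp).
by apply: bmfD => //; exact: bmf_cst.
Qed.

Lemma hyper_iter n a c : hyper_at a c ->
  hyper_at (Num.sqrt 2 ^+ n * a) (2 ^+ n * c).
Proof.
move=> h; elim: n => [|n ih]; first by rewrite !expr0 !mul1r.
by rewrite !exprS -!mulrA; exact: hyper_double.
Qed.

(** With e = E|W - c|, the deviation from the mean is at most |W - c| + e, whose cube is at most 4
    |W - c|^3 + 4 e^3; and e^3 <= E|W - c|^3, since x^3 lies above its tangent at e. *)
Lemma cube_center (W : T -> R) (c : R) : bmf W ->
  \int[P]_t `|W t - \int[P]_t W t| ^+ 3 <= 8 * \int[P]_t `|W t - c| ^+ 3.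
Proof.
move=> bW; have bWc : bmf (fun t => W t - c) by apply: bmfB => //; exact: bmf_cst.
have bn := bmf_norm bWc; have bn3 := bmfX 3 bn.
pose e := \int[P]_t `|W t - c|.
have e0 : 0 <= e by apply: Rintegral_ge0.
have We : `|(\int[P]_t W t) - c| <= e.
  have -> : (\int[P]_t W t) - c = \int[P]_t (W t - c).
    by rewrite bmf_intB ?prob_int_cst//; exact: bmf_cst.
  exact: bmf_norm_int.
have e3 : e ^+ 3 <= \int[P]_t `|W t - c| ^+ 3.
  rewrite (@le_trans _ _ (\int[P]_t (3 * e ^+ 2 * `|W t - c| - 2 * e ^+ 3)))//.
    rewrite bmf_intB; [|exact: bmfZ|exact: bmf_cst].
    rewrite bmf_intZ// prob_int_cst -/e.
    by rewrite le_eqVlt; apply/orP; left; apply/eqP; ring.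
  apply: bmf_int_le => //.
    by apply: bmfB; [exact: bmfZ|exact: bmf_cst].
  move=> t; set x := `|_|; have x0 : 0 <= x by exact: normr_ge0.
  rewrite -subr_ge0 (_ : _ - _ = (x - e) ^+ 2 * (x + 2 * e)); last by ring.
  by rewrite mulr_ge0 ?sqr_ge0// addr_ge0// mulr_ge0.
rewrite (@le_trans _ _ (\int[P]_t (4 * `|W t - c| ^+ 3 + 4 * e ^+ 3)))//.
  apply: bmf_int_le => [||t].
  - by apply: bmfX; apply: bmf_norm; apply: bmfB => //; exact: bmf_cst.
  - by apply: bmfD; [exact: bmfZ|exact: bmf_cst].
  have h : `|W t - \int[P]_t W t| <= `|W t - c| + e.
    have -> : W t - (\int[P]_t W t) = (W t - c) - ((\int[P]_t W t) - c) by ring.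
    by rewrite (le_trans (ler_normB _ _))// lerD2l.
  rewrite (@le_trans _ _ ((`|W t - c| + e) ^+ 3))//.
    by rewrite lerXn2r ?nnegrE ?addr_ge0.
  set x := `|W t - c|; have x0 : 0 <= x by exact: normr_ge0.
  rewrite -subr_ge0 (_ : _ - _ = 3 * ((x - e) ^+ 2 * (x + e))); last by ring.
  by rewrite mulr_ge0// mulr_ge0 ?sqr_ge0// addr_ge0.
rewrite bmf_intD; [|exact: bmfZ|exact: bmf_cst].
rewrite bmf_intZ// prob_int_cst; lra.
Qed.

(** Only the second moment of |w| is assumed finite. Of the cube of an increment of f, two factors
    are bounded by L a |w| and the third also by [M], so that the cubic error is a^2 times a
    quantity tending to zero with a. *)
Definition third_moment (w : T -> borel X) (a : R) :=
  \int[P]_t (`|w t : X| ^+ 2 * Num.min M (L * a * `|w t : X|)).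

Let third_integrable (w : T -> borel X) (a : R) : measurable_fun setT w -> 0 <= a -> 0 <= M ->
  P.-integrable setT (fun t => (`|w t : X| ^+ 2)%:E) ->
  P.-integrable setT (fun t => (`|w t : X| ^+ 2 * Num.min M (L * a * `|w t : X|))%:E).
Proof.
move=> mw a0 M0 iw.
have mn : measurable_fun setT (fun t => `|w t : X|).
  by apply: (measurableT_comp _ mw); exact: measurable_hnorm.
apply: (le_integrable _ _ _ (integrableZl _ M iw)) => //.
  apply/measurable_EFinP; apply: measurable_funM; first exact: measurable_funX.
  apply: measurable_minr => //; apply: measurable_funM => //; exact: measurable_cst.
move=> t _ /=; rewrite lee_fin mulrC.
have h0 : 0 <= Num.min M (L * a * `|w t : X|) by rewrite le_min M0 !mulr_ge0.
by rewrite !ger0_norm ?mulr_ge0 ?sqr_ge0// ler_wpM2r ?sqr_ge0// ge_min lexx.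
Qed.

Lemma third_le (w : T -> borel X) (a : R) f (u : X) : measurable_fun setT w ->
  0 <= a -> P.-integrable setT (fun t => (`|w t : X| ^+ 2)%:E) -> good f ->
  \int[P]_t `|f (add u (scale a (w t))) - avg w a f u| ^+ 3 <=
  8 * L ^+ 2 * a ^+ 2 * third_moment w a.
Proof.
move=> mw a0 iw gf.
have bs := bmf_shift u a mw (good_bmf gf).
have M0 : 0 <= M.
  have := good_ge0 u gf; have [/(_ u)/andP[_ fM] _] := gf.
  by move=> /le_trans; apply.
rewrite (le_trans (cube_center (f u) bs))//.
have -> : 8 * L ^+ 2 * a ^+ 2 * third_moment w a = 8 * ((L * a) ^+ 2 * third_moment w a) by ring.
rewrite ler_wpM2l//.
rewrite -RintegralZl//; last exact: third_integrable.
apply: le_Rintegral => //.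
- apply: bmf_integrable; apply: bmfX; apply: bmf_norm; apply: bmfB => //; exact: bmf_cst.
- exact: (integrableZl measurableT ((L * a) ^+ 2) (third_integrable mw a0 M0 iw)).
move=> t _ /=.
set x := `|f _ - f u|.
have x1 : x <= L * a * `|w t : X|.
  have [_ fL] := gf; rewrite (le_trans (fL _ _))//.
  by rewrite /add /scale addrC addKr normrZ ger0_norm// mulrA.
have x2 : x <= M.
  have [fmM _] := gf; have /andP[p1 p2] := fmM u.
  have /andP[p3 p4] := fmM (add u (scale a (w t))).
  rewrite ler_norml; apply/andP; split; move: m0; lra.
have x0 : 0 <= x by exact: normr_ge0.
have x3 : x <= Num.min M (L * a * `|w t : X|) by rewrite le_min x1 x2.
rewrite exprSr mulrA -exprMn ler_pM ?exprn_ge0//.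
by rewrite lerXn2r// nnegrE// !mulr_ge0.
Qed.

Definition base_cst := one_step_cst al be m M * (8 * L ^+ 2).

Lemma hyper_base a : 0 <= a ->
  hyper_at a (base_cst * (a ^+ 2 * (third_moment xi a + third_moment zeta a))).
Proof.
move=> a0 f g gf gg u v.
have bU := bmf_shift u a mxi (good_bmf gf).
have bV := bmf_shift v a mzeta (good_bmf gg).
have UmM t := gf.1 (add u (scale a (xi t))).
have VmM t := gg.1 (add v (scale a (zeta t))).
apply: le_trans (one_step_ineq al01 be01 alber m0 bU bV UmM VmM _) _.
  apply: (@correlation (fun x => f (add u (scale a x)) - avg xi a f u)
    (fun x => g (add v (scale a x)) - avg zeta a g v)).
  - by apply: bmfB; [exact: bmf_shift_borel (good_bmf gf)|exact: bmf_cst].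
  - by apply: bmfB; [exact: bmf_shift_borel (good_bmf gg)|exact: bmf_cst].
  - by rewrite bmf_intB ?prob_int_cst ?subrr//; exact: bmf_cst.
  - by rewrite bmf_intB ?prob_int_cst ?subrr//; exact: bmf_cst.
rewrite -/(avg xi a f u) -/(avg zeta a g v) lerD2l.
have mM : m <= M by have /andP[h1 h2] := gf.1 u; exact: le_trans h2.
rewrite /base_cst -mulrA ler_wpM2l//.
  have q0 : 0 <= M / m by rewrite divr_ge0 ?(ltW m0)// (le_trans _ mM)// ltW.
  rewrite /one_step_cst !mulr_ge0 ?powR_ge0// ?invr_ge0 ?exprn_ge0 ?(ltW m0)//.
  by have := exprn_ge0 3 q0; lra.
have := third_le u mxi a0 xi2 gf; have := third_le v mzeta a0 zeta2 gg.
lra.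
Qed.

Lemma third_cvg (w : T -> borel X) (a : R^nat) : measurable_fun setT w -> 0 <= M ->
  (forall n, 0 <= a n) -> a @ \oo --> (0 : R) ->
  P.-integrable setT (fun t => (`|w t : X| ^+ 2)%:E) ->
  third_moment w (a n) @[n --> \oo] --> (0 : R).
Proof.
move=> mw M0 a0 ca iw.
pose F n t := (`|w t : X| ^+ 2 * Num.min M (L * a n * `|w t : X|))%:E.
have iF n : P.-integrable setT (F n) by exact: third_integrable.
have [] := @dominated_convergence _ T R P setT measurableT F (cst 0%E)
  (fun t => (M%:E * (`|w t : X| ^+ 2)%:E)%E).
- by move=> n; exact: measurable_int (iF n).
- exact: measurable_cst.
- apply: aeW => t _; rewrite /F; apply: cvg_EFin; first exact: nearW.
  rewrite /= -[X in _ --> X](mulr0 (`|w t : X| ^+ 2)); apply: cvgM; first exact: cvg_cst.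
  apply: (@squeeze_cvgr _ _ _ _ (cst 0) (fun n => L * a n * `|w t : X|)).
  + near=> n; rewrite le_min M0 !mulr_ge0//= ge_min lexx orbT//.
  + exact: cvg_cst.
  + have h : L * a n * `|w t : X| @[n --> \oo] --> L * 0 * `|w t : X|.
      by apply: cvgM; [apply: cvgM => //; exact: cvg_cst|exact: cvg_cst].
    by rewrite mulr0 mul0r in h.
- exact: integrableZl.
- apply: aeW => t n _; rewrite /F/= lee_fin mulrC.
  have h0 : 0 <= Num.min M (L * a n * `|w t : X|) by rewrite le_min M0 !mulr_ge0.
  by rewrite ger0_norm ?mulr_ge0 ?sqr_ge0// ler_wpM2r ?sqr_ge0// ge_min lexx.
move=> _ _; rewrite integral_cst// mul0e => h.
exact: (fine_cvg h).
Unshelve. all: by end_near. Qed.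

(** Start at a = 2^(-n/2), where [hyper_base] has error a^2 o(1). After n doublings the scale is 1
    and the error is 2^n a^2 o(1) = o(1). *)
Lemma hypercontractive_lipschitz f g : good f -> good g ->
  \int[P]_t (f (xi t) `^ al * g (zeta t) `^ be) <=
  (\int[P]_t f (xi t)) `^ al * (\int[P]_t g (zeta t)) `^ be.
Proof.
move=> gf gg.
have M0 : 0 <= M.
  have := good_ge0 0 gf; have [/(_ 0)/andP[_ fM] _] := gf.
  by move=> /le_trans; apply.
pose a n : R := (Num.sqrt 2)^-1 ^+ n.
have s2 : 0 < Num.sqrt 2 :> R by rewrite sqrtr_gt0.
have a0 n : 0 <= a n by rewrite exprn_ge0// invr_ge0 ltW.
have s2a n : Num.sqrt 2 ^+ n * a n = 1.
  by rewrite /a -exprMn divff ?gt_eqF// expr1n.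
have ca : a @ \oo --> (0 : R).
  apply: cvg_expr; rewrite ger0_norm ?invr_ge0 ?(ltW s2)//.
  by rewrite invf_lt1// -[X in X < _]sqrtr1 ltr_sqrt// ltr1n.
have E w h : avg w 1 h 0 = \int[P]_t h (w t).
  by apply: eq_Rintegral => t _; rewrite /add /scale scale1r add0r.
have key n : \int[P]_t (f (xi t) `^ al * g (zeta t) `^ be) <=
  (\int[P]_t f (xi t)) `^ al * (\int[P]_t g (zeta t)) `^ be +
  base_cst * (third_moment xi (a n) + third_moment zeta (a n)).
  have := hyper_iter n (hyper_base (a0 n)); rewrite s2a.
  move=> /(_ f g gf gg 0 0); rewrite !E.
  under eq_Rintegral do rewrite /add /scale !scale1r !add0r.
  have -> // : 2 ^+ n * (base_cst * (a n ^+ 2 * (third_moment xi (a n) + third_moment zeta (a n)))) =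
      base_cst * (third_moment xi (a n) + third_moment zeta (a n)).
  have sq2 : 2 ^+ n * a n ^+ 2 = 1.
    have {1}-> : 2 = Num.sqrt 2 ^+ 2 :> R by rewrite sqr_sqrtr.
    by rewrite -exprM mulnC exprM -exprMn s2a expr1n.
  by rewrite mulrCA; congr (_ * _); rewrite mulrA sq2 mul1r.
have h : (\int[P]_t f (xi t)) `^ al * (\int[P]_t g (zeta t)) `^ be +
  base_cst * (third_moment xi (a n) + third_moment zeta (a n)) @[n --> \oo] -->
  (\int[P]_t f (xi t)) `^ al * (\int[P]_t g (zeta t)) `^ be + base_cst * (0 + 0).
  apply: cvgD; first exact: cvg_cst.
  apply: cvgM; first exact: cvg_cst.
  by apply: cvgD; exact: third_cvg.
rewrite addr0 mulr0 addr0 in h.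
rewrite -(cvg_lim _ h)//; apply: limr_ge; first by apply/cvg_ex; eexists; exact: h.
exact: nearW.
Qed.

End hypercontractive_coupling.

(** * Approximation in L^1 by bounded Lipschitz functions *)

Section lipschitz_density.
Context d {T : measurableType d} {R : realType} {P : probability T R}.
Context {X : hilbertType R}.
Hypothesis hX : separable_space X.

Definition bounded_lipschitz (f : borel X -> R) := exists2 L : R, 0 <= L &
  forall x y : X, `|f x - f y| <= L * `|x - y|.

Lemma cos_lipschitz (x y : R) : `|cos x - cos y| <= `|x - y|.
Proof.
wlog xy : x y / x < y => [H|].
  have [h|h|->] := ltgtP x y; first exact: H.
    by rewrite distrC (distrC x); exact: H.
  by rewrite !subrr normr0.
have [|z _] := @MVT R (@cos R) (fun z => - sin z) x y xy (fun z _ => is_derive_cos z).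
  apply: continuous_subspaceT; exact: continuous_cos.
rewrite distrC => ->; rewrite normrM normrN (distrC x) ler_piMl//.
by rewrite ler_norml sin_geN1 sin_le1.
Qed.

Lemma sin_lipschitz (x y : R) : `|sin x - sin y| <= `|x - y|.
Proof.
have h (z : R) : sin z = cos (z - pi / 2) by rewrite cosB cos_pihalf sin_pihalf mulr0 add0r mulr1.
by rewrite !h (le_trans (cos_lipschitz _ _))// opprB addrA subrK.
Qed.

(** Induction on [trigc]: cos and sin of functionals are Lipschitz, and bounded pointwise limits are
    limits in L^1. *)
Lemma lipschitz_approx (w : T -> borel X) (f : borel X -> R) (e : R) :
  measurable_fun setT w -> bmf f -> 0 < e ->
  exists2 t, bmf t /\ bounded_lipschitz t & \int[P]_s `|f (w s) - t (w s)| <= e.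
Proof.
move=> mw bf; have := bmf_trigc hX bf; move=> tf; move: e.
elim: tf {bf} => {f} [h|h|f g tf ihf tg ihg|c f tf ihf|F f M tF ihF FM Ff] e e0.
- exists (fun x => cos (inner h x)).
    split; first by apply: bmf_cos; exact: measurable_inner.
    exists `|h| => // x y; rewrite (le_trans (cos_lipschitz _ _))//.
    by rewrite -innerBr cauchy_schwarz.
  under eq_Rintegral do rewrite subrr normr0.
  by rewrite prob_int_cst ltW.
- exists (fun x => sin (inner h x)).
    split; first by apply: bmf_sin; exact: measurable_inner.
    exists `|h| => // x y; rewrite (le_trans (sin_lipschitz _ _))//.
    by rewrite -innerBr cauchy_schwarz.
  under eq_Rintegral do rewrite subrr normr0.
  by rewrite prob_int_cst ltW.
- have e2 : 0 < e / 2 by rewrite divr_gt0.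
  have [t [bt [K K0 tK]] ft] := ihf _ e2.
  have [s [bs [N N0 sN]] gs] := ihg _ e2.
  exists (fun x => t x + s x).
    split; first exact: bmfD.
    exists (K + N) => [|x y]; first exact: addr_ge0.
    rewrite opprD addrACA mulrDl (le_trans (ler_normD _ _))//; exact: lerD.
  have bfw (h : borel X -> R) : bmf h -> bmf (fun z => h (w z)) by move=> ?; exact: bmf_comp.
  have b1 := bmf_norm (bmfB (bfw _ (trigc_bmf tf)) (bfw _ bt)).
  have b2 := bmf_norm (bmfB (bfw _ (trigc_bmf tg)) (bfw _ bs)).
  rewrite (@le_trans _ _ (\int[P]_z (`|f (w z) - t (w z)| + `|g (w z) - s (w z)|)))//.
    apply: bmf_int_le => [||z].
    - by apply: bmf_norm; apply: bmfB; apply: bmfD; apply: bfw => //; exact: trigc_bmf.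
    - exact: bmfD.
    - by rewrite opprD addrACA ler_normD.
  by rewrite bmf_intD// [leRHS](splitr e) lerD.
- have e2 : 0 < e / (`|c| + 1) by rewrite divr_gt0// ltr_wpDl.
  have [t [bt [K K0 tK]] ft] := ihf _ e2.
  exists (fun x => c * t x).
    split; first exact: bmfZ.
    exists (`|c| * K) => [|x y]; first exact: mulr_ge0.
    by rewrite -mulrBr normrM -mulrA ler_wpM2l.
  under eq_Rintegral do rewrite -mulrBr normrM.
  have b1 : bmf (fun z => `|f (w z) - t (w z)|).
    by apply: bmf_norm; apply: bmfB; apply: bmf_comp => //; exact: trigc_bmf.
  rewrite bmf_intZ// (@le_trans _ _ ((`|c| + 1) * (e / (`|c| + 1))))//.
    by rewrite ler_pM ?Rintegral_ge0// lerDl.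
  by rewrite mulrCA divff ?mulr1// gt_eqF// ltr_wpDl.
- have e2 : 0 < e / 2 by rewrite divr_gt0.
  have mF n : measurable_fun setT (F n) := (trigc_bmf (tF n)).1.
  have bf : bmf f := bmf_cvg mF FM Ff.
  have fM x : `|f x| <= M.
    have /cvg_norm h := Ff x; rewrite -(cvg_lim _ h)//.
    apply: limr_le; first by apply/cvg_ex; exists `|f x|.
    exact: nearW.
  have cv : \int[P]_z `|f (w z) - F n (w z)| @[n --> \oo] --> (0 : R).
    rewrite -[X in _ --> X](prob_int_cst (P := P)).
    apply: (bmf_cvg_int (M := M + M)).
    + move=> n; apply: (bmf_norm _).1; apply: bmfB; apply: bmf_comp => //.
      exact: trigc_bmf.
    + move=> n x; rewrite normr_id (le_trans (ler_normB _ _))// lerD//.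
    + move=> x; rewrite -(normr0 R) -(subrr (f (w x))).
      by apply: cvg_norm; apply: cvgB; [exact: cvg_cst|exact: Ff].
  have /cvgrPdist_le /(_ _ e2)[n _ /(_ n (leqnn n))] := cv.
  rewrite sub0r normrN ger0_norm ?Rintegral_ge0// => hn.
  have [t [bt lt] ft] := ihF n _ e2.
  exists t => //.
  have bfw (h : borel X -> R) : bmf h -> bmf (fun z => h (w z)) by move=> ?; exact: bmf_comp.
  have bFn := bfw _ (trigc_bmf (tF n)).
  have b1 := bmf_norm (bmfB (bfw _ bf) bFn).
  have b2 := bmf_norm (bmfB bFn (bfw _ bt)).
  rewrite (@le_trans _ _ (\int[P]_z (`|f (w z) - F n (w z)| + `|F n (w z) - t (w z)|)))//.
    apply: bmf_int_le => [||z].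
    - by apply: bmf_norm; apply: bmfB; exact: bfw.
    - exact: bmfD.
    - rewrite (le_trans _ (ler_normD _ _))// addrA subrK//.
  by rewrite bmf_intD// [leRHS](splitr e) lerD.
Qed.

Definition clip (m M x : R) := Num.max m (Num.min M x).

Lemma clip_lipschitz m M x y : `|clip m M x - clip m M y| <= `|x - y|.
Proof.
wlog xy : x y / x <= y => [H|].
  have [h|h] := leP x y; first exact: H.
  by rewrite distrC (distrC x); apply: H; exact: ltW.
rewrite distrC (distrC x) (@ger0_norm _ (y - x)) ?subr_ge0// /clip.
rewrite ler_norml; apply/andP; split; rewrite /Num.max /Num.min; do ! case: ifPn;
 rewrite -?leNgt => *; lra.
Qed.

Lemma clip_id m M x : m <= x <= M -> clip m M x = x.
Proof. by move=> /andP[mx xM]; rewrite /clip min_r// max_r. Qed.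

Lemma clip_range m M x : m <= M -> m <= clip m M x <= M.
Proof. by move=> mM; rewrite /clip le_max lexx/= ge_max mM/= ge_min lexx. Qed.

(** Clipping to [m, M] is 1-Lipschitz and fixes the values of f, so it keeps the approximant
    Lipschitz without increasing the error. *)
Lemma lipschitz_approx_range (w : T -> borel X) (f : borel X -> R) (e m M : R) :
  measurable_fun setT w -> bmf f -> m <= M -> (forall x, m <= f x <= M) -> 0 < e ->
  exists2 t, (forall x, m <= t x <= M) /\ bounded_lipschitz t &
    \int[P]_s `|f (w s) - t (w s)| <= e.
Proof.
move=> mw bf mM fmM e0; have [t [bt [L L0 tL]] ft] := lipschitz_approx mw bf e0.
exists (fun x => clip m M (t x)).
  split=> [x|]; first exact: clip_range.
  by exists L => // x y; rewrite (le_trans (clip_lipschitz _ _ _ _)).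
have bfw (h : borel X -> R) : bmf h -> bmf (fun z => h (w z)) by move=> ?; exact: bmf_comp.
have bc : bmf (fun x => clip m M (t x)).
  split.
    apply: measurable_maxr; first exact: measurable_cst.
    by apply: measurable_minr; [exact: measurable_cst|exact: bt.1].
  exists (`|m| + `|M|) => x; have /andP[h1 h2] := clip_range (t x) mM.
  have := ler_norm M; have := ler_norm (- m); rewrite normrN.
  have := normr_ge0 m; have := normr_ge0 M.
  by rewrite ler_norml => *; apply/andP; split; lra.
apply: le_trans ft; apply: bmf_int_le => [||z].
- by apply: bmf_norm; apply: bmfB; [exact: bfw|exact: (bfw _ bc)].
- by apply: bmf_norm; apply: bmfB; exact: bfw.
- by rewrite -{1}(clip_id (fmM (w z))) clip_lipschitz.
Qed.

End lipschitz_density.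

(** * The two-function inequality for bounded nonnegative functions *)

Section hypercontractive_bounded.
Context d {T : measurableType d} {R : realType} {P : probability T R}.
Context {X : hilbertType R}.
Variables (xi zeta : T -> borel X).
Hypothesis hX : separable_space X.
Hypotheses (mxi : measurable_fun setT xi) (mzeta : measurable_fun setT zeta).
Variables (al be r : R).
Hypothesis al01 : 0 < al < 1.
Hypothesis be01 : 0 < be < 1.
Hypothesis alber : r ^+ 2 * (al * be) <= (1 - al) * (1 - be).
Let add (x y : borel X) : borel X := ((x : X) + (y : X)).
Let scale (a : R) (x : borel X) : borel X := (a *: (x : X)).
Hypothesis stable : forall f g : borel X -> R, bmf f -> bmf g ->
  \int[P]_s \int[P]_t (f (add (xi s) (xi t)) * g (add (zeta s) (zeta t))) =
  \int[P]_t (f (scale (Num.sqrt 2) (xi t)) * g (scale (Num.sqrt 2) (zeta t))).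
Hypothesis correlation : forall f g : borel X -> R, bmf f -> bmf g ->
  \int[P]_t f (xi t) = 0 -> \int[P]_t g (zeta t) = 0 ->
  (\int[P]_t (f (xi t) * g (zeta t))) ^+ 2 <=
  r ^+ 2 * ((\int[P]_t f (xi t) ^+ 2) * (\int[P]_t g (zeta t) ^+ 2)).
Hypothesis xi2 : P.-integrable setT (fun t => (`|xi t : X| ^+ 2)%:E).
Hypothesis zeta2 : P.-integrable setT (fun t => (`|zeta t : X| ^+ 2)%:E).

Local Lemma error_sum (I J J' x y a b z w e : R) :
  I <= J -> x <= a -> y <= b -> J <= J' + z + w -> z <= a -> w <= b ->
  2 * (a + b) <= e -> I + x + y <= J' + e.
Proof. lra. Qed.

(** Away from zero the powers are Lipschitz, so both sides are continuous in L^1 and Lipschitz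
    approximants suffice. *)
Let hypercontractive_pos (m M : R) f g : 0 < m -> m <= M -> bmf f -> bmf g ->
  (forall x, m <= f x <= M) -> (forall x, m <= g x <= M) ->
  \int[P]_t (f (xi t) `^ al * g (zeta t) `^ be) <=
  (\int[P]_t f (xi t)) `^ al * (\int[P]_t g (zeta t)) `^ be.
Proof.
move=> m0 mM bf bg fmM gmM.
have /andP[a0 a1] := al01; have /andP[b0 b1] := be01.
have M0 : 0 <= M by apply: le_trans mM; exact: ltW.
pose Ca := m `^ (al - 1) * M `^ be; pose Cb := m `^ (be - 1) * M `^ al.
have Ca0 : 0 <= Ca by rewrite mulr_ge0 ?powR_ge0.
have Cb0 : 0 <= Cb by rewrite mulr_ge0 ?powR_ge0.
(* Each approximation error is paid twice, once on each side of the inequality; the summand 1 only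
   makes [C] positive. *)
pose C := 2 * (Ca + Cb) + 1.
have C0 : 0 < C by rewrite /C; lra.
have diff (x x' y y' : R) : m <= x <= M -> m <= x' <= M -> m <= y <= M -> m <= y' <= M ->
    x `^ al * y `^ be <= x' `^ al * y' `^ be + Ca * `|x - x'| + Cb * `|y - y'|.
  move=> /andP[mx xM] /andP[mx' xM'] /andP[my yM] /andP[my' yM'].
  have h1 : x `^ al - x' `^ al <= m `^ (al - 1) * `|x - x'|.
    by rewrite (le_trans (ler_norm _))// powR_lipschitz.
  have h2 : y `^ be - y' `^ be <= m `^ (be - 1) * `|y - y'|.
    by rewrite (le_trans (ler_norm _))// powR_lipschitz.
  have e1 : (x `^ al - x' `^ al) * y `^ be <= m `^ (al - 1) * `|x - x'| * M `^ be.
    rewrite (@le_trans _ _ (m `^ (al - 1) * `|x - x'| * y `^ be))//.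
      by rewrite ler_wpM2r ?powR_ge0.
    rewrite ler_wpM2l ?mulr_ge0 ?powR_ge0// ge0_ler_powR ?nnegrE ?(ltW b0)//.
    by rewrite (le_trans _ my)// ltW.
  have e2 : x' `^ al * (y `^ be - y' `^ be) <= M `^ al * (m `^ (be - 1) * `|y - y'|).
    rewrite (@le_trans _ _ (x' `^ al * (m `^ (be - 1) * `|y - y'|)))//.
      by rewrite ler_wpM2l ?powR_ge0.
    rewrite ler_wpM2r ?mulr_ge0 ?powR_ge0// ge0_ler_powR ?nnegrE ?(ltW a0)//.
    by rewrite (le_trans _ mx')// ltW.
  by rewrite /Ca /Cb; lra.
apply/ler_addgt0Pr => e e0.
have eC : 0 < e / C by rewrite divr_gt0.
have [t [tmM [L1 L10 tL]] ft] := lipschitz_approx_range (P := P) hX mxi bf mM fmM eC.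
have [s [smM [L2 L20 sL]] gs] := lipschitz_approx_range (P := P) hX mzeta bg mM gmM eC.
pose L := L1 + L2.
have L0 : 0 <= L by rewrite addr_ge0.
have gt : good L m M t.
  by split => // x y; rewrite (le_trans (tL x y))// ler_wpM2r// lerDl.
have gd : good L m M s.
  by split => // x y; rewrite (le_trans (sL x y))// ler_wpM2r// lerDr.
have key := @hypercontractive_lipschitz _ T R P X xi zeta hX mxi mzeta al be r al01
  be01 alber stable correlation xi2 zeta2 L m M L0 m0 t s gt gd.
have bt := good_bmf L0 m0 gt; have bs := good_bmf L0 m0 gd.
have bw (h : borel X -> R) (w : T -> borel X) : measurable_fun setT w -> bmf h -> bmf (fun z => h (w z)).
  by move=> ? ?; exact: bmf_comp.
have pow (h : borel X -> R) (w : T -> borel X) p : measurable_fun setT w -> 0 <= p -> (forall x, m <= h x <= M) ->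
    bmf h -> bmf (fun z => h (w z) `^ p).
  move=> mw p0 hmM bh; apply: bmf_powR => //; last exact: bw.
  by move=> x; have /andP[h1 _] := hmM (w x); apply: le_trans h1; exact: ltW.
have bd1 : bmf (fun z => `|f (xi z) - t (xi z)|).
  by apply: bmf_norm; apply: bmfB; exact: bw.
have bd2 : bmf (fun z => `|g (zeta z) - s (zeta z)|).
  by apply: bmf_norm; apply: bmfB; exact: bw.
have bp (h k : borel X -> R) : bmf h -> bmf k -> (forall x, m <= h x <= M) -> (forall x, m <= k x <= M) ->
   bmf (fun z => h (xi z) `^ al * k (zeta z) `^ be).
  by move=> *; apply: bmfM; apply: pow => //; exact: ltW.
have rng (h : borel X -> R) (w : T -> borel X) : measurable_fun setT w -> bmf h -> (forall x, m <= h x <= M) ->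
    m <= \int[P]_z h (w z) <= M.
  move=> mw bh hmM; rewrite -{1}(prob_int_cst (P := P) m) -(prob_int_cst (P := P) M).
  by rewrite !bmf_int_le//; try (exact: bw); try exact: bmf_cst;
     move=> z; have /andP[] := hmM (w z).
have ids (h k : borel X -> R) (w : T -> borel X) : measurable_fun setT w -> bmf h -> bmf k ->
    `|(\int[P]_z h (w z)) - (\int[P]_z k (w z))| <= \int[P]_z `|h (w z) - k (w z)|.
  move=> mw bh bk; rewrite -bmf_intB; [|exact: bw..].
  by apply: bmf_norm_int; apply: bmfB; exact: bw.
apply: (@le_trans _ _ (\int[P]_z (t (xi z) `^ al * s (zeta z) `^ be
    + Ca * `|f (xi z) - t (xi z)| + Cb * `|g (zeta z) - s (zeta z)|))).
  apply: bmf_int_le.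
  - exact: bp.
  - by apply: bmfD; [apply: bmfD; [exact: bp|exact: bmfZ]|exact: bmfZ].
  - by move=> z; exact: diff.
rewrite bmf_intD; [|by apply: bmfD; [exact: bp|exact: bmfZ]|exact: bmfZ].
rewrite bmf_intD; [|exact: bp|exact: bmfZ].
rewrite !bmf_intZ//.
have h1 : Ca * (\int[P]_z `|f (xi z) - t (xi z)|) <= Ca * (e / C) by rewrite ler_wpM2l.
have h2 : Cb * (\int[P]_z `|g (zeta z) - s (zeta z)|) <= Cb * (e / C) by rewrite ler_wpM2l.
have h3 := diff _ _ _ _ (rng _ _ mxi bt tmM) (rng _ _ mxi bf fmM)
  (rng _ _ mzeta bs smM) (rng _ _ mzeta bg gmM).
have h4 := ids _ _ _ mxi bf bt; rewrite distrC in h4.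
have h5 := ids _ _ _ mzeta bg bs; rewrite distrC in h5.
have h6 := ler_wpM2l Ca0 (le_trans h4 ft).
have h7 := ler_wpM2l Cb0 (le_trans h5 gs).
have h8 : 2 * (Ca * (e / C) + Cb * (e / C)) <= e.
  rewrite -mulrDl mulrA mulrCA ler_piMr ?(ltW e0)//.
  by rewrite ler_pdivrMr// mul1r /C lerDl.
exact: error_sum key h1 h2 h3 h6 h7 h8.
Qed.

(** Apply the positive case to f + m and g + m, split the powers by subadditivity and let m tend to
    0. *)
Lemma hypercontractive_bmf f g : bmf f -> bmf g ->
  (forall x, 0 <= f x) -> (forall x, 0 <= g x) ->
  \int[P]_t (f (xi t) `^ al * g (zeta t) `^ be) <=
  (\int[P]_t f (xi t)) `^ al * (\int[P]_t g (zeta t)) `^ be.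
Proof.
move=> bf bg f0 g0.
have /andP[a0 a1] := al01; have /andP[b0 b1] := be01.
have [_ [M1 fM]] := bf; have [_ [M2 gM]] := bg.
have bw (h : borel X -> R) (w : T -> borel X) : measurable_fun setT w -> bmf h -> bmf (fun z => h (w z)).
  by move=> ? ?; exact: bmf_comp.
set Ef := \int[P]_t f (xi t); set Eg := \int[P]_t g (zeta t).
have Ef0 : 0 <= Ef by apply: Rintegral_ge0.
have Eg0 : 0 <= Eg by apply: Rintegral_ge0.
have key m : 0 < m -> \int[P]_t (f (xi t) `^ al * g (zeta t) `^ be) <=
    (Ef `^ al + m `^ al) * (Eg `^ be + m `^ be).
  move=> m0; pose M := `|M1| + `|M2| + m.
  have mM : m <= M by rewrite lerDr addr_ge0.
  have bf' : bmf (fun x => f x + m) by apply: bmfD => //; exact: bmf_cst.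
  have bg' : bmf (fun x => g x + m) by apply: bmfD => //; exact: bmf_cst.
  have fmM x : m <= f x + m <= M.
    rewrite lerDr f0 lerD2r/= (le_trans (ler_norm _))// (le_trans (fM x))//.
    by rewrite (le_trans (ler_norm _))// lerDl.
  have gmM x : m <= g x + m <= M.
    rewrite lerDr g0 lerD2r/= (le_trans (ler_norm _))// (le_trans (gM x))//.
    by rewrite (le_trans (ler_norm _))// lerDr.
  have := hypercontractive_pos m0 mM bf' bg' fmM gmM.
  rewrite bmf_intD; [|exact: bw|exact: bmf_cst].
  rewrite [X in _ * (X `^ be)]bmf_intD; [|exact: bw|exact: bmf_cst].
  rewrite !prob_int_cst -/Ef -/Eg => h.
  apply: le_trans (le_trans h _).
    apply: bmf_int_le.
    - apply: bmfM; apply: bmf_powR => //; try exact: ltW; exact: bw.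
    - have pw (k : borel X -> R) w p : 0 <= p -> measurable_fun setT w -> bmf k ->
          (forall x, 0 <= k x) -> bmf (fun z : T => (k (w z) + m) `^ p).
        move=> p0 mw bk k0; apply: bmf_powR => // [x|].
          by rewrite addr_ge0// ltW.
        by apply: bmfD; [exact: bw|exact: bmf_cst].
      by apply: bmfM; apply: pw => //; exact: ltW.
    - move=> x; rewrite ler_pM ?powR_ge0// ge0_ler_powR ?nnegrE ?addr_ge0 ?(ltW a0) ?(ltW b0) ?(ltW m0)// lerDl ltW//.
  by rewrite ler_pM ?powR_ge0// powR_subadditive// ltW.
have cv : (Ef `^ al + m `^ al) * (Eg `^ be + m `^ be) @[m --> 0^'+] --> Ef `^ al * Eg `^ be.
  have : (Ef `^ al + m `^ al) * (Eg `^ be + m `^ be) @[m --> 0^'+] -->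
      (Ef `^ al + 0) * (Eg `^ be + 0).
    by apply: cvgM; apply: cvgD; (try exact: cvg_cst); exact: powR_cvg0.
  by rewrite !addr0.
rewrite -(cvg_lim _ cv)//; apply: limr_ge; first by apply/cvg_ex; eexists; exact: cv.
near=> m; apply: key; near: m; exact: nbhs_right_gt.
Unshelve. all: by end_near. Qed.

End hypercontractive_bounded.

(** * Quadratic forms of Gram kernels and Schur products *)

Lemma cvg_sumr (R : realType) (I : Type) (s : seq I) (F : I -> nat -> R) (l : I -> R) :
  (forall i, F i @ \oo --> l i) ->
  \sum_(i <- s) F i n @[n --> \oo] --> \sum_(i <- s) l i.
Proof.
move=> Fl; elim: s => [|i s ih].
  by rewrite big_nil; under eq_fun do rewrite big_nil; exact: cvg_cst.
by rewrite big_cons; under eq_fun do rewrite big_cons; exact: cvgD.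
Qed.

Section kernels.
Context {R : realType} {X : hilbertType R}.
Variable e : nat -> X.
Hypothesis basis_e : orthonormal_basis setT e.

Lemma inner_basis (x y : X) :
  (\sum_(k < m) inner x (e k) * inner y (e k)) @[m --> \oo] --> inner x y.
Proof.
have [_ _ _ /(_ y I) h] := basis_e.
rewrite (_ : (fun m => \sum_(k < m) _) = (fun m => inner x (partial_proj e m y))).
  exact: (cvg_inner (h := x) h).
apply/funext => m; rewrite /partial_proj inner_sumr; apply: eq_bigr => k _.
by rewrite innerZr mulrC.
Qed.

Section sums.
Context {I : Type}.
Variable s : seq I.
Implicit Types (c : I -> R) (K : I -> I -> R).

Definition qform K c : R := \sum_(i <- s) \sum_(j <- s) c i * c j * K i j.

Definition kle K K' := forall c, qform K c <= qform K' c.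

(** The Schur product theorem. In coordinates the Gram kernel is a sum over k of products <v i, e k>
    <v j, e k>, and each of them only rescales the coefficients of the form. *)
Lemma kle_gram K K' (v : I -> X) : kle K K' ->
  kle (fun i j => K i j * inner (v i) (v j)) (fun i j => K' i j * inner (v i) (v j)).
Proof.
move=> KK' c.
have cv (L : I -> I -> R) : qform (fun i j => L i j *
     \sum_(k < m) inner (v i) (e k) * inner (v j) (e k)) c @[m --> \oo] -->
     qform (fun i j => L i j * inner (v i) (v j)) c.
  rewrite /qform; apply: cvg_sumr => i; apply: cvg_sumr => j.
  apply: cvgM; first exact: cvg_cst.
  by apply: cvgM; [exact: cvg_cst|exact: inner_basis].
have E (L : I -> I -> R) m : qform (fun i j => L i j *
     \sum_(k < m) inner (v i) (e k) * inner (v j) (e k)) c =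
     \sum_(k < m) qform L (fun i => c i * inner (v i) (e k)).
  rewrite /qform [RHS]exchange_big; apply: eq_bigr => i _.
  rewrite [RHS]exchange_big; apply: eq_bigr => j _.
  by rewrite !big_distrr/=; apply: eq_bigr => k _; ring.
rewrite -(cvg_lim _ (cv K))// -(cvg_lim _ (cv K'))//.
apply: ler_lim; [apply/cvg_ex; eexists; exact: (cv K)|apply/cvg_ex; eexists; exact: (cv K')|].
by apply: nearW => m; rewrite !E; apply: ler_sum.
Qed.

Lemma qformZ a K c : qform (fun i j => a * K i j) c = a * qform K c.
Proof.
rewrite /qform big_distrr; apply: eq_bigr => i _; rewrite big_distrr.
by apply: eq_bigr => j _; rewrite /=; ring.
Qed.

Lemma qformD K K' c : qform (fun i j => K i j + K' i j) c = qform K c + qform K' c.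
Proof.
rewrite /qform -big_split; apply: eq_bigr => i _; rewrite -big_split.
by apply: eq_bigr => j _; rewrite /=; ring.
Qed.

Lemma eq_qform K K' c : (forall i j, K i j = K' i j) -> qform K c = qform K' c.
Proof. by move=> h; apply: eq_bigr => i _; apply: eq_bigr => j _; rewrite h. Qed.

Lemma qform_sum (F : nat -> I -> I -> R) n c :
  qform (fun i j => \sum_(0 <= k < n) F k i j) c = \sum_(0 <= k < n) qform (F k) c.
Proof.
elim: n => [|n ih].
  rewrite big_geq//; rewrite /qform big1// => i _; rewrite big1// => j _.
  by rewrite big_geq// mulr0.
rewrite big_nat_recr//= -ih -qformD; apply: eq_qform => i j.
by rewrite big_nat_recr.
Qed.

Lemma qform_inner (w : I -> X) c :
  qform (fun i j => inner (w i) (w j)) c = `|\sum_(i <- s) c i *: w i| ^+ 2.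
Proof.
rewrite -inner_norm inner_suml; apply: eq_bigr => i _.
by rewrite inner_sumr; apply: eq_bigr => j _; rewrite innerZl innerZr mulrA.
Qed.

Variables (w z : I -> X) (r : R).
Hypothesis r01 : 0 <= r <= 1.
Hypothesis zw : forall c,
  `|\sum_(i <- s) c i *: z i| <= r * `|\sum_(i <- s) c i *: w i|.

Let Gw i j := inner (w i) (w j).
Let Gz i j := inner (z i) (z j).

Lemma kle_pow_ge0 n : kle (fun _ _ => 0) (fun i j => Gw i j ^+ n).
Proof.
have q0 (c : I -> R) : qform (fun _ _ => 0) c = 0.
  by rewrite /qform big1// => i _; rewrite big1// => j _; rewrite mulr0.
elim: n => [|n ih] c.
  rewrite q0 (eq_qform (K' := fun _ _ => 1)); last by move=> i j; rewrite expr0.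
  rewrite /qform.
  under eq_bigr do under eq_bigr do rewrite mulr1.
  by rewrite -big_distrlr/= -expr2 sqr_ge0.
have := kle_gram w ih c; rewrite (eq_qform (K' := fun _ _ => 0)).
  by move=> /le_trans; apply; rewrite le_eqVlt; apply/orP; left; apply/eqP; apply: eq_qform => i j; rewrite exprSr.
by move=> i j; rewrite mul0r.
Qed.

Lemma kle_gram1 n : kle (fun i j => Gw i j ^+ n * Gz i j)
  (fun i j => r ^+ 2 * Gw i j ^+ n.+1).
Proof.
have /andP[r0 r1] := r01.
elim: n => [|n ih] c.
  rewrite qformZ (eq_qform (K' := Gz)); last by move=> i j; rewrite expr0 mul1r.
  rewrite [qform (fun i j => Gw i j ^+ 1) c](eq_qform (K' := Gw)); last by move=> i j.
  by rewrite !qform_inner -exprMn lerXn2r// nnegrE// mulr_ge0.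
have := kle_gram w ih c.
rewrite (eq_qform (K' := fun i j => Gw i j ^+ n.+1 * Gz i j)); last first.
  by move=> i j; rewrite exprSr mulrAC.
rewrite [X in _ <= X -> _](eq_qform (K' := fun i j => r ^+ 2 * Gw i j ^+ n.+2))//.
by move=> i j; rewrite (exprSr (Gw i j) n.+1) [RHS]mulrA.
Qed.

(** Replace the factors [Gz] by [Gw] one at a time; a single replacement already gains r^2, so the
    gain is available as soon as there is one factor. *)
Lemma kle_pow1 n : kle (fun i j => Gz i j ^+ n) (fun i j => Gw i j ^+ n) /\
  kle (fun i j => Gz i j ^+ n.+1) (fun i j => r ^+ 2 * Gw i j ^+ n.+1).
Proof.
have /andP[r0 r1] := r01.
suff: kle (fun i j => Gz i j ^+ n) (fun i j => Gw i j ^+ n).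
  move=> h; split => // c.
  rewrite (eq_qform (K' := fun i j => Gz i j ^+ n * Gz i j)); last by move=> i j; rewrite exprSr.
  exact: le_trans (kle_gram z h c) (kle_gram1 n c).
elim: n => [|n ih] c; first by [].
rewrite (eq_qform (K' := fun i j => Gz i j ^+ n * Gz i j)); last by move=> i j; rewrite exprSr.
apply: le_trans (kle_gram z ih c) _; apply: le_trans (kle_gram1 n c) _.
have := kle_pow_ge0 n.+1 c.
rewrite {1}/qform big1 => [|i _]; last by rewrite big1// => j _; rewrite mulr0.
by move=> h; rewrite qformZ ler_piMl// exprn_ile1.
Qed.

Lemma kle_pow n (b : R) : 0 <= b -> (n = 0%N -> b = 0) ->
  kle (fun i j => b * Gz i j ^+ n) (fun i j => r ^+ 2 * (b * Gw i j ^+ n)).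
Proof.
move=> b0; case: n => [/(_ erefl) ->|n _] c.
  by rewrite !qformZ !mul0r mulr0.
rewrite !qformZ mulrCA ler_wpM2l//.
by have [_ /(_ c)] := kle_pow1 n; rewrite qformZ.
Qed.

(** The gain r^2 holds in every positive degree, hence the vanishing constant term; nonnegative
    coefficients allow summing the degrees. *)
Lemma kle_series (b : nat -> R) (phi : R -> R) : (forall n, 0 <= b n) -> b 0%N = 0 ->
  (forall x, series (fun n => b n * x ^+ n) @ \oo --> phi x) ->
  kle (fun i j => phi (Gz i j)) (fun i j => r ^+ 2 * phi (Gw i j)).
Proof.
move=> b0 b00 cphi c.
have cv (L : I -> I -> R) : qform (fun i j => series (fun n => b n * L i j ^+ n) m) c
     @[m --> \oo] --> qform (fun i j => phi (L i j)) c.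
  rewrite /qform; apply: cvg_sumr => i; apply: cvg_sumr => j.
  by apply: cvgM; [exact: cvg_cst|exact: cphi].
have cv2 : r ^+ 2 * qform (fun i j => series (fun n => b n * Gw i j ^+ n) m) c
     @[m --> \oo] --> qform (fun i j => r ^+ 2 * phi (Gw i j)) c.
  by rewrite qformZ; apply: cvgM; [exact: cvg_cst|exact: cv].
rewrite -(cvg_lim _ (cv Gz))// -(cvg_lim _ cv2)//.
apply: ler_lim; [apply/cvg_ex; eexists; exact: (cv Gz)|apply/cvg_ex; eexists; exact: cv2|].
apply: nearW => m; rewrite /series/= !qform_sum big_distrr/=.
apply: ler_sum => n _; have n0 : n = 0%N -> b n = 0 by move=> ->.
by apply: le_trans (@kle_pow n (b n) (b0 n) n0 c) _; rewrite qformZ.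
Qed.

End sums.
End kernels.

Lemma qform_map (R : realType) (I J : Type) (u : J -> I) (s : seq J) (K : I -> I -> R) c :
  qform (map u s) K c = qform s (fun i j => K (u i) (u j)) (fun i => c (u i)).
Proof.
by rewrite /qform big_map; apply: eq_bigr => i _; rewrite big_map.
Qed.

Lemma eq_qform_coef (R : realType) (I : Type) (s : seq I) (K : I -> I -> R) c c' :
  (forall i, c i = c' i) -> qform s K c = qform s K c'.
Proof.
by move=> h; apply: eq_bigr => i _; apply: eq_bigr => j _; rewrite !h.
Qed.

(** * Power series of cosh and sinh *)

Section cosh_sinh.
Context {R : realType}.

Definition cosh (x : R) := (expR x + expR (- x)) / 2.
Definition sinh (x : R) := (expR x - expR (- x)) / 2.

(** The sign [s] = 1 keeps the even exponential coefficients, [s] = -1 the odd ones. *)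
Let parity_coeff (s : R) (n : nat) := (1 + s * (-1) ^+ n) / 2 / n`!%:R : R.

Let parity_series (s x : R) :
  series (fun n => parity_coeff s n * x ^+ n) @ \oo --> (expR x + s * expR (- x)) / 2.
Proof.
have h1 : series (exp_coeff x) @ \oo --> expR x by exact: is_cvg_series_exp_coeff.
have h2 : series (exp_coeff (- x)) @ \oo --> expR (- x) by exact: is_cvg_series_exp_coeff.
rewrite (_ : series _ = (fun n => (series (exp_coeff x) n + s * series (exp_coeff (- x)) n) / 2)).
  by apply: cvgM; [apply: cvgD => //; apply: cvgM => //; exact: cvg_cst|exact: cvg_cst].
apply/funext => n; rewrite /series/= big_distrr/= -big_split/= big_distrl/=.
apply: eq_bigr => k _; rewrite /parity_coeff /exp_coeff/= (exprNn x); field.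
by rewrite pnatr_eq0 -lt0n fact_gt0.
Qed.

Lemma cosh_series : exists b : nat -> R, [/\ forall n, 0 <= b n, b 0%N = 0 &
  forall x, series (fun n => b n * x ^+ n) @ \oo --> cosh x - 1].
Proof.
exists (fun n => if n is 0%N then 0 else parity_coeff 1 n); split => //.
  case=> // n; rewrite /parity_coeff mul1r !divr_ge0// -signr_odd.
  by case: odd; rewrite ?expr1 ?expr0 ?subrr ?addr_ge0.
move=> x; have := @parity_series 1 x; rewrite mul1r -/(cosh x).
move=> /cvgB /(_ (cvg_cst (1 : R))); apply: cvg_trans.
apply: near_eq_cvg; exists 1%N => // -[//|n] _.
rewrite /series/= !big_nat_recl//= /parity_coeff.
rewrite -[LHS]/(\sum_(0 <= k < n.+1) _ - 1) big_nat_recl//= fact0 !expr0.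
by field.
Qed.

Lemma sinh_series : exists b : nat -> R, [/\ forall n, 0 <= b n, b 0%N = 0 &
  forall x, series (fun n => b n * x ^+ n) @ \oo --> sinh x].
Proof.
exists (parity_coeff (-1)); split.
- move=> n; rewrite /parity_coeff mulN1r !divr_ge0// -signr_odd.
  by case: odd; rewrite ?expr1 ?expr0 ?subrr ?opprK ?addr_ge0.
- by rewrite /parity_coeff expr0 mulr1 subrr !mul0r.
- by move=> x; have := @parity_series (-1) x; rewrite mulN1r.
Qed.

End cosh_sinh.

(** * The L^2 seminorm of bounded functions *)

Section l2norm.
Context d {T : measurableType d} {R : realType} {P : probability T R}.
Implicit Types f g : T -> R.

Definition l2norm f : R := Num.sqrt (\int[P]_t f t ^+ 2).

Lemma l2norm_ge0 f : 0 <= l2norm f. Proof. exact: sqrtr_ge0. Qed.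

Lemma l2norm_sqr f : l2norm f ^+ 2 = \int[P]_t f t ^+ 2.
Proof. by rewrite sqr_sqrtr// Rintegral_ge0// => t _; exact: sqr_ge0. Qed.

Lemma l2norm_inner f g : bmf f -> bmf g ->
  `|\int[P]_t (f t * g t)| <= l2norm f * l2norm g.
Proof.
move=> bf bg; rewrite -ler_sqr ?nnegrE ?mulr_ge0 ?l2norm_ge0//.
by rewrite real_normK ?num_real// exprMn !l2norm_sqr bmf_cauchy_schwarz.
Qed.

Lemma l2norm_le f g : l2norm f ^+ 2 <= l2norm g ^+ 2 -> l2norm f <= l2norm g.
Proof. by rewrite ler_sqr ?nnegrE ?l2norm_ge0. Qed.

Lemma l2normD f g : bmf f -> bmf g ->
  l2norm (fun t => f t + g t) <= l2norm f + l2norm g.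
Proof.
move=> bf bg; rewrite -ler_sqr ?nnegrE ?addr_ge0 ?l2norm_ge0// l2norm_sqr.
have -> : \int[P]_t (f t + g t) ^+ 2 =
  l2norm f ^+ 2 + 2 * (\int[P]_t (f t * g t)) + l2norm g ^+ 2.
  rewrite !l2norm_sqr -bmf_intZ; last exact: bmfM.
  rewrite -bmf_intD; [|exact: bmfX|by apply: bmfZ; exact: bmfM].
  rewrite -bmf_intD; [|by apply: bmfD; [exact: bmfX|apply: bmfZ; exact: bmfM]|exact: bmfX].
  by apply: eq_Rintegral => t _; ring.
have := le_trans (ler_norm _) (l2norm_inner bf bg).
by rewrite sqrrD => h; rewrite lerD2r lerD2l mulr_natl lerMn2r.
Qed.

Lemma sqr_int_le f : bmf f -> (\int[P]_t f t) ^+ 2 <= \int[P]_t f t ^+ 2.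
Proof.
move=> bf; have := bmf_cauchy_schwarz (P := P) bf (bmf_cst 1).
under eq_Rintegral do rewrite mulr1.
by under [X in _ <= _ * X]eq_Rintegral do rewrite expr1n; rewrite prob_int_cst mulr1.
Qed.

Lemma variance_eq f : bmf f -> \int[P]_t (f t - \int[P]_s f s) ^+ 2 =
  (\int[P]_t f t ^+ 2) - (\int[P]_s f s) ^+ 2.
Proof.
move=> bf; set m := \int[P]_s f s.
transitivity (\int[P]_t (f t ^+ 2 - 2 * m * f t + m ^+ 2)).
  by apply: eq_Rintegral => t _; ring.
rewrite bmf_intD; [|by apply: bmfB; [exact: bmfX|exact: bmfZ]|exact: bmf_cst].
rewrite bmf_intB; [|exact: bmfX|exact: bmfZ].
rewrite bmf_intZ// prob_int_cst -/m; ring.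
Qed.

End l2norm.
Arguments l2norm {d T R} P f.

(** * Trigonometric polynomials: density in L^2 and Gaussian variances *)

Section trig_polynomials.
Context {R : realType} {X : hilbertType R}.
Hypothesis hX : separable_space X.
Implicit Types s : seq (R * R * X).

Definition trig_poly s (x : borel X) : R :=
  \sum_(i <- s) (i.1.1 * cos (inner i.2 x) + i.1.2 * sin (inner i.2 x)).

Lemma trig_poly_bmf s : bmf (trig_poly s).
Proof.
apply: bmf_sum => i; apply: bmfD; apply: bmfZ.
  by apply: bmf_cos; exact: measurable_inner.
by apply: bmf_sin; exact: measurable_inner.
Qed.

(** Induction on [trigc] once more; bounded pointwise limits are limits in L^2. *)
Lemma trig_poly_approx (Q : probability (borel X) R) (f : borel X -> R) (e : R) :
  bmf f -> 0 < e -> exists s, l2norm Q (fun x => f x - trig_poly s x) <= e.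
Proof.
move=> bf; have := bmf_trigc hX bf; move=> tf; move: e.
elim: tf {bf} => {f} [h|h|f g tf ihf tg ihg|c f tf ihf|F f M tF ihF FM Ff] e e0.
- exists [:: (1, 0, h)]; rewrite /l2norm.
  under eq_Rintegral do rewrite /trig_poly big_seq1/= mul0r addr0 mul1r subrr expr0n.
  by rewrite prob_int_cst sqrtr0 ltW.
- exists [:: (0, 1, h)]; rewrite /l2norm.
  under eq_Rintegral do rewrite /trig_poly big_seq1/= mul0r add0r mul1r subrr expr0n.
  by rewrite prob_int_cst sqrtr0 ltW.
- have e2 : 0 < e / 2 by rewrite divr_gt0.
  have [s hs] := ihf _ e2; have [t ht] := ihg _ e2.
  exists (s ++ t).
  rewrite (_ : (fun x => _) = (fun x => (f x - trig_poly s x) + (g x - trig_poly t x))); last first.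
    by apply/funext => x; rewrite /trig_poly big_cat/= opprD addrACA.
  rewrite (le_trans (l2normD _ _))//; [| |by rewrite [leRHS](splitr e) lerD].
    by apply: bmfB; [exact: trigc_bmf|exact: trig_poly_bmf].
  by apply: bmfB; [exact: trigc_bmf|exact: trig_poly_bmf].
- have e2 : 0 < e / (`|c| + 1) by rewrite divr_gt0// ltr_wpDl.
  have [s hs] := ihf _ e2.
  exists [seq (c * i.1.1, c * i.1.2, i.2) | i <- s].
  have -> : l2norm Q (fun x => c * f x - trig_poly [seq (c * i.1.1, c * i.1.2, i.2) | i <- s] x)
      = `|c| * l2norm Q (fun x => f x - trig_poly s x).
    rewrite /l2norm -(sqrtr_sqr c) -sqrtrM ?sqr_ge0// -bmf_intZ; last first.
      by apply: bmfX; apply: bmfB; [exact: trigc_bmf|exact: trig_poly_bmf].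
    congr Num.sqrt; apply: eq_Rintegral => x _.
    rewrite -exprMn mulrBr; congr ((_ - _) ^+ 2).
    rewrite /trig_poly big_map big_distrr/=; apply: eq_bigr => i _; ring.
  rewrite (@le_trans _ _ ((`|c| + 1) * (e / (`|c| + 1))))//.
    by rewrite ler_pM ?l2norm_ge0// lerDl.
  by rewrite mulrCA divff ?mulr1// gt_eqF// ltr_wpDl.
- have e2 : 0 < e / 2 by rewrite divr_gt0.
  have bf : bmf f := bmf_cvg (fun n => (trigc_bmf (tF n)).1) FM Ff.
  have fM x : `|f x| <= M.
    have /cvg_norm h := Ff x; rewrite -(cvg_lim _ h)//.
    apply: limr_le; first by apply/cvg_ex; exists `|f x|.
    exact: nearW.
  have cv : \int[Q]_z (f z - F n z) ^+ 2 @[n --> \oo] --> (0 : R).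
    rewrite -[X in _ --> X](prob_int_cst (P := Q)).
    apply: (bmf_cvg_int (M := (M + M) ^+ 2)).
    + move=> n; apply: (bmfX _ _).1; apply: bmfB => //; exact: trigc_bmf.
    + move=> n x; rewrite normrX lerXn2r ?nnegrE//.
        by rewrite addr_ge0// (le_trans _ (fM x)).
      by rewrite (le_trans (ler_normB _ _))// lerD.
    + move=> x; have h : f x - F n x @[n --> \oo] --> f x - f x.
        by apply: cvgB; [exact: cvg_cst|exact: Ff].
      rewrite subrr in h.
      have -> : 0 = 0 * 0 :> R by rewrite mulr0.
      exact: (cvgM h h).
  have e22 : 0 < (e / 2) ^+ 2 by rewrite exprn_gt0.
  have /cvgrPdist_le /(_ _ e22)[n _ /(_ n (leqnn n))] := cv.
  rewrite sub0r normrN ger0_norm; last by rewrite Rintegral_ge0// => x _; exact: sqr_ge0.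
  rewrite -l2norm_sqr ler_sqr ?nnegrE ?l2norm_ge0 ?(ltW e2)// => hn.
  have [s hs] := ihF n _ e2.
  exists s.
  rewrite (_ : (fun x => _) = (fun x => (f x - F n x) + (F n x - trig_poly s x))); last first.
    by apply/funext => x; rewrite addrA subrK.
  rewrite (le_trans (l2normD _ _))//; [| |by rewrite [leRHS](splitr e) lerD].
    by apply: bmfB => //; exact: trigc_bmf.
  by apply: bmfB; [exact: trigc_bmf|exact: trig_poly_bmf].
Qed.

Context d {T : measurableType d} {P : probability T R} (w : T -> borel X) (W : X -> X).
Hypothesis mw : measurable_fun setT w.
Hypothesis WD : {morph W : x y / x + y}.
Hypothesis WN : {morph W : x / - x}.
Hypothesis cos_w : forall h, \int[P]_t cos (inner h (w t)) = expR (- (`|W h| ^+ 2 / 2)).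
Hypothesis sin_w : forall h, \int[P]_t sin (inner h (w t)) = 0.

Let bcos h : bmf (fun t => cos (inner h (w t))).
Proof. by apply: bmf_cos; apply: (measurableT_comp (measurable_inner h) mw). Qed.

Let bsin h : bmf (fun t => sin (inner h (w t))).
Proof. by apply: bmf_sin; apply: (measurableT_comp (measurable_inner h) mw). Qed.

Let gauss h : R := expR (- (`|W h| ^+ 2 / 2)).

Let gaussD h k : gauss (h + k) = gauss h * gauss k * expR (- inner (W h) (W k)).
Proof.
rewrite /gauss -!expRD; congr expR.
rewrite WD -!inner_norm innerDl !innerDr (innerC (W k)); by field.
Qed.

Let gaussB h k : gauss (h - k) = gauss h * gauss k * expR (inner (W h) (W k)).
Proof. by rewrite gaussD WN innerNr opprK /gauss WN normrN. Qed.

Let cos_cos h k : \int[P]_t (cos (inner h (w t)) * cos (inner k (w t))) =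
  gauss h * gauss k * cosh (inner (W h) (W k)).
Proof.
transitivity (\int[P]_t (1 / 2 * cos (inner (h - k) (w t)) + 1 / 2 * cos (inner (h + k) (w t)))).
  by apply: eq_Rintegral => t _; rewrite innerBl innerDl cosB cosD; field.
rewrite bmf_intD; [|exact: bmfZ..]; rewrite !bmf_intZ// !cos_w -!/(gauss _) gaussB gaussD.
by rewrite /cosh; field.
Qed.

Let sin_sin h k : \int[P]_t (sin (inner h (w t)) * sin (inner k (w t))) =
  gauss h * gauss k * sinh (inner (W h) (W k)).
Proof.
transitivity (\int[P]_t (1 / 2 * cos (inner (h - k) (w t)) - 1 / 2 * cos (inner (h + k) (w t)))).
  by apply: eq_Rintegral => t _; rewrite innerBl innerDl cosB cosD; field.
rewrite bmf_intB; [|exact: bmfZ..]; rewrite !bmf_intZ// !cos_w -!/(gauss _) gaussB gaussD.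
by rewrite /sinh; field.
Qed.

Let sin_cos h k : \int[P]_t (sin (inner h (w t)) * cos (inner k (w t))) = 0.
Proof.
transitivity (\int[P]_t (1 / 2 * sin (inner (h - k) (w t)) + 1 / 2 * sin (inner (h + k) (w t)))).
  by apply: eq_Rintegral => t _; rewrite innerBl innerDl sinB sinD; field.
by rewrite bmf_intD; [|exact: bmfZ..]; rewrite !bmf_intZ// !sin_w mulr0 addr0.
Qed.

Lemma trig_poly_int s : \int[P]_t trig_poly s (w t) = \sum_(i <- s) i.1.1 * gauss i.2.
Proof.
rewrite bmf_int_sum => [|i]; last by apply: bmfD; exact: bmfZ.
apply: eq_bigr => i _; rewrite bmf_intD; [|exact: bmfZ..].
by rewrite !bmf_intZ// cos_w sin_w mulr0 addr0.
Qed.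

(** Under a centered Gaussian law whose covariance is the Gram form of W, product-to-sum formulas
    give cosines the covariance gauss h gauss k (cosh <W h, W k> - 1) and sines the same with sinh;
    cosines and sines are uncorrelated. The factors [gauss] are absorbed in the coefficients. *)
Lemma trig_poly_var s :
  \int[P]_t (trig_poly s (w t) - \int[P]_t trig_poly s (w t)) ^+ 2 =
  qform s (fun i j => cosh (inner (W i.2) (W j.2)) - 1) (fun i => i.1.1 * gauss i.2) +
  qform s (fun i j => sinh (inner (W i.2) (W j.2))) (fun i => i.1.2 * gauss i.2).
Proof.
have bt (i : R * R * X) : bmf (fun t => i.1.1 * cos (inner i.2 (w t)) + i.1.2 * sin (inner i.2 (w t))).
  by apply: bmfD; exact: bmfZ.
rewrite variance_eq; last exact: bmf_sum.
transitivity ((\sum_(i <- s) \sum_(j <- s) \int[P]_t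
  ((i.1.1 * cos (inner i.2 (w t)) + i.1.2 * sin (inner i.2 (w t))) *
   (j.1.1 * cos (inner j.2 (w t)) + j.1.2 * sin (inner j.2 (w t)))))
  - (\sum_(i <- s) \sum_(j <- s) i.1.1 * gauss i.2 * (j.1.1 * gauss j.2))).
  congr (_ - _); last by rewrite trig_poly_int expr2 big_distrlr.
  under eq_Rintegral do rewrite expr2 /trig_poly big_distrlr/=.
  rewrite bmf_int_sum => [|i]; last by apply: bmf_sum => j; exact: bmfM.
  by apply: eq_bigr => i _; rewrite bmf_int_sum// => j; exact: bmfM.
rewrite -sumrB -big_split/=; apply: eq_bigr => i _.
rewrite -sumrB -big_split/=; apply: eq_bigr => j _.
transitivity (i.1.1 * j.1.1 * (gauss i.2 * gauss j.2 * cosh (inner (W i.2) (W j.2)))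
  + i.1.2 * j.1.2 * (gauss i.2 * gauss j.2 * sinh (inner (W i.2) (W j.2)))
  + i.1.1 * j.1.2 * 0 + i.1.2 * j.1.1 * 0 - i.1.1 * gauss i.2 * (j.1.1 * gauss j.2));
  last by ring.
congr (_ - _).
rewrite -{1}(sin_cos j.2 i.2) -(sin_cos i.2 j.2) -cos_cos -sin_sin.
have cc h k : bmf (fun t => cos (inner h (w t)) * cos (inner k (w t))) by exact: bmfM.
have ss h k : bmf (fun t => sin (inner h (w t)) * sin (inner k (w t))) by exact: bmfM.
have sc h k : bmf (fun t => sin (inner h (w t)) * cos (inner k (w t))) by exact: bmfM.
rewrite -!bmf_intZ// -!bmf_intD//; try by [exact: bmfZ]; try by (apply: bmfD; exact: bmfZ).
  by apply: eq_Rintegral => t _; ring.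
by apply: bmfD; [apply: bmfD|]; exact: bmfZ.
Qed.

End trig_polynomials.

(** * Alternating Taylor remainders of cos, sin and exp(-x) *)

Section taylor_remainders.
Context {R : realType}.
Implicit Types u x : R.

(* Alternating Taylor remainders: up to sign, what is left of cos, sin and
   exp(-x) after removing the first k terms of the power series. *)
Fixpoint cos_rem (k : nat) (u : R) : R :=
  if k is j.+1 then u ^+ j.*2 / (j.*2)`!%:R - cos_rem j u else cos u.

Fixpoint sin_rem (k : nat) (u : R) : R :=
  if k is j.+1 then u ^+ (j.*2).+1 / ((j.*2).+1)`!%:R - sin_rem j u else sin u.

Fixpoint exp_rem (k : nat) (u : R) : R :=
  if k is j.+1 then u ^+ j / j`!%:R - exp_rem j u else expR (- u).

Lemma is_derive_monomial n u :
  is_derive u 1 (fun x => x ^+ n.+1 / n.+1`!%:R) (u ^+ n / n`!%:R).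
Proof.
have -> : (fun x : R => x ^+ n.+1 / n.+1`!%:R) = horner ((n.+1`!%:R)^-1 *: 'X^(n.+1)).
  by apply/funext => x; rewrite hornerZ hornerXn mulrC.
apply: is_derive_eq.
rewrite derivZ derivXn hornerZ hornerMn hornerXn/= factS natrM -[X in _ * X]mulr_natl.
have nf : n`!%:R != 0 :> R by rewrite pnatr_eq0 -lt0n fact_gt0.
have nn : n.+1%:R != 0 :> R by rewrite pnatr_eq0.
by field; rewrite nf addrC natr1 nn.
Qed.

Lemma is_derive_sin_rem k u : is_derive u 1 (sin_rem k) (cos_rem k u).
Proof.
elim: k => [|k ih] /=; first exact: is_derive_sin.
have h := is_derive_monomial k.*2 u.
exact: (is_deriveB h ih).
Qed.

Lemma is_derive_cos_rem k u : is_derive u 1 (cos_rem k.+1) (sin_rem k u).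
Proof.
elim: k => [|k ih].
  have h0 : is_derive u 1 (fun x : R => x ^+ 0 / 0`!%:R) 0.
    rewrite (_ : (fun x => _) = cst 1); first exact: is_derive_cst.
    by apply/funext => x; rewrite expr0 fact0 divr1.
  have h := is_deriveB h0 (is_derive_cos u).
  by rewrite sub0r opprK in h.
have h := is_derive_monomial k.*2.+1 u.
exact: (is_deriveB h ih).
Qed.

Lemma is_derive_exp_rem k u : is_derive u 1 (exp_rem k.+1) (exp_rem k u).
Proof.
elim: k => [|k ih].
  have h0 : is_derive u 1 (fun x : R => x ^+ 0 / 0`!%:R) 0.
    rewrite (_ : (fun x => _) = cst 1); first exact: is_derive_cst.
    by apply/funext => x; rewrite expr0 fact0 divr1.
  have he : is_derive u 1 (fun x => expR (- x)) (- expR (- u)).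
    have h1 := is_derive1_comp (f := expR) (g := -%R) (x := u) (is_derive_expR _) (is_deriveNid u 1).
    by rewrite mulrN1 in h1.
  have h := is_deriveB h0 he.
  by rewrite sub0r opprK in h.
have h := is_derive_monomial k u.
exact: (is_deriveB h ih).
Qed.

Lemma ge0_of_derive (f df : R -> R) x : f 0 = 0 ->
  (forall u, is_derive u 1 f (df u)) -> (forall u, 0 <= u -> 0 <= df u) ->
  0 <= x -> 0 <= f x.
Proof.
move=> f0 fdf df0; rewrite le_eqVlt => /predU1P[<-|x0]; first by rewrite f0.
have [|c] := @MVT R f df 0 x x0 (fun u _ => fdf u).
  by apply: derivable_within_continuous => u _; have [] := fdf u.
rewrite in_itv/= f0 !subr0 => /andP[c0 _] ->.
by rewrite mulr_ge0 ?df0// ltW.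
Qed.

Lemma sin_rem0 k : sin_rem k 0 = 0.
Proof. by elim: k => [|k ih] /=; rewrite ?sin0// ih expr0n mul0r subr0. Qed.

Lemma cos_rem0 k : cos_rem k.+1 0 = 0.
Proof.
elim: k => [|k ih]; first by rewrite /= cos0 expr0 fact0 divr1 subrr.
by rewrite -[LHS]/(0 ^+ (k.+1).*2 / _ - cos_rem k.+1 0) ih expr0n/= mul0r subr0.
Qed.

Lemma exp_rem0 k : exp_rem k.+1 0 = 0.
Proof.
elim: k => [|k ih]; first by rewrite /= oppr0 expR0 expr0 fact0 divr1 subrr.
by rewrite -[LHS]/(0 ^+ k.+1 / _ - exp_rem k.+1 0) ih expr0n/= mul0r subr0.
Qed.

Lemma cos_remN k u : cos_rem k (- u) = cos_rem k u.
Proof.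
elim: k => [|k ih] /=; first exact: cosN.
by rewrite ih exprNn -signr_odd odd_double mul1r.
Qed.

(** Each remainder vanishes at 0 and has the preceding one as derivative, starting from 1 - cos >=
    0; positivity is integrated upwards. *)
Lemma cos_sin_rem_ge0 k u : 0 <= u -> 0 <= cos_rem k.+1 u /\ 0 <= sin_rem k.+1 u.
Proof.
elim: k u => [|k ih] u u0.
  have h x : 0 <= cos_rem 1 x by rewrite /= expr0 fact0 divr1 subr_ge0 cos_le1.
  split => //; apply: (ge0_of_derive (sin_rem0 1) (is_derive_sin_rem 1)) => // x _.
have h x : 0 <= x -> 0 <= cos_rem k.+2 x.
  apply: (ge0_of_derive (cos_rem0 k.+1) (is_derive_cos_rem k.+1)) => y y0.
  by have [] := ih y y0.
split; first exact: h.
exact: (ge0_of_derive (sin_rem0 k.+2) (is_derive_sin_rem k.+2)).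
Qed.

Lemma cos_rem_ge0 k u : 0 <= cos_rem k.+1 u.
Proof.
have [u0|u0] := leP 0 u; first by have [] := cos_sin_rem_ge0 k u0.
by rewrite -cos_remN; have [] // := @cos_sin_rem_ge0 k (- u); rewrite oppr_ge0 ltW.
Qed.

Lemma exp_rem_ge0 k u : 0 <= u -> 0 <= exp_rem k u.
Proof.
elim: k u => [|k ih] u u0; first exact: expR_ge0.
exact: (ge0_of_derive (exp_rem0 k) (is_derive_exp_rem k)).
Qed.

Lemma cos_rem_le k u : cos_rem k u <= u ^+ k.*2 / (k.*2)`!%:R.
Proof. by have := cos_rem_ge0 k u; rewrite /= subr_ge0. Qed.

Lemma cos_rem_lower k u : u ^+ k.*2 / (k.*2)`!%:R - u ^+ (k.+1).*2 / ((k.+1).*2)`!%:R <= cos_rem k u.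
Proof. by have := cos_rem_le k.+1 u; rewrite [X in X <= _]/=; lra. Qed.

Lemma exp_rem_le k u : 0 <= u -> exp_rem k u <= u ^+ k / k`!%:R.
Proof. by move=> u0; have := exp_rem_ge0 k.+1 u0; rewrite /= subr_ge0. Qed.

Lemma exp_rem_lower k u : 0 <= u ->
  u ^+ k / k`!%:R - u ^+ k.+1 / k.+1`!%:R <= exp_rem k u.
Proof. by move=> u0; have := exp_rem_le k.+1 u0; rewrite [X in X <= _]/=; lra. Qed.

End taylor_remainders.

(** * Even Gaussian moments from the characteristic function *)

Lemma limn_einf_le (R : realType) (u : (\bar R)^nat) (M : \bar R) :
  (forall n, (u n <= M)%E) -> (limn_einf u <= M)%E.
Proof.
move=> uM; rewrite limn_einf_lim; apply: lime_le; first exact: is_cvg_einfs.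
apply: nearW => n; apply: le_trans (uM n).
by apply: ereal_inf_lbound; exists n => /=.
Qed.

Section gaussian_moments.
Context d {T : measurableType d} {R : realType} {P : probability T R}.
Variables (phi : T -> R) (v : R).
Hypothesis v0 : 0 <= v.
Hypothesis mphi : measurable_fun setT phi.
Hypothesis cos_phi : forall t, \int[P]_s cos (t * phi s) = expR (- (t ^+ 2 * v / 2)).

Let mom k := fun s => phi s ^+ k.*2 / (k.*2)`!%:R.

Let mom_ge0 k s : 0 <= mom k s.
Proof. by rewrite /mom divr_ge0// -mul2n exprM exprn_ge0// sqr_ge0. Qed.

Let mmom k : measurable_fun setT (mom k).
Proof.
by apply: measurable_funM; [exact: measurable_funX|exact: measurable_cst].
Qed.

Let moment_at k := P.-integrable setT (EFin \o mom k) /\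
  \int[P]_s mom k s = (v / 2) ^+ k / k`!%:R.

Let rem_at k := forall t, P.-integrable setT (EFin \o (fun s => cos_rem k (t * phi s))) /\
  \int[P]_s cos_rem k (t * phi s) = exp_rem k (t ^+ 2 * v / 2).

(** Integrability of the next cosine remainder needs the moment just obtained, so moments and
    remainders are gained alternately. *)
Let rem_succ k : moment_at k -> rem_at k -> rem_at k.+1.
Proof.
move=> [im Em] hr t; have [ir Er] := hr t.
have iz : P.-integrable setT (EFin \o (fun s => t ^+ k.*2 * mom k s)).
  exact: (integrableZl measurableT (t ^+ k.*2) im).
have E s : cos_rem k.+1 (t * phi s) = t ^+ k.*2 * mom k s - cos_rem k (t * phi s).
  by rewrite /= /mom exprMn mulrA.
split.
  apply: eq_integrable (integrableB measurableT iz ir) => // s _.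
  by rewrite -[RHS]/((cos_rem k.+1 (t * phi s))%:E) E EFinB.
under eq_Rintegral do rewrite E.
rewrite RintegralB// RintegralZl// Em Er /=; congr (_ - _).
by rewrite -mul2n exprM mulrA -exprMn mulrA.
Qed.

Let scale n : R := n.+1%:R^-1.
Let scale_gt0 n : 0 < scale n. Proof. by rewrite invr_gt0. Qed.
Let scale_cvg : scale @ \oo --> (0 : R).
Proof.
apply/cvgrPdist_lt => e e0.
have := @near_infty_natSinv_lt R (PosNum e0); apply: filterS => n.
by rewrite sub0r normrN gtr0_norm// scale_gt0.
Qed.

(** Divide the identity E [cos_rem] k (t phi) = [exp_rem] k (t^2 v / 2) by t^(2k) and let t tend to
    0. The integrands are nonnegative and tend to the monomial, so Fatou's lemma gives integrability
    and the upper bound; they also lie below the monomial, which gives the lower bound. *)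
Let moment_succ k : rem_at k.+1 -> moment_at k.+1.
Proof.
move: k.+1 (cos_rem_ge0 (R := R) k) => {}k cr0 hr.
have mrem n : measurable_fun setT (fun s => cos_rem k (scale n * phi s)).
  by have [/measurable_int/measurable_EFinP] := hr (scale n).
pose F n s := (cos_rem k (scale n * phi s) / scale n ^+ k.*2)%:E.
have mF n : measurable_fun setT (F n).
  apply/measurable_EFinP; apply: measurable_funM => //; exact: measurable_cst.
have F0 n s : setT s -> (0 <= F n s)%E.
  by move=> _; rewrite lee_fin divr_ge0// exprn_ge0// ltW.
have sE n : scale n ^+ 2 * v / 2 = scale n ^+ 2 * (v / 2) by rewrite mulrA.
have s2 n : scale n ^+ k.*2 = (scale n ^+ 2) ^+ k by rewrite -mul2n exprM.
have intF n : (\int[P]_s F n s = (exp_rem k (scale n ^+ 2 * v / 2) / scale n ^+ k.*2)%:E)%E.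
  have [ir Er] := hr (scale n).
  rewrite /F; under eq_integral do rewrite EFinM.
  rewrite integralZr//; rewrite -Er /Rintegral EFinM fineK//.
  exact: integrable_fin_num.
have F_le n : (\int[P]_s F n s <= ((v / 2) ^+ k / k`!%:R)%:E)%E.
  rewrite intF lee_fin ler_pdivrMr ?exprn_gt0//.
  rewrite (le_trans (exp_rem_le _ _))//; first by rewrite divr_ge0// mulr_ge0// sqr_ge0.
  by rewrite sE exprMn s2 -mulrA mulrC.
have Fcv s : F n s @[n --> \oo] --> (mom k s)%:E.
  apply: cvg_EFin; first exact: nearW.
  rewrite /F/=.
  pose C := phi s ^+ (k.+1).*2 / ((k.+1).*2)`!%:R.
  apply: (@squeeze_cvgr _ _ _ _ (fun n => mom k s - scale n ^+ 2 * C) (cst (mom k s))).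
  - apply: nearW => n; rewrite /mom ler_pdivlMr ?exprn_gt0// ler_pdivrMr ?exprn_gt0//.
    have h1 := cos_rem_lower k (scale n * phi s).
    have h2 := cos_rem_le k (scale n * phi s).
    rewrite !exprMn in h1 h2; rewrite /C.
    apply/andP; split.
      apply: le_trans h1; rewrite le_eqVlt; apply/orP; left; apply/eqP.
      have -> : scale n ^+ (k.+1).*2 = scale n ^+ 2 * scale n ^+ k.*2 by rewrite -exprD.
      move: (scale n ^+ k.*2) (scale n ^+ 2) (phi s ^+ k.*2) (phi s ^+ (k.+1).*2).
      by move: ((k.*2)`!%:R^-1) (((k.+1).*2)`!%:R^-1) => *; ring.
    by apply: le_trans h2 _; rewrite -mulrA mulrC.
  - have h : mom k s - scale n ^+ 2 * C @[n --> \oo] --> mom k s - 0 * 0 * C.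
      apply: cvgB; first exact: cvg_cst.
      apply: cvgM; last exact: cvg_cst.
      exact: (cvgM scale_cvg scale_cvg).
    by rewrite !mul0r subr0 in h.
  - exact: cvg_cst.
have upper : (\int[P]_s (mom k s)%:E <= ((v / 2) ^+ k / k`!%:R)%:E)%E.
  have := fatou P measurableT mF F0.
  rewrite (eq_integral (fun s => (mom k s)%:E)); last first.
    move=> s _; rewrite is_cvg_limn_einfE; last by apply/cvg_ex; eexists; exact: Fcv.
    exact/cvg_lim/Fcv.
  by move=> /le_trans; apply; exact: limn_einf_le.
have imom : P.-integrable setT (EFin \o mom k).
  apply/integrableP; split; first exact/measurable_EFinP.
  rewrite (@le_lt_trans _ _ ((v / 2) ^+ k / k`!%:R)%:E) ?ltry//.
  under eq_integral do rewrite /= ger0_norm//.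
  exact: upper.
split => //; apply/eqP; rewrite eq_le; apply/andP; split.
  by rewrite -lee_fin /Rintegral fineK//; exact: integrable_fin_num imom.
have lower n : (v / 2) ^+ k / k`!%:R - scale n ^+ 2 * ((v / 2) ^+ k.+1 / k.+1`!%:R) <=
    \int[P]_s mom k s.
  rewrite (@le_trans _ _ (exp_rem k (scale n ^+ 2 * v / 2) / scale n ^+ k.*2))//.
    rewrite ler_pdivlMr ?exprn_gt0//.
    apply: le_trans (exp_rem_lower _ _); last by rewrite divr_ge0// mulr_ge0// sqr_ge0.
    rewrite sE s2; move: (v / 2) (scale n ^+ 2) => q a.
    rewrite (exprMn k) (exprMn k.+1) [a ^+ k.+1]exprS.
    rewrite le_eqVlt; apply/orP; left; apply/eqP.
    by move: (q ^+ k.+1) (q ^+ k) (a ^+ k) (k`!%:R^-1) (k.+1`!%:R^-1) => *; ring.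
  rewrite -lee_fin -intF /Rintegral fineK; last exact: integrable_fin_num imom.
  apply: ge0_le_integral => //.
  - by move=> s _; exact: F0.
  - exact/measurable_EFinP.
  - move=> s _; rewrite /F lee_fin ler_pdivrMr ?exprn_gt0//.
    by rewrite (le_trans (cos_rem_le _ _))// exprMn /mom -mulrA mulrC.
have h : (v / 2) ^+ k / k`!%:R - scale n ^+ 2 * ((v / 2) ^+ k.+1 / k.+1`!%:R) @[n --> \oo] -->
    (v / 2) ^+ k / k`!%:R - 0 * 0 * ((v / 2) ^+ k.+1 / k.+1`!%:R).
  apply: cvgB; first exact: cvg_cst.
  apply: cvgM; last exact: cvg_cst.
  exact: (cvgM scale_cvg scale_cvg).
rewrite !mul0r subr0 in h.
rewrite -(cvg_lim _ h)//; apply: limr_le; first by apply/cvg_ex; eexists; exact: h.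
exact: nearW.
Qed.

Lemma gaussian_moment k : moment_at k.
Proof.
suff: moment_at k /\ rem_at k by case.
elim: k => [|k [mk rk]].
  have E : mom 0 = cst 1 by apply/funext => s; rewrite /mom expr0 fact0 divr1.
  split.
    rewrite /moment_at E expr0 fact0 divr1; split; last exact: prob_int_cst.
    exact: finite_measure_integrable_cst.
  move=> t; split; last by rewrite /= cos_phi.
  apply: bmf_integrable; apply: bmf_cos; apply: measurable_funM => //.
have rk1 := rem_succ mk rk.
by split => //; exact: moment_succ.
Qed.

End gaussian_moments.

(** * Finite second moment of the norm *)

Section gaussian_second_moment.
Context d {T : measurableType d} {R : realType} {P : probability T R}.
Context {X : hilbertType R}.
Variables (w : T -> borel X) (W : X -> X) (e : nat -> X).
Hypothesis mw : measurable_fun setT w.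
Hypothesis WZ : forall a h, W (a *: h) = a *: W h.
Hypothesis cos_w : forall h, \int[P]_t cos (inner h (w t)) = expR (- (`|W h| ^+ 2 / 2)).
Hypothesis basis_e : orthonormal_basis setT e.
Hypothesis trace : cvgn (series (fun k => `|W (e k)| ^+ 2)).

Lemma inner_moment h k :
  P.-integrable setT (EFin \o (fun s => inner h (w s) ^+ k.*2 / (k.*2)`!%:R)) /\
  \int[P]_s (inner h (w s) ^+ k.*2 / (k.*2)`!%:R) = (`|W h| ^+ 2 / 2) ^+ k / k`!%:R.
Proof.
apply: gaussian_moment => //.
  exact: (measurableT_comp (measurable_inner h) mw).
move=> t; under eq_Rintegral do rewrite -innerZl.
by rewrite cos_w WZ normrZ exprMn real_normK ?num_real.
Qed.

Lemma inner_sqr_int h : (\int[P]_s (inner h (w s) ^+ 2)%:E = (`|W h| ^+ 2)%:E)%E.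
Proof.
have [i1 e1] := inner_moment h 1; move: e1.
rewrite expr1 (_ : 1`! = 1%N)// divr1 => e1; rewrite -[`|W h| ^+ 2](@divfK _ 2)// -e1 mulrC EFinM /Rintegral fineK; last exact: integrable_fin_num.
rewrite -integralZl//; apply: eq_integral => s _.
by rewrite -EFinM; congr EFin; rewrite /= (_ : 2`! = 2%N)//; field.
Qed.

(** Parseval and monotone convergence: the integral is the trace of the covariance. *)
Lemma norm_sqr_integrable : P.-integrable setT (fun t => (`|w t : X| ^+ 2)%:E).
Proof.
have mi h : measurable_fun setT (fun t => inner h (w t)).
  exact: (measurableT_comp (measurable_inner h) mw).
have mn : measurable_fun setT (fun t => (`|w t : X| ^+ 2)%:E).
  apply/measurable_EFinP; apply: measurable_funX.
  exact: (measurableT_comp measurable_hnorm mw).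
apply/integrableP; split => //.
under eq_integral do rewrite gee0_abs ?lee_fin ?sqr_ge0//.
pose g m t := (\sum_(k < m) inner (e k) (w t) ^+ 2)%:E.
have g0 m t : setT t -> (0 <= g m t)%E.
  by move=> _; rewrite lee_fin sumr_ge0// => k _; exact: sqr_ge0.
have mg m : measurable_fun setT (g m).
  apply/measurable_EFinP; apply: measurable_sum => k; exact: measurable_funX.
have nd t : setT t -> {homo g ^~ t : m n / (m <= n)%N >-> (m <= n)%E}.
  move=> _ m n mn'; rewrite lee_fin.
  rewrite -(big_mkord xpredT (fun k => inner (e k) (w t) ^+ 2)).
  rewrite -(big_mkord xpredT (fun k => inner (e k) (w t) ^+ 2)).
  rewrite (big_cat_nat (leq0n m) mn')//= lerDl sumr_ge0// => k _; exact: sqr_ge0.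
have lim t : (`|w t : X| ^+ 2)%:E = limn (g ^~ t).
  apply/esym/cvg_lim => //; apply: cvg_EFin; first exact: nearW.
  have := @inner_basis R X e basis_e (w t) (w t); rewrite inner_norm.
  by apply: cvg_trans; apply: near_eq_cvg; apply: nearW => m /=; apply: eq_bigr => k _; rewrite innerC -expr2.
under eq_integral do rewrite lim.
rewrite monotone_convergence//.
have E m : (\int[P]_t g m t = (series (fun k => `|W (e k)| ^+ 2) m)%:E)%E.
  rewrite /g; under eq_integral do rewrite -sumEFin.
  rewrite ge0_integral_sum//.
  - rewrite /series/= -sumEFin big_mkord; apply: eq_bigr => k _; exact: inner_sqr_int.
  - by move=> k; apply/measurable_EFinP; exact: measurable_funX.
  - by move=> k t _; rewrite lee_fin sqr_ge0.
under eq_fun do rewrite E.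
have := trace => /cvg_ex[l hl].
rewrite (cvg_lim _ (cvg_EFin _ hl))// ?ltry//; exact: nearW.
Qed.

End gaussian_second_moment.

(** * Restriction to sets of full measure, and normalised sums of two copies *)

Section full_measure.
Context d {T : measurableType d} {R : realType} {P : probability T R}.

Lemma int_full_measure (S : set T) (f : T -> R) : measurable S -> P S = 1%E ->
  bmf f -> \int[P]_t f t = \int[P]_t (f t * \1_S t).
Proof.
move=> mS PS bf; have [_ [M fM]] := bf.
have bS : bmf (\1_S : T -> R).
  split; first exact: measurable_indic.
  by exists 1 => x; rewrite indicE; case: (_ \in _); rewrite ?normr0 ?normr1.
have b1 : bmf (fun t => 1 - \1_S t : R) by apply: bmfB => //; exact: bmf_cst.
have i1 : \int[P]_t (1 - \1_S t) = 0.
  rewrite bmf_intB//; last exact: bmf_cst.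
  by rewrite prob_int_cst /Rintegral integral_indic// setIT [X in fine X]PS subrr.
apply/eqP; rewrite -subr_eq0 -normr_eq0 -bmf_intB//; last exact: bmfM.
rewrite eq_le normr_ge0 andbT.
have bd : bmf (fun t => f t - f t * \1_S t) by apply: bmfB => //; exact: bmfM.
rewrite (le_trans (bmf_norm_int bd))// -(mulr0 `|M|) -i1 -bmf_intZ//.
apply: bmf_int_le; [exact: bmf_norm|exact: bmfZ|move=> t].
have S01 : 0 <= 1 - \1_S t :> R.
  by rewrite indicE; case: (_ \in _); rewrite ?subrr ?subr0.
rewrite -[X in `|X - _|]mulr1 -mulrBr normrM (ger0_norm S01) ler_wpM2r//.
exact: le_trans (fM t) (ler_norm M).
Qed.

End full_measure.

Lemma half_sum_law (R : realType) (X : hilbertType R) (Q : probability (borel X) R)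
    (V : X -> X) : separable_space X ->
  (forall a h, V (a *: h) = a *: V h) ->
  (forall h, \int[Q]_x cos (inner h x) = expR (- (`|V h| ^+ 2 / 2))) ->
  (forall h, \int[Q]_x sin (inner h x) = 0) ->
  forall f : borel X -> R, bmf f ->
  \int[Q]_s \int[Q]_t f ((Num.sqrt 2)^-1 *: (s + t : X)) = \int[Q]_x f x.
Proof.
move=> hX VZ cosQ sinQ f bf; set c : R := (Num.sqrt 2)^-1.
pose v (z : borel X * borel X) : borel X := c *: (z.1 + z.2 : X).
have mv : measurable_fun setT v.
  apply: (measurableT_comp (measurable_hscale c)).
  exact: measurable_hadd.
have mi h : measurable_fun setT (fun x : borel X => inner h x) by exact: measurable_inner.
have bc h : bmf (fun x : borel X => cos (inner h x)) by exact: bmf_cos.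
have bs h : bmf (fun x : borel X => sin (inner h x)) by exact: bmf_sin.
have vE h z : inner h (v z) = inner (c *: h) z.1 + inner (c *: h) z.2.
  by rewrite /v innerZr innerDr !innerZl mulrDr.
rewrite -(charfun_unique (P := (Q \x Q)%E) (Q := Q) (v := v) (w := id) hX)//.
- by rewrite bmf_fubini1//; exact: bmf_comp.
- move=> h; rewrite bmf_fubini1; last exact: (bmf_comp mv (bc h)).
  under eq_Rintegral => s _.
    under eq_Rintegral do rewrite vE/= cosD.
    rewrite bmf_intB; [|exact: bmfZ..].
    rewrite !bmf_intZ// sinQ mulr0 subr0 mulrC; over.
  rewrite bmf_intZ// !cosQ -expRD VZ normrZ exprMn; congr expR.
  have -> : `|c| ^+ 2 = 1 / 2.
    by rewrite real_normK ?num_real// exprVn sqr_sqrtr// div1r.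
  by field.
- move=> h; rewrite bmf_fubini1; last exact: (bmf_comp mv (bs h)).
  under eq_Rintegral => s _.
    under eq_Rintegral do rewrite vE/= sinD.
    rewrite bmf_intD; [|exact: bmfZ..].
    rewrite !bmf_intZ// sinQ mulr0 addr0 mulrC; over.
  by rewrite bmf_intZ// !sinQ mulr0.
Qed.

(** * The Gaussian coupling of nu and mu *)

Section gaussian_pair.
Context {R : realType} {X : hilbertType R}.
Hypothesis hX : separable_space X.
Variables (mu nu : probability (borel X) R) (A B : borel X -> borel X).
Hypotheses (mA : measurable_fun setT A) (mB : measurable_fun setT B).
Variables (W V Z : X -> X) (r : R) (e e' : nat -> X).
Hypothesis r01 : 0 <= r <= 1.
Hypothesis W_lin : forall a x y, W (a *: x + y) = a *: W x + W y.
Hypothesis V_lin : forall a x y, V (a *: x + y) = a *: V x + V y.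
Hypothesis Z_lin : forall a x y, Z (a *: x + y) = a *: Z x + Z y.
Hypothesis cos_mu : forall h, \int[mu]_x cos (inner h x) = expR (- (`|W h| ^+ 2 / 2)).
Hypothesis sin_mu : forall h, \int[mu]_x sin (inner h x) = 0.
Hypothesis cos_nu : forall h, \int[nu]_x cos (inner h x) = expR (- (`|V h| ^+ 2 / 2)).
Hypothesis sin_nu : forall h, \int[nu]_x sin (inner h x) = 0.
Hypothesis cos_A : forall h, \int[nu]_x cos (inner h (A x)) = expR (- (`|Z h| ^+ 2 / 2)).
Hypothesis sin_A : forall h, \int[nu]_x sin (inner h (A x)) = 0.
Hypothesis cos_B : forall h,
  \int[mu]_x cos (inner h (B x)) = expR (- ((`|W h| ^+ 2 - `|Z h| ^+ 2) / 2)).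
Hypothesis sin_B : forall h, \int[mu]_x sin (inner h (B x)) = 0.
Hypothesis ZW : forall h, `|Z h| <= r * `|W h|.
Hypothesis basis_e : orthonormal_basis setT e.
Hypothesis basis_e' : orthonormal_basis setT e'.
Hypothesis trace_mu : cvgn (series (fun k => `|W (e k)| ^+ 2)).
Hypothesis trace_nu : cvgn (series (fun k => `|V (e' k)| ^+ 2)).

Section linear.
Variable L : X -> X.
Hypothesis L_lin : forall a x y, L (a *: x + y) = a *: L x + L y.

Let L0 : L 0 = 0.
Proof. by have := L_lin (-1) 0 0; rewrite scaler0 addr0 scaleN1r addNr. Qed.

Lemma lin_scale a x : L (a *: x) = a *: L x.
Proof. by rewrite -[a *: x]addr0 L_lin L0 addr0. Qed.

Lemma lin_add : {morph L : x y / x + y}.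
Proof. by move=> x y; have := L_lin 1 x y; rewrite !scale1r. Qed.

Lemma lin_opp : {morph L : x / - x}.
Proof. by move=> x; rewrite -scaleN1r lin_scale scaleN1r. Qed.

Lemma lin_sum I (s : seq I) (c : I -> R) (h : I -> X) :
  L (\sum_(i <- s) c i *: h i) = \sum_(i <- s) c i *: L (h i).
Proof.
elim: s => [|i s ih]; first by rewrite !big_nil L0.
by rewrite !big_cons L_lin ih.
Qed.

End linear.

Implicit Types f g : borel X -> R.

Definition pair_prob := (nu \x mu)%E.
Let P : probability _ R := pair_prob.

(** With the first coordinate it forms the coupling; [gamma] below is the conditional expectation of
    f composed with it, given that coordinate. *)
Definition pair_out (z : borel X * borel X) : borel X := (A z.1 : X) + (B z.2 : X).

Lemma measurable_pair_out : measurable_fun setT pair_out.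
Proof.
apply: measurable_hadd => //.
  exact: measurableT_comp mA measurable_fst.
exact: measurableT_comp mB measurable_snd.
Qed.

Lemma bmf_out f : bmf f -> bmf (fun z => f (pair_out z)).
Proof. by move=> bf; apply: bmf_comp => //; exact: measurable_pair_out. Qed.

Let mAh h : measurable_fun setT (fun x => inner h (A x)).
Proof. exact: (measurableT_comp (measurable_inner h) mA). Qed.

Let mBh h : measurable_fun setT (fun x => inner h (B x)).
Proof. exact: (measurableT_comp (measurable_inner h) mB). Qed.

Lemma pair_fst f : bmf f -> \int[P]_z f z.1 = \int[nu]_x f x.
Proof.
move=> bf; rewrite bmf_fubini1; last by apply: bmf_comp => //; exact: measurable_fst.
by apply: eq_Rintegral => x _; rewrite /= prob_int_cst.
Qed.

Definition gamma (f : borel X -> R) (x : borel X) : R := \int[mu]_y f (pair_out (x, y)).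

Lemma gamma_cos h x : gamma (fun z => cos (inner h z)) x =
  expR (- ((`|W h| ^+ 2 - `|Z h| ^+ 2) / 2)) * cos (inner h (A x)).
Proof.
rewrite /gamma /pair_out/=.
under eq_Rintegral do rewrite innerDr cosD.
rewrite bmf_intB; [|by apply: bmfZ; exact: bmf_cos|by apply: bmfZ; exact: bmf_sin].
by rewrite !bmf_intZ ?cos_B ?sin_B ?mulr0 ?subr0 1?mulrC//; [exact: bmf_sin|exact: bmf_cos].
Qed.

Lemma gamma_sin h x : gamma (fun z => sin (inner h z)) x =
  expR (- ((`|W h| ^+ 2 - `|Z h| ^+ 2) / 2)) * sin (inner h (A x)).
Proof.
rewrite /gamma /pair_out/=.
under eq_Rintegral do rewrite innerDr sinD.
rewrite bmf_intD; [|by apply: bmfZ; exact: bmf_cos|by apply: bmfZ; exact: bmf_sin].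
by rewrite !bmf_intZ ?cos_B ?sin_B ?mulr0 ?addr0 1?mulrC//; [exact: bmf_sin|exact: bmf_cos].
Qed.

Lemma gamma_bmf f : bmf f -> bmf (gamma f).
Proof. by move=> /bmf_out bf; exact: (bmf_int1 (P1 := nu) (P2 := mu) bf). Qed.

Lemma pair_out_gamma f : bmf f -> \int[P]_z f (pair_out z) = \int[nu]_x gamma f x.
Proof. by move=> bf; rewrite bmf_fubini1//; exact: bmf_out. Qed.

(** A x and B y are independent and their variances |Z h|^2 and |W h|^2 - |Z h|^2 add up to that of
    mu. *)
Lemma pair_out_law f : bmf f -> \int[P]_z f (pair_out z) = \int[mu]_x f x.
Proof.
apply: (charfun_unique (w := id) (v := pair_out) (P := P) hX) => //.
- exact: measurable_pair_out.
- move=> h.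
  have E : bmf (fun z : borel X => cos (inner h z)).
    by apply: bmf_cos; exact: measurable_inner.
  rewrite (pair_out_gamma E).
  rewrite cos_mu; under eq_Rintegral do rewrite gamma_cos.
  rewrite bmf_intZ ?cos_A; last exact: bmf_cos.
  by rewrite -expRD; congr expR; field.
- move=> h.
  have E : bmf (fun z : borel X => sin (inner h z)).
    by apply: bmf_sin; exact: measurable_inner.
  rewrite (pair_out_gamma E).
  rewrite sin_mu; under eq_Rintegral do rewrite gamma_sin.
  by rewrite bmf_intZ ?sin_A ?mulr0//; exact: bmf_sin.
Qed.

Lemma gammaB f g x : bmf f -> bmf g ->
  gamma (fun z => f z - g z) x = gamma f x - gamma g x.
Proof.
by move=> /bmf_out bf /bmf_out bg; rewrite /gamma bmf_intB//; [exact: (bmf_pair1 bf)|exact: (bmf_pair1 bg)].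
Qed.

Lemma gamma_int f : bmf f -> \int[nu]_x gamma f x = \int[mu]_x f x.
Proof. by move=> bf; rewrite -pair_out_gamma// pair_out_law. Qed.

Lemma gamma_l2 f : bmf f -> l2norm nu (gamma f) <= l2norm mu f.
Proof.
move=> bf; rewrite -ler_sqr ?nnegrE ?l2norm_ge0// !l2norm_sqr.
rewrite -(gamma_int (bmfX 2 bf)); apply: bmf_int_le.
- exact/bmfX/gamma_bmf.
- exact/gamma_bmf/bmfX.
- by move=> x; apply: sqr_int_le; exact: (bmf_pair1 (bmf_out bf)).
Qed.

Let gamma_trig (s : seq (R * R * X)) (x : borel X) :
  gamma (trig_poly s) x = trig_poly [seq
   (i.1.1 * expR (- ((`|W i.2| ^+ 2 - `|Z i.2| ^+ 2) / 2)),
    i.1.2 * expR (- ((`|W i.2| ^+ 2 - `|Z i.2| ^+ 2) / 2)), i.2) | i <- s] (A x).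
Proof.
have bc h : bmf (fun z : borel X => cos (inner h z)).
  by apply: bmf_cos; exact: measurable_inner.
have bs h : bmf (fun z : borel X => sin (inner h z)).
  by apply: bmf_sin; exact: measurable_inner.
have bc' h : bmf (fun y => cos (inner h (pair_out (x, y)))).
  exact: (bmf_pair1 (bmf_out (bc h)) x).
have bs' h : bmf (fun y => sin (inner h (pair_out (x, y)))).
  exact: (bmf_pair1 (bmf_out (bs h)) x).
rewrite /gamma bmf_int_sum => [|i]; last by apply: bmfD; exact: bmfZ.
rewrite /trig_poly big_map; apply: eq_bigr => i _.
rewrite bmf_intD; [|exact: bmfZ..]; rewrite !bmf_intZ//=.
by rewrite -/(gamma (fun z => cos (inner i.2 z)) x) -/(gamma (fun z => sin (inner i.2 z)) x)
  gamma_cos gamma_sin; ring.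
Qed.

(** [gamma] keeps each frequency and damps its coefficient. Both variances become quadratic forms
    with the same coefficients, in the kernels cosh - 1 and sinh of the Gram matrices of Z and of W,
    which [kle_series] compares. *)
Let gebelein_trig (s : seq (R * R * X)) :
  l2norm nu (fun x => gamma (trig_poly s) x - \int[mu]_y trig_poly s y) <=
  r * l2norm mu (fun x => trig_poly s x - \int[mu]_y trig_poly s y).
Proof.
have /andP[r0 r1] := r01.
rewrite -ler_sqr ?nnegrE ?mulr_ge0 ?l2norm_ge0// exprMn !l2norm_sqr.
rewrite (trig_poly_var (w := id) _ (lin_add W_lin) (lin_opp W_lin) cos_mu sin_mu)//.
rewrite -(gamma_int (trig_poly_bmf s)).
set s' := [seq (i.1.1 * expR (- ((`|W i.2| ^+ 2 - `|Z i.2| ^+ 2) / 2)),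
    i.1.2 * expR (- ((`|W i.2| ^+ 2 - `|Z i.2| ^+ 2) / 2)), i.2) | i <- s].
have -> : gamma (trig_poly s) = (fun x => trig_poly s' (A x)).
  by apply/funext => x; exact: gamma_trig.
rewrite (trig_poly_var mA (lin_add Z_lin) (lin_opp Z_lin) cos_A sin_A).
rewrite !qform_map/=.
pose a (h : X) : R := expR (- ((`|W h| ^+ 2 - `|Z h| ^+ 2) / 2)).
pose b (h : X) : R := expR (- (`|Z h| ^+ 2 / 2)).
pose g (h : X) : R := expR (- (`|W h| ^+ 2 / 2)).
(* The damping factor times the Gaussian mean for Z is the Gaussian mean for W. *)
have E (c : R * R * X -> R) : (fun i => c i * a i.2 * b i.2) = (fun i => c i * g i.2).
  apply/funext => i; rewrite -mulrA; congr (_ * _).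
  by rewrite /a /b -expRD; congr expR; field.
have := E (fun i => i.1.1); rewrite /a /b /g => ->.
have := E (fun i => i.1.2); rewrite /a /b /g => -> {E a b g}.
have zw (c : R * R * X -> R) : `|\sum_(i <- s) c i *: Z i.2| <= r * `|\sum_(i <- s) c i *: W i.2|.
  by rewrite -!lin_sum.
rewrite mulrDr.
have [b [b0 b00 bc]] := @cosh_series R.
have [b' [b0' b00' bs]] := @sinh_series R.
have := kle_series basis_e r01 zw b0 b00 bc.
have := kle_series basis_e r01 zw b0' b00' bs.
move=> /(_ (fun i => i.1.2 * expR (- (`|W i.2| ^+ 2 / 2)))) h1.
move=> /(_ (fun i => i.1.1 * expR (- (`|W i.2| ^+ 2 / 2)))) h2.
by rewrite lerD// -qformZ.
Qed.

(** Approximate by a trigonometric polynomial in L^2(mu); the polynomial need not be centered, and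
    its mean is transferred to the remainder, whose norm does not grow because variance is at most
    the second moment. *)
Lemma gebelein f : bmf f -> \int[mu]_x f x = 0 ->
  l2norm nu (gamma f) <= r * l2norm mu f.
Proof.
move=> bf f0; have /andP[r0 r1] := r01.
apply/ler_addgt0Pr => e0 e00.
have e2 : 0 < e0 / 2 by rewrite divr_gt0.
have [s hs] := trig_poly_approx hX mu bf e2.
have bt := trig_poly_bmf s.
set m := \int[mu]_y trig_poly s y.
have bu : bmf (fun x => f x - trig_poly s x) by exact: bmfB.
have bum : bmf (fun x => f x - trig_poly s x + m) by apply: bmfD => //; exact: bmf_cst.
have btm : bmf (fun x => trig_poly s x - m) by apply: bmfB => //; exact: bmf_cst.
have um : \int[mu]_x (f x - trig_poly s x) = - m by rewrite bmf_intB// f0 sub0r.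
have gE : gamma f = (fun x => gamma (fun z => f z - trig_poly s z + m) x + (gamma (trig_poly s) x - m)).
  apply/funext => x.
  have -> : gamma (fun z => f z - trig_poly s z + m) x = gamma f x - gamma (trig_poly s) x + m.
    rewrite /gamma bmf_intD; [|exact: bmf_pair1 (bmf_out bu) _|exact: bmf_cst].
    by rewrite prob_int_cst -/(gamma (fun z => f z - trig_poly s z) x) gammaB.
  by rewrite addrA addrAC addrK subrK.
rewrite gE; have bg := gamma_bmf bum.
have bg' : bmf (fun x => gamma (trig_poly s) x - m).
  by apply: bmfB; [exact: gamma_bmf|exact: bmf_cst].
have h1 : l2norm mu (fun z => f z - trig_poly s z + m) <= l2norm mu (fun z => f z - trig_poly s z).
  apply: l2norm_le; rewrite !l2norm_sqr.
  have := variance_eq (P := mu) bu; rewrite um; under eq_Rintegral do rewrite opprK.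
  by move=> ->; rewrite lerBlDr lerDl sqr_ge0.
have h2 : l2norm mu (fun z => trig_poly s z - m) <= l2norm mu f + l2norm mu (fun z => f z - trig_poly s z).
  have -> : (fun z => trig_poly s z - m) = (fun z => f z + - (f z - trig_poly s z + m)).
    by apply/funext => z; ring.
  rewrite (le_trans (l2normD _ _))//; first exact: bmfN.
  rewrite lerD2l; apply: le_trans h1; rewrite /l2norm ler_wsqrtr//.
  by under eq_Rintegral do rewrite sqrrN.
rewrite (le_trans (l2normD bg bg'))// (le_trans (lerD (gamma_l2 bum) (gebelein_trig s)))//.
have h3 := ler_wpM2l r0 h2.
have h4 : r * l2norm mu (fun z => f z - trig_poly s z) <= e0 / 2.
  by rewrite (le_trans _ hs)// ler_piMl// l2norm_ge0.
rewrite -/m mulrDr in h3 *.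
have := le_trans h1 hs; move: h3 h4; lra.
Qed.

(** Integrating out the second coordinate turns the correlation into the nu-integral of f times
    [gamma g]; then Cauchy-Schwarz and [gebelein]. *)
Lemma pair_correlation f g : bmf f -> bmf g ->
  \int[P]_z f z.1 = 0 -> \int[P]_z g (pair_out z) = 0 ->
  (\int[P]_z (f z.1 * g (pair_out z))) ^+ 2 <=
  r ^+ 2 * ((\int[P]_z f z.1 ^+ 2) * (\int[P]_z g (pair_out z) ^+ 2)).
Proof.
move=> bf bg _; rewrite pair_out_law// => g0.
have bf1 : bmf (fun z : borel X * borel X => f z.1).
  by apply: bmf_comp => //; exact: measurable_fst.
rewrite bmf_fubini1; last by apply: bmfM => //; exact: bmf_out.
under eq_Rintegral => x _.
  rewrite /= bmf_intZ; last exact: bmf_pair1 (bmf_out bg) x.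
  rewrite -/(gamma g x); over.
rewrite (pair_fst (bmfX 2 bf)) (pair_out_law (bmfX 2 bg)).
apply: le_trans (bmf_cauchy_schwarz bf (gamma_bmf bg)) _.
rewrite [leRHS]mulrCA ler_wpM2l//.
  by apply: Rintegral_ge0 => x _; exact: sqr_ge0.
rewrite -!l2norm_sqr -exprMn lerXn2r ?nnegrE ?l2norm_ge0 ?mulr_ge0 ?l2norm_ge0//.
  by case/andP: r01.
exact: gebelein.
Qed.


Let c : R := (Num.sqrt 2)^-1.
Let cadd (x y : borel X) : borel X := c *: ((x : X) + (y : X)).

Let measurable_cadd d (T : measurableType d) (u w : T -> borel X) :
  measurable_fun setT u -> measurable_fun setT w ->
  measurable_fun setT (fun t => cadd (u t) (w t)).
Proof.
move=> mu' mw'; apply: (measurableT_comp (measurable_hscale c)).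
exact: measurable_hadd.
Qed.

(** Each coordinate of the product measure is invariant under (s + t) / sqrt 2. Fubini brings the
    two copies of one coordinate together, and [half_sum_law] is applied to nu and then to mu. *)
Lemma pair_rotation (F : borel X * borel X -> R) : bmf F ->
  \int[P]_s \int[P]_t F (cadd s.1 t.1, cadd s.2 t.2) = \int[P]_z F z.
Proof.
move=> bF.
have bF1 d (T : measurableType d) (u : T -> borel X * borel X) :
    measurable_fun setT u -> bmf (fun t => F (u t)) by move=> mu'; exact: bmf_comp.
have m4 d (T : measurableType d) (u1 u2 w1 w2 : T -> borel X) :
    measurable_fun setT u1 -> measurable_fun setT u2 -> measurable_fun setT w1 ->
    measurable_fun setT w2 ->
    bmf (fun t => F (cadd (u1 t) (w1 t), cadd (u2 t) (w2 t))).
  by move=> *; apply: bF1; apply: measurable_fun_pair; exact: measurable_cadd.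
have bG : bmf (fun a => \int[mu]_y F (a, y)) by exact: bmf_int1 bF.
rewrite [RHS]bmf_fubini1//.
rewrite -(half_sum_law hX (lin_scale V_lin) cos_nu sin_nu bG).
rewrite bmf_fubini1; last first.
  apply: (@bmf_int1 _ _ _ _ _ P P (fun st => F (cadd st.1.1 st.2.1, cadd st.1.2 st.2.2))).
  by apply: m4; do ?[exact: measurableT_comp measurable_fst measurable_fst
   |exact: measurableT_comp measurable_snd measurable_fst
   |exact: measurableT_comp measurable_fst measurable_snd
   |exact: measurableT_comp measurable_snd measurable_snd].
apply: eq_Rintegral => s1 _.
transitivity (\int[mu]_s2 \int[nu]_t1 \int[mu]_t2 F (cadd s1 t1, cadd s2 t2)).
  apply: eq_Rintegral => s2 _; rewrite bmf_fubini1//; apply: m4 => //.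
transitivity (\int[nu]_t1 \int[mu]_s2 \int[mu]_t2 F (cadd s1 t1, cadd s2 t2)).
  have bK : bmf (fun st : borel X * borel X => \int[mu]_t2 F (cadd s1 st.2, cadd st.1 t2)).
    apply: (@bmf_int1 _ _ _ _ _ P mu (fun st => F (cadd s1 st.1.2, cadd st.1.1 st.2))).
    apply: m4 => //.
    - exact: measurableT_comp measurable_fst measurable_fst.
    - exact: measurableT_comp measurable_snd measurable_fst.
  by rewrite -(bmf_fubini1 bK (P1 := mu) (P2 := nu)) (bmf_fubini2 bK).
apply: eq_Rintegral => t1 _.
apply: (half_sum_law hX (lin_scale W_lin) cos_mu sin_mu (f := fun y => F (cadd s1 t1, y))).
by apply: bF1; exact: measurable_fun_pair.
Qed.

Variables (VA VB : set (borel X)).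
Hypotheses (mVA : measurable VA) (mVB : measurable VB).
Hypotheses (VA1 : nu VA = 1%E) (VB1 : mu VB = 1%E).
Hypothesis VA_lin : forall a (x y : X), VA x -> VA y -> VA (a *: x + y).
Hypothesis VB_lin : forall a (x y : X), VB x -> VB y -> VB (a *: x + y).
Hypothesis VA0 : VA (0 : X).
Hypothesis VB0 : VB (0 : X).
Hypothesis A_lin : forall a (x y : X), VA x -> VA y ->
  A (a *: x + y) = a *: (A x : X) + (A y : X).
Hypothesis B_lin : forall a (x y : X), VB x -> VB y ->
  B (a *: x + y) = a *: (B x : X) + (B y : X).

Section linear_on.
Variables (U : set (borel X)) (L : borel X -> borel X).
Hypothesis U0 : U (0 : X).
Hypothesis U_lin : forall a (x y : X), U x -> U y -> U (a *: x + y).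
Hypothesis L_lin : forall a (x y : X), U x -> U y ->
  L (a *: x + y) = a *: (L x : X) + (L y : X).

Lemma linear_on0 : L (0 : X) = (0 : X).
Proof. by have := L_lin (-1) U0 U0; rewrite scaler0 addr0 scaleN1r addNr. Qed.

Lemma linear_on_scale a (x : X) : U x -> U (a *: x) /\ L (a *: x) = a *: (L x : X).
Proof.
move=> Ux; have := U_lin a Ux U0; have := L_lin a Ux U0.
by rewrite linear_on0 !addr0.
Qed.

Lemma linear_on_cadd (x y : X) : U x -> U y ->
  Num.sqrt 2 *: (L (cadd x y) : X) = (L x : X) + (L y : X).
Proof.
move=> Ux Uy; have Uxy : U (x + y) by have := U_lin 1 Ux Uy; rewrite scale1r.
have [_ ->] := linear_on_scale c Uxy.
rewrite scalerA divff ?scale1r; last by rewrite gt_eqF// sqrtr_gt0.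
by have := L_lin 1 Ux Uy; rewrite !scale1r.
Qed.

End linear_on.

(** On the full-measure set where A and B are linear, [pair_out] commutes with normalised sums, so
    [pair_rotation] applies. Both integrations are first restricted to that set. *)
Lemma pair_stable f g : bmf f -> bmf g ->
  \int[P]_s \int[P]_t (f ((s.1 : X) + (t.1 : X)) *
     g ((pair_out s : X) + (pair_out t : X))) =
  \int[P]_z (f (Num.sqrt 2 *: (z.1 : X)) * g (Num.sqrt 2 *: (pair_out z : X))).
Proof.
move=> bf bg; set a : R := Num.sqrt 2.
have a0 : a != 0 by rewrite gt_eqF// sqrtr_gt0.
pose F (z : borel X * borel X) := f (a *: (z.1 : X)) * g (a *: (pair_out z : X)).
have bF : bmf F.
  apply: bmfM.
    exact: (bmf_comp (measurableT_comp (measurable_hscale a) measurable_fst) bf).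
  exact: (bmf_comp (measurableT_comp (measurable_hscale a) measurable_pair_out) bg).
rewrite -(pair_rotation bF).
have mS : measurable (VA `*` VB) by exact: measurableX.
have PS : P (VA `*` VB) = 1%E.
  by rewrite /P /pair_prob/= product_measure1E// [X in (X * _)%E]VA1 [X in (_ * X)%E]VB1 mul1e.
have bH1 : bmf (fun st : (borel X * borel X) * (borel X * borel X) =>
    f ((st.1.1 : X) + (st.2.1 : X)) * g ((pair_out st.1 : X) + (pair_out st.2 : X))).
  apply: bmfM.
    apply: (bmf_comp _ bf); apply: (measurable_hadd hX).
      exact: measurableT_comp measurable_fst measurable_fst.
    exact: measurableT_comp measurable_fst measurable_snd.
  apply: (bmf_comp _ bg); apply: (measurable_hadd hX).
    exact: measurableT_comp measurable_pair_out measurable_fst.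
  exact: measurableT_comp measurable_pair_out measurable_snd.
have bH2 : bmf (fun st : (borel X * borel X) * (borel X * borel X) =>
    F (cadd st.1.1 st.2.1, cadd st.1.2 st.2.2)).
  apply: (bmf_comp _ bF); apply: measurable_fun_pair; apply: measurable_cadd.
  - exact: measurableT_comp measurable_fst measurable_fst.
  - exact: measurableT_comp measurable_fst measurable_snd.
  - exact: measurableT_comp measurable_snd measurable_fst.
  - exact: measurableT_comp measurable_snd measurable_snd.
rewrite (int_full_measure mS PS (bmf_int1 (P1 := P) (P2 := P) bH1)).
rewrite [RHS](int_full_measure mS PS (bmf_int1 (P1 := P) (P2 := P) bH2)).
apply: eq_Rintegral => s _; rewrite indicE.
have [/set_mem[sA sB]|_] := boolP (s \in _); last by rewrite !mulr0.
rewrite !mulr1.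
rewrite (int_full_measure mS PS (bmf_pair1 bH1 s)) (int_full_measure mS PS (bmf_pair1 bH2 s)).
apply: eq_Rintegral => t _; rewrite indicE.
have [/set_mem[tA tB]|_] := boolP (t \in _); last by rewrite !mulr0.
rewrite !mulr1 /F /pair_out/=; congr (f _ * g _).
  by rewrite /cadd scalerA divff// scale1r.
rewrite scalerDr (linear_on_cadd VA0 VA_lin A_lin sA tA).
by rewrite (linear_on_cadd VB0 VB_lin B_lin sB tB) addrACA.
Qed.

Lemma pair_hypercontractive (al be : R) f g : 0 < al < 1 -> 0 < be < 1 ->
  r ^+ 2 * (al * be) <= (1 - al) * (1 - be) -> bmf f -> bmf g ->
  (forall x, 0 <= f x) -> (forall x, 0 <= g x) ->
  \int[P]_z (f z.1 `^ al * g (pair_out z) `^ be) <=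
  (\int[nu]_x f x) `^ al * (\int[mu]_x g x) `^ be.
Proof.
move=> al01 be01 alber bf bg f0 g0.
have out2 : P.-integrable setT (fun z => (`|pair_out z : X| ^+ 2)%:E).
  apply: (norm_sqr_integrable measurable_pair_out (lin_scale W_lin) _ basis_e trace_mu).
  move=> h; rewrite (pair_out_law (f := fun x => cos (inner h x)))//.
  by apply: bmf_cos; exact: measurable_inner.
have fst2 : P.-integrable setT (fun z => (`|z.1 : X| ^+ 2)%:E).
  apply: (norm_sqr_integrable measurable_fst (lin_scale V_lin) _ basis_e' trace_nu).
  move=> h; rewrite (pair_fst (f := fun x => cos (inner h x)))//.
  by apply: bmf_cos; exact: measurable_inner.
have := hypercontractive_bmf hX measurable_fst measurable_pair_out al01 be01 alber
  pair_stable pair_correlation fst2 out2 bf bg f0 g0.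
by rewrite (pair_fst bf) (pair_out_law bg).
Qed.

End gaussian_pair.

(** * Orthonormal families padded with zeros, and diagonal operators *)

Section orthonormal_series.
Context {R : realType} {X : hilbertType R}.
Variable f : nat -> X.
Hypothesis f_norm : forall k, `|f k| = 1 \/ f k = 0.
Hypothesis f_orth : forall j k, j != k -> inner (f j) (f k) = 0.
Implicit Types x y : X.

Lemma normsqrD_orth x y : inner x y = 0 -> `|x + y| ^+ 2 = `|x| ^+ 2 + `|y| ^+ 2.
Proof.
by move=> xy; rewrite -!inner_norm innerDl !innerDr (innerC y) xy addr0 add0r.
Qed.

(** Lets padding vectors be treated together with unit vectors: where the norm is 0 the coefficient
    is 0 as well. *)
Lemma coef_norm k x : inner x (f k) * `|f k| ^+ 2 = inner x (f k).
Proof. by case: (f_norm k) => ->; rewrite ?expr1n ?mulr1// inner0r mul0r. Qed.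

Lemma inner_orth_sum (c : nat -> R) (s : seq nat) j : uniq s ->
  inner (\sum_(k <- s) c k *: f k) (f j) = (if j \in s then c j * `|f j| ^+ 2 else 0).
Proof.
move=> us; rewrite inner_suml.
have h : forall k, k != j -> inner (c k *: f k) (f j) = 0.
  by move=> k kj; rewrite innerZl f_orth// mulr0.
case: ifPn => js.
  rewrite (bigD1_seq j)//= big1 => [|k kj]; last exact: h.
  by rewrite addr0 innerZl inner_norm.
rewrite big_seq big1// => k ks; apply: h; apply: contraNneq js => <-//.
Qed.

Lemma norm_orth_sum (c : nat -> R) (s : seq nat) : uniq s ->
  `|\sum_(k <- s) c k *: f k| ^+ 2 <= \sum_(k <- s) c k ^+ 2.
Proof.
elim: s => [_|k s ih /= /andP[ks us]]; first by rewrite !big_nil normr0 expr0n.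
rewrite !big_cons normsqrD_orth.
  apply: lerD; last exact: ih.
  rewrite normrZ exprMn real_normK ?num_real//.
  by case: (f_norm k) => ->; rewrite ?normr0 ?expr1n ?mulr1// expr0n mulr0 sqr_ge0.
by rewrite innerZl innerC inner_orth_sum// (negbTE ks) mulr0.
Qed.

Lemma bessel x m : \sum_(k < m) inner x (f k) ^+ 2 <= `|x| ^+ 2.
Proof.
rewrite -(big_mkord xpredT (fun k => inner x (f k) ^+ 2)).
pose y := \sum_(0 <= k < m) inner x (f k) *: f k.
have yE j : (0 <= j < m)%N -> inner y (f j) = inner x (f j).
  by move=> jm; rewrite inner_orth_sum ?iota_uniq// mem_index_iota jm coef_norm.
have E : \sum_(0 <= k < m) inner x (f k) ^+ 2 = inner x y.
  by rewrite inner_sumr; apply: eq_bigr => k _; rewrite innerZr expr2.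
have E' : inner y y = inner x y.
  rewrite inner_sumr big_seq inner_sumr [RHS]big_seq; apply: eq_bigr => k.
  by rewrite mem_index_iota => km; rewrite !innerZr yE.
rewrite E -E'.
have := inner_self_ge0 (x - y); rewrite innerBl !innerBr E' (innerC y x) inner_norm.
lra.
Qed.

Lemma orth_series_cvg (c : nat -> R) (M : R) :
  (forall m, \sum_(k < m) c k ^+ 2 <= M) ->
  cvgn (fun m => \sum_(k < m) c k *: f k).
Proof.
move=> cM.
have cs : cvgn (series (fun k => c k ^+ 2)).
  apply: nondecreasing_is_cvgn.
    by apply: nondecreasing_series => k _ _; exact: sqr_ge0.
  by exists M => _ [m _ <-]; rewrite /series/= big_mkord.
rewrite (_ : (fun m => _) = series (fun k => c k *: f k)); last first.
  by apply/funext => m; rewrite /series/= big_mkord.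
apply/cauchy_cvgP/cauchy_seriesP => e e0.
have /cauchy_cvgP/cauchy_seriesP/(_ (e ^+ 2)) := cs.
rewrite exprn_gt0// => /(_ isT); apply: filterS => -[m n] /=.
rewrite ger0_norm; last by rewrite sumr_ge0// => k _; exact: sqr_ge0.
move=> h; rewrite -ltr_sqr ?nnegrE ?(ltW e0)//.
by apply: le_lt_trans h; apply: norm_orth_sum; exact: iota_uniq.
Qed.

(** For bounded [c] Bessel's inequality makes the series converge ([diag_op_cvg]). *)
Definition diag_op (c : nat -> R) (x : X) : X :=
  limn (fun m => \sum_(k < m) (c k * inner x (f k)) *: f k).

Section diag.
Variables (c : nat -> R) (C : R).
Hypothesis cC : forall k, `|c k| <= C.

Let C0 : 0 <= C. Proof. exact: le_trans (cC 0). Qed.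

Let coef_le x m : \sum_(k < m) (c k * inner x (f k)) ^+ 2 <= (C * `|x|) ^+ 2.
Proof.
rewrite exprMn (le_trans _ (ler_wpM2l (sqr_ge0 C) (bessel x m)))//.
rewrite big_distrr/=; apply: ler_sum => k _.
rewrite exprMn ler_wpM2r ?sqr_ge0// -(real_normK (num_real (c k))).
by rewrite lerXn2r// nnegrE.
Qed.

Lemma diag_op_cvg x :
  \sum_(k < m) (c k * inner x (f k)) *: f k @[m --> \oo] --> diag_op c x.
Proof. exact: (orth_series_cvg (c := fun k => c k * inner x (f k)) (coef_le x)). Qed.

Lemma diag_op_inner x y :
  \sum_(k < m) c k * inner x (f k) * inner y (f k) @[m --> \oo] --> inner (diag_op c x) y.
Proof.
rewrite (innerC (diag_op c x)) (_ : (fun m => \sum_(k < m) _) =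
  (fun m => inner y (\sum_(k < m) (c k * inner x (f k)) *: f k))).
  exact: (cvg_inner (h := y) (@diag_op_cvg x)).
apply/funext => m; rewrite inner_sumr; apply: eq_bigr => k _.
by rewrite innerZr.
Qed.

Lemma diag_op_sym x y : inner (diag_op c x) y = inner x (diag_op c y).
Proof.
rewrite (innerC x); apply/esym.
rewrite -(cvg_lim _ (@diag_op_inner y x))// -(cvg_lim _ (@diag_op_inner x y))//.
by congr (limn _); apply/funext => m; apply: eq_bigr => k _; rewrite mulrAC.
Qed.

Lemma diag_op_lin a x y : diag_op c (a *: x + y) = a *: diag_op c x + diag_op c y.
Proof.
apply: cvg_lim => //.
rewrite (_ : (fun m => _) = (fun m => a *: (\sum_(k < m) (c k * inner x (f k)) *: f k) +
  \sum_(k < m) (c k * inner y (f k)) *: f k)).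
  by apply: cvgD; [apply: cvgZr; exact: diag_op_cvg|exact: diag_op_cvg].
apply/funext => m; rewrite scaler_sumr -big_split/=; apply: eq_bigr => k _.
by rewrite scalerA -scalerDl innerDl innerZl; congr (_ *: _); ring.
Qed.

Lemma diag_op_norm x : `|diag_op c x| <= C * `|x|.
Proof.
rewrite -ler_sqr ?nnegrE ?mulr_ge0//.
have h := @diag_op_cvg x.
have h2 : `|\sum_(k < m) (c k * inner x (f k)) *: f k| ^+ 2 @[m --> \oo] --> `|diag_op c x| ^+ 2.
  by rewrite !expr2; apply: cvgM; exact: cvg_norm.
rewrite -(cvg_lim _ h2)//; apply: limr_le; first by apply/cvg_ex; eexists; exact: h2.
apply: nearW => m; rewrite (le_trans _ (coef_le x m))//.
rewrite -(big_mkord xpredT (fun k => (c k * inner x (f k)) *: f k)).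
rewrite -(big_mkord xpredT (fun k => (c k * inner x (f k)) ^+ 2)).
by apply: norm_orth_sum; exact: iota_uniq.
Qed.

Lemma diag_op_coef x j : inner (diag_op c x) (f j) = c j * inner x (f j).
Proof.
rewrite -(cvg_lim _ (@diag_op_inner x (f j)))//; apply: cvg_lim => //.
apply: cvg_near_cst; exists j.+1 => // m /= jm.
rewrite (bigD1 (Ordinal jm))//= inner_norm -mulrA coef_norm big1 ?addr0// => k kj.
by rewrite (f_orth (j := j) (k := k)) ?mulr0// eq_sym.
Qed.

End diag.

Lemma diag_op_eigen c C j : (forall k, `|c k| <= C) -> diag_op c (f j) = c j *: f j.
Proof.
move=> cC; apply: cvg_lim => //; apply: cvg_near_cst; exists j.+1 => // m /= jm.
rewrite (bigD1 (Ordinal jm))//= inner_norm big1 ?addr0 => [|k kj].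
  by case: (f_norm j) => ->; rewrite ?normr0 ?expr1n ?mulr1// !scaler0.
by rewrite (f_orth (j := j) (k := k)) ?mulr0 ?scale0r// eq_sym.
Qed.

Lemma diag_op_comp c c' C C' x : (forall k, `|c k| <= C) -> (forall k, `|c' k| <= C') ->
  diag_op c (diag_op c' x) = diag_op (fun k => c k * c' k) x.
Proof.
move=> cC cC'; congr (limn _); apply/funext => m; apply: eq_bigr => k _.
by rewrite (diag_op_coef cC') mulrA.
Qed.

End orthonormal_series.

Lemma cvg_inner_seq (R : realType) (X : hilbertType R) (u : nat -> X) (x h : X) :
  u @ \oo --> x -> inner h (u n) @[n --> \oo] --> inner h x.
Proof. by move=> ux; exact: cvg_inner. Qed.

Lemma bounded_linear_cvg (R : realType) (X : hilbertType R) (L : X -> X) (M : R)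
    (u : nat -> X) (x : X) :
  (forall a y z, L (a *: y + z) = a *: L y + L z) -> (forall y, `|L y| <= M * `|y|) ->
  u @ \oo --> x -> L (u n) @[n --> \oo] --> L x.
Proof.
move=> Llin LM ux; apply/cvgrPdist_le => e e0.
have M1 : 0 < `|M| + 1 by rewrite ltr_wpDl.
have e1 : 0 < e / (`|M| + 1) by rewrite divr_gt0.
move/cvgrPdist_le : ux => /(_ _ e1); apply: filterS => n xn.
rewrite -(lin_opp Llin) -(lin_add Llin) (le_trans (LM _))//.
rewrite (@le_trans _ _ ((`|M| + 1) * (e / (`|M| + 1))))//.
  rewrite (@le_trans _ _ (`|M| * `|x - u n|))//.
    by rewrite ler_wpM2r// ler_norm.
  by rewrite ler_pM// lerDl.
by rewrite mulrCA divff ?mulr1// gt_eqF.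
Qed.

(** * Spectral form of a covariance, its square root and pseudo-inverse *)

Section covariance.
Context {R : realType} {X : hilbertType R}.
Variables (Q : X -> X).
Hypothesis hQ : nonneg_operator ambient Q.

Lemma ipnorm_ambient (x : X) : ipnorm ambient x = `|x|.
Proof. by rewrite /ipnorm/= inner_norm sqrtr_sqr normr_id. Qed.

Lemma cov_lin a x y : Q (a *: x + y) = a *: Q x + Q y.
Proof. by have [[_ + _] _ _] := hQ; apply. Qed.

Lemma cov_bounded : exists2 M : R, 0 <= M & forall x, `|Q x| <= M * `|x|.
Proof.
have [[_ _ [M hM]] _ _] := hQ; exists `|M| => // x.
have := hM x I; rewrite !ipnorm_ambient => /le_trans; apply.
by rewrite ler_wpM2r// ler_norm.
Qed.

Lemma cov_sym x y : inner (Q x) y = inner x (Q y).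
Proof. by have [_ h _] := hQ; exact: h. Qed.

Lemma cov_ge0 x : 0 <= inner (Q x) x.
Proof. by have [_ _ h] := hQ; exact: h. Qed.

Lemma cov_mem_kernel_orth x : kernel_orth Q (Q x).
Proof. by move=> z Qz; rewrite cov_sym Qz inner0r. Qed.

Lemma kernel_orth_lin a x y : kernel_orth Q x -> kernel_orth Q y ->
  kernel_orth Q (a *: x + y).
Proof. by move=> kx ky z Qz; rewrite innerDl innerZl kx// ky// mulr0 addr0. Qed.

Lemma kernel_orth_cvg (u : nat -> X) x : u @ \oo --> x ->
  (forall n, kernel_orth Q (u n)) -> kernel_orth Q x.
Proof.
move=> ux ku z Qz; have h := cvg_inner_seq (h := z) ux.
rewrite innerC -(cvg_lim _ h)//; apply: cvg_lim => //.
by apply: cvg_near_cst; apply: nearW => n; rewrite innerC ku.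
Qed.

Lemma kernel_orth_eq0 x : kernel_orth Q x -> Q x = 0 -> x = 0.
Proof. by move=> kx Qx; apply: inner_self_eq0; exact: kx. Qed.

Variable f : nat -> X.
Hypothesis hf : eigenbasis Q f.

Lemma eigen_ker k : kernel_orth Q (f k). Proof. by have [[h _ _ _] _] := hf. Qed.
Lemma eigen_norm k : `|f k| = 1 \/ f k = 0. Proof. by have [[_ h _ _] _] := hf. Qed.
Lemma eigen_orth j k : j != k -> inner (f j) (f k) = 0.
Proof. by have [[_ _ h _] _] := hf; exact: h. Qed.
Lemma eigen_cvg x : kernel_orth Q x -> partial_proj f m x @[m --> \oo] --> x.
Proof. by have [[_ _ _ h] _] := hf; exact: h. Qed.

Definition eigval k : R := inner (Q (f k)) (f k).

Lemma eigvalE k : Q (f k) = eigval k *: f k.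
Proof.
have [_ /(_ k)[l hl]] := hf; rewrite /eigval hl innerZl inner_norm.
by case: (eigen_norm k) => ->; rewrite ?expr1n ?mulr1// scaler0 scaler0.
Qed.

Lemma eigval_ge0 k : 0 <= eigval k. Proof. exact: cov_ge0. Qed.

Lemma eigval_bounded : exists2 M : R, 0 <= M & forall k, `|eigval k| <= M.
Proof.
have [M M0 hM] := cov_bounded; exists M => // k.
rewrite (le_trans (cauchy_schwarz _ _))// (le_trans (ler_wpM2r _ (hM _)))//.
by case: (eigen_norm k) => ->; rewrite ?normr0 ?mulr0 ?mulr1.
Qed.

Lemma eigval_gt0 k : f k != 0 -> 0 < eigval k.
Proof.
move=> fk; rewrite lt_def eigval_ge0 andbT; apply: contraNneq fk => lk.
by apply/eqP/kernel_orth_eq0; [exact: eigen_ker|rewrite eigvalE lk scale0r].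
Qed.

Definition proj x : X := diag_op f (fun=> 1) x.

Let c1 : forall k : nat, `|1| <= 1 :> R. Proof. by move=> _; rewrite normr1. Qed.

Lemma proj_lin a x y : proj (a *: x + y) = a *: proj x + proj y.
Proof. exact: (diag_op_lin eigen_norm eigen_orth c1). Qed.

Lemma proj_norm x : `|proj x| <= `|x|.
Proof. by rewrite -[leRHS]mul1r; exact: (diag_op_norm eigen_norm eigen_orth c1). Qed.

Lemma proj_cvg x : partial_proj f m x @[m --> \oo] --> proj x.
Proof.
have := diag_op_cvg eigen_norm eigen_orth c1 (x := x).
by under eq_fun do under eq_bigr do rewrite mul1r.
Qed.

Lemma partial_proj_ker m x : kernel_orth Q (partial_proj f m x).
Proof.
move=> z Qz; rewrite /partial_proj inner_suml big1// => k _.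
by rewrite innerZl (eigen_ker k)// mulr0.
Qed.

Lemma proj_ker x : kernel_orth Q (proj x).
Proof.
exact: (kernel_orth_cvg (@proj_cvg x) (fun n => @partial_proj_ker n x)).
Qed.

Lemma proj_id x : kernel_orth Q x -> proj x = x.
Proof.
move=> kx; have h1 := @proj_cvg x; have h2 := eigen_cvg kx.
by rewrite -(cvg_lim _ h1)// (cvg_lim _ h2).
Qed.

(** The defect w = x - [proj x] is orthogonal to every eigenvector, hence to the orthogonal
    complement of the kernel, which contains Q (Q w); symmetry then gives |Q w| = 0. *)
Lemma cov_proj x : Q (proj x) = Q x.
Proof.
set w := x - proj x.
suff Qw : Q w = 0.
  have : Q x = Q w + Q (proj x) by rewrite -(lin_add cov_lin) subrK.
  by rewrite Qw add0r.
have wf k : inner w (f k) = 0.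
  by rewrite innerBl (diag_op_coef eigen_norm eigen_orth c1) mul1r subrr.
have wk y : kernel_orth Q y -> inner w y = 0.
  move=> ky; have h := cvg_inner_seq (h := w) (eigen_cvg ky).
  rewrite -(cvg_lim _ h)//; apply: cvg_lim => //; apply: cvg_near_cst.
  apply: nearW => m; rewrite /partial_proj inner_sumr big1// => k _.
  by rewrite innerZr wf mulr0.
apply: inner_self_eq0; rewrite cov_sym wk//.
exact: cov_mem_kernel_orth.
Qed.

Lemma cov_diag x : Q x = diag_op f eigval x.
Proof.
have [M M0 hM] := cov_bounded.
rewrite -cov_proj; have h := bounded_linear_cvg cov_lin hM (@proj_cvg x).
rewrite -(cvg_lim _ h)//; congr (limn _); apply/funext => m.
rewrite /partial_proj (lin_sum cov_lin); apply: eq_bigr => k _.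
by rewrite eigvalE scalerA mulrC.
Qed.

Let root k : R := Num.sqrt (eigval k).

Let root_bounded : exists C : R, forall k, `|root k| <= C.
Proof.
have [M M0 hM] := eigval_bounded; exists (Num.sqrt M) => k.
rewrite ger0_norm ?sqrtr_ge0// /root ler_wsqrtr//.
exact: le_trans (ler_norm _) (hM k).
Qed.

Let Qh := sqrt_operator ambient Q.

(** [sqrt_operator] is a choice, justified by the diagonal operator with the roots of the
    eigenvalues. That the chosen root has the same eigenvectors is shown separately in
    [cov_sqrt_eigen]. *)
Lemma cov_sqrt_spec : nonneg_operator ambient Qh /\ forall x, Qh (Qh x) = Q x.
Proof.
suff: [set S : X -> X | nonneg_operator ambient S /\
    forall x, carrier ambient x -> S (S x) = Q x] Qh.
  by move=> [h1 h2]; split => // x; exact: h2.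
apply: getPex; have [C hC] := root_bounded.
exists (diag_op f root); split; last first.
  move=> x _; rewrite (diag_op_comp eigen_norm eigen_orth _ hC hC) cov_diag.
  by congr diag_op; apply/funext => k; rewrite -expr2 sqr_sqrtr// eigval_ge0.
split.
- split => //.
    by move=> a x y _ _; exact: (diag_op_lin eigen_norm eigen_orth hC).
  exists C => x _; rewrite !ipnorm_ambient.
  exact: (diag_op_norm eigen_norm eigen_orth hC).
- by move=> x y _ _; exact: (diag_op_sym eigen_norm eigen_orth hC).
- move=> x _; have h := @diag_op_inner _ _ _ eigen_norm eigen_orth _ _ hC x x.
  rewrite /= -(cvg_lim _ h)//; apply: limr_ge; first by apply/cvg_ex; eexists; exact: h.
  apply: nearW => m; apply: sumr_ge0 => k _.
  by rewrite -mulrA mulr_ge0 ?sqrtr_ge0// -expr2 sqr_ge0.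
Qed.

Let hQh : nonneg_operator ambient Qh := cov_sqrt_spec.1.
Let QhQh x : Qh (Qh x) = Q x := cov_sqrt_spec.2 x.

Lemma cov_sqrt_ker0 z : Qh z = 0 <-> Q z = 0.
Proof.
have [[_ Qlin _] Qsym _] := hQh.
have Qh0 : Qh 0 = 0.
  by have := Qlin (-1) 0 0 I I; rewrite scaler0 addr0 scaleN1r addNr.
split=> [Qz|Qz]; first by rewrite -QhQh Qz.
by apply: inner_self_eq0; rewrite [LHS](Qsym z (Qh z) I I)/= QhQh Qz inner0r.
Qed.

Lemma cov_sqrt_kernel_orth : kernel_orth Qh = kernel_orth Q.
Proof.
by apply/seteqP; split => x kx z hz; apply: kx; apply/cov_sqrt_ker0.
Qed.

Lemma cov_sqrt_lin a x y : Qh (a *: x + y) = a *: Qh x + Qh y.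
Proof. by have [[_ + _] _ _] := hQh; apply. Qed.

Lemma cov_sqrt_sym x y : inner (Qh x) y = inner x (Qh y).
Proof. by have [_ h _] := hQh; exact: h. Qed.

Lemma cov_sqrt_bounded : exists2 M : R, 0 <= M & forall x, `|Qh x| <= M * `|x|.
Proof.
have [[_ _ [M hM]] _ _] := hQh; exists `|M| => // x.
have := hM x I; rewrite !ipnorm_ambient => /le_trans; apply.
by rewrite ler_wpM2r// ler_norm.
Qed.

Lemma cov_sqrt_mem x : kernel_orth Q (Qh x).
Proof. by move=> z /cov_sqrt_ker0 Qz; rewrite cov_sqrt_sym Qz inner0r. Qed.

Lemma cov_sqrt_proj x : Qh (proj x) = Qh x.
Proof.
apply/eqP; rewrite -subr_eq0 -(lin_opp cov_sqrt_lin) -(lin_add cov_sqrt_lin).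
apply/eqP/cov_sqrt_ker0; rewrite (lin_add cov_lin) (lin_opp cov_lin) cov_proj.
exact: subrr.
Qed.

Lemma cov0 : Q 0 = 0.
Proof. by have := lin_scale cov_lin 0 0; rewrite !scale0r. Qed.

Lemma cov_sqrt0 : Qh 0 = 0.
Proof. by apply/cov_sqrt_ker0; exact: cov0. Qed.

(** With s the root of the eigenvalue, w = [Qh (f k)] - s f k satisfies Qh w = - s w, which
    positivity of [Qh] allows only for w = 0. *)
Lemma cov_sqrt_eigen k : Qh (f k) = Num.sqrt (eigval k) *: f k.
Proof.
have [f0|f0] := eqVneq (f k) 0.
  by rewrite f0 scaler0 cov_sqrt0.
have l0 : 0 < Num.sqrt (eigval k) by rewrite sqrtr_gt0 eigval_gt0.
set s := Num.sqrt _ in l0 *.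
set w := Qh (f k) - s *: f k.
have Qw : Qh w + s *: w = 0.
  rewrite /w (lin_add cov_sqrt_lin) (lin_opp cov_sqrt_lin) (lin_scale cov_sqrt_lin) QhQh.
  rewrite scalerBr scalerA eigvalE -expr2 sqr_sqrtr ?eigval_ge0//.
  by rewrite addrA subrK subrr.
suff w0 : w = 0 by apply/eqP; rewrite -subr_eq0 -/w w0.
have [_ _ Qpos] := hQh.
apply: inner_self_eq0; have := Qpos w I; rewrite /=.
have : inner (Qh w + s *: w) w = 0 by rewrite Qw inner0l.
rewrite innerDl innerZl => h1 h2.
have h3 := inner_self_ge0 w.
have : s * inner w w <= 0 by lra.
by rewrite pmulr_rle0// => h4; apply/eqP; rewrite eq_le h4.
Qed.

Let pinv := pseudo_inverse Qh.

Lemma pinv_spec h : range Qh h -> kernel_orth Q (pinv h) /\ Qh (pinv h) = h.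
Proof.
move=> [z _ <-]; rewrite -cov_sqrt_kernel_orth.
apply: (@getPex _ [set y | kernel_orth Qh y /\ Qh y = Qh z]).
exists (proj z); rewrite /= cov_sqrt_kernel_orth; split; first exact: proj_ker.
exact: cov_sqrt_proj.
Qed.

Lemma pinv_sqrtK z : kernel_orth Q z -> pinv (Qh z) = z.
Proof.
move=> kz; have [k1 k2] := pinv_spec (imageT Qh z).
apply/eqP; rewrite -subr_eq0; apply/eqP/kernel_orth_eq0.
  by rewrite -[X in _ - X]scale1r -scaleNr addrC; exact: kernel_orth_lin.
by apply/cov_sqrt_ker0; rewrite (lin_add cov_sqrt_lin) (lin_opp cov_sqrt_lin) k2 subrr.
Qed.

Lemma pinv_sqrt x : pinv (Qh x) = proj x.
Proof. by rewrite -cov_sqrt_proj pinv_sqrtK//; exact: proj_ker. Qed.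

Lemma pinv_lin a x y : range Qh x -> range Qh y -> pinv (a *: x + y) = a *: pinv x + pinv y.
Proof.
move=> rx ry; have [k1 e1] := pinv_spec rx; have [k2 e2] := pinv_spec ry.
rewrite -{1}e1 -{1}e2 -cov_sqrt_lin pinv_sqrtK//; exact: kernel_orth_lin.
Qed.

Lemma range_lin a x y : range Qh x -> range Qh y -> range Qh (a *: x + y).
Proof.
by move=> [u _ <-] [v _ <-]; exists (a *: u + v) => //; rewrite cov_sqrt_lin.
Qed.

Lemma range_cov h : range Qh (Q h).
Proof. by exists (Qh h) => //; rewrite QhQh. Qed.

Lemma pinv_cov h : pinv (Q h) = Qh h.
Proof. by rewrite -QhQh pinv_sqrtK//; exact: cov_sqrt_mem. Qed.

Lemma range_eigen k : range Qh (f k).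
Proof.
have [f0|f0] := eqVneq (f k) 0.
  by exists 0 => //; rewrite f0 cov_sqrt0.
exists ((Num.sqrt (eigval k))^-1 *: f k) => //.
rewrite (lin_scale cov_sqrt_lin) cov_sqrt_eigen scalerA mulVf ?scale1r//.
by rewrite gt_eqF// sqrtr_gt0 eigval_gt0.
Qed.

Lemma pinv_eigen k : Num.sqrt (eigval k) *: pinv (f k) = f k.
Proof.
have [f0|f0] := eqVneq (f k) 0.
  by rewrite f0 -{1}cov_sqrt0 pinv_sqrtK ?scaler0// => z _; rewrite inner0l.
have l0 : Num.sqrt (eigval k) != 0 by rewrite gt_eqF// sqrtr_gt0 eigval_gt0.
have -> : f k = Qh ((Num.sqrt (eigval k))^-1 *: f k).
  by rewrite (lin_scale cov_sqrt_lin) cov_sqrt_eigen scalerA mulVf ?scale1r.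
rewrite pinv_sqrtK ?scalerA ?divff ?scale1r//.
  by rewrite (lin_scale cov_sqrt_lin) cov_sqrt_eigen scalerA mulVf ?scale1r.
by move=> z Qz; rewrite innerZl (eigen_ker k)// mulr0.
Qed.

Lemma inner_range h v : range Qh v -> inner h v = inner (Qh h) (pinv v).
Proof. by move=> rv; have [_ e] := pinv_spec rv; rewrite cov_sqrt_sym e. Qed.

End covariance.

(** * The adjoint of a bounded operator, by series *)

Section adjoint_operator.
Context {R : realType} {X : hilbertType R}.
Variables (f : nat -> X) (L : X -> X) (M : R).
Hypothesis f_norm : forall k, `|f k| = 1 \/ f k = 0.
Hypothesis f_orth : forall j k, j != k -> inner (f j) (f k) = 0.
Hypothesis L_lin : forall a x y, L (a *: x + y) = a *: L x + L y.
Hypothesis L_norm : forall x, `|L x| <= M * `|x|.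

Let coef y k := inner y (L (f k)).

(** The sum s equals <y, L v> for v the sum of the coef y k f k, and |v|^2 <= s; so s <= M |y| sqrt
    s. *)
Let coef_le y m : \sum_(k < m) coef y k ^+ 2 <= (M * `|y|) ^+ 2.
Proof.
set s := \sum_(k < m) _.
pose v := \sum_(0 <= k < m) coef y k *: f k.
have s0 : 0 <= s by apply: sumr_ge0 => k _; exact: sqr_ge0.
have sE : s = inner y (L v).
  rewrite /s -(big_mkord xpredT (fun k => coef y k ^+ 2)) (lin_sum L_lin).
  by rewrite inner_sumr; apply: eq_bigr => k _; rewrite innerZr expr2.
have vs : `|v| ^+ 2 <= s.
  rewrite /s -(big_mkord xpredT (fun k => coef y k ^+ 2)).
  by apply: norm_orth_sum => //; exact: iota_uniq.
have h1 : s <= `|y| * (M * `|v|).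
  rewrite {1}sE (le_trans (ler_norm _))// (le_trans (cauchy_schwarz _ _))//.
  by rewrite ler_wpM2l.
have h2 : s ^+ 2 <= (M * `|y|) ^+ 2 * s.
  rewrite (@le_trans _ _ ((`|y| * (M * `|v|)) ^+ 2))//.
    by rewrite ler_sqr ?nnegrE// (le_trans s0).
  have -> : (`|y| * (M * `|v|)) ^+ 2 = (M * `|y|) ^+ 2 * `|v| ^+ 2.
    by move: (`|y|) (`|v|) => u w; ring.
  by rewrite ler_wpM2l ?sqr_ge0.
have [->|sn0] := eqVneq s 0; first exact: sqr_ge0.
have sp : 0 < s by rewrite lt_def sn0.
by rewrite -(ler_pM2r sp) -expr2.
Qed.

Definition adjoint_op y : X := limn (fun m => \sum_(k < m) coef y k *: f k).

Let adjoint_op_cvg y : \sum_(k < m) coef y k *: f k @[m --> \oo] --> adjoint_op y.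
Proof. exact: (orth_series_cvg f_norm f_orth (coef_le y)). Qed.

Lemma adjoint_op_norm y : `|adjoint_op y| <= `|M| * `|y|.
Proof.
rewrite -ler_sqr ?nnegrE ?mulr_ge0//.
have h2 : `|\sum_(k < m) coef y k *: f k| ^+ 2 @[m --> \oo] --> `|adjoint_op y| ^+ 2.
  by rewrite !expr2; apply: cvgM; exact: cvg_norm (@adjoint_op_cvg y).
rewrite -(cvg_lim _ h2)//; apply: limr_le; first by apply/cvg_ex; eexists; exact: h2.
apply: nearW => m.
have -> : (`|M| * `|y|) ^+ 2 = (M * `|y|) ^+ 2 by rewrite !exprMn real_normK ?num_real.
rewrite (le_trans _ (coef_le y m))//.
rewrite -(big_mkord xpredT (fun k => coef y k *: f k)).
rewrite -(big_mkord xpredT (fun k => coef y k ^+ 2)).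
by apply: norm_orth_sum => //; exact: iota_uniq.
Qed.

Lemma adjoint_op_lin a x y : adjoint_op (a *: x + y) = a *: adjoint_op x + adjoint_op y.
Proof.
apply: cvg_lim => //.
rewrite (_ : (fun m => _) = (fun m => a *: (\sum_(k < m) coef x k *: f k) +
  \sum_(k < m) coef y k *: f k)).
  by apply: cvgD; [apply: cvgZr; exact: (@adjoint_op_cvg x)|exact: (@adjoint_op_cvg y)].
apply/funext => m; rewrite scaler_sumr -big_split/=; apply: eq_bigr => k _.
by rewrite scalerA -scalerDl /coef innerDl innerZl.
Qed.

Lemma adjoint_opE x y : partial_proj f m x @[m --> \oo] --> x ->
  inner (L x) y = inner x (adjoint_op y).
Proof.
move=> fx.
have h1 := cvg_inner_seq (h := y) (bounded_linear_cvg L_lin L_norm fx).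
have h2 := cvg_inner_seq (h := x) (@adjoint_op_cvg y).
rewrite innerC -(cvg_lim _ h1)// -(cvg_lim _ h2)//.
congr (limn _); apply/funext => m; rewrite /partial_proj (lin_sum L_lin).
rewrite !inner_sumr; apply: eq_bigr => k _; rewrite !innerZr /coef; ring.
Qed.

Lemma adjoint_op_closed (K : set X) : (forall m y, K (\sum_(k < m) coef y k *: f k)) ->
  (forall (u : nat -> X) x, u @ \oo --> x -> (forall n, K (u n)) -> K x) ->
  forall y, K (adjoint_op y).
Proof. by move=> hK cK y; apply: (cK _ _ (@adjoint_op_cvg y)). Qed.

End adjoint_operator.

(** * Square root of 1 - L for a strict contraction L *)

Section sqrt_one_minus.
Context {R : realType} {X : hilbertType R}.
Variables (L : X -> X) (k : R).
Hypothesis k01 : 0 <= k < 1.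
Hypothesis L_lin : forall a x y, L (a *: x + y) = a *: L x + L y.
Hypothesis L_sym : forall x y, inner (L x) y = inner x (L y).
Hypothesis L_norm : forall x, `|L x| <= k * `|x|.

(* [b] is the smaller root of [b = (k + b^2) / 2], the scalar version of the
   fixed-point equation [Y = (L + Y^2) / 2], which says [(1 - Y)^2 = 1 - L]. *)
Let b := 1 - Num.sqrt (1 - k).

Let s_spec : 0 < Num.sqrt (1 - k) <= 1 /\ Num.sqrt (1 - k) ^+ 2 = 1 - k.
Proof.
have /andP[k0 k1'] := k01; have k1 : 0 < 1 - k by rewrite subr_gt0.
split; last by rewrite sqr_sqrtr// ltW.
by rewrite sqrtr_gt0 k1/= -[leRHS]sqrtr1 ler_wsqrtr// gerBl.
Qed.

Let b01 : 0 <= b < 1. Proof. by have [/andP[s0 s1] _] := s_spec; rewrite /b subr_ge0 s1 gtrBl. Qed.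

Let b_fix : (k + b ^+ 2) / 2 = b.
Proof.
have [_] := s_spec; rewrite /b; set s := Num.sqrt _ => hs.
have -> : k = 1 - s ^+ 2 by rewrite hs; ring.
by field.
Qed.

Fixpoint sqrt_iter n : X -> X :=
  if n is m.+1 then fun x => 2^-1 *: (L x + sqrt_iter m (sqrt_iter m x)) else fun=> 0.

Let Y := sqrt_iter.

Let Y_lin n a x y : Y n (a *: x + y) = a *: Y n x + Y n y.
Proof.
elim: n a x y => [a x y|n ih a x y]; first by rewrite /= scaler0 addr0.
rewrite /= L_lin !ih !scalerDr !scalerA !(mulrC a).
by rewrite -!addrA; congr (_ + _); rewrite addrCA.
Qed.

Let Y_sym n x y : inner (Y n x) y = inner x (Y n y).
Proof.
elim: n x y => [x y|n ih x y]; first by rewrite inner0l inner0r.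
by rewrite /= innerZl innerZr innerDl innerDr L_sym !ih.
Qed.

Let Y_norm n x : `|Y n x| <= b * `|x|.
Proof.
have /andP[b0 _] := b01.
elim: n x => [x|n ih x]; first by rewrite normr0 mulr_ge0.
rewrite /= normrZ ger0_norm ?invr_ge0// -{1}b_fix.
have h1 : `|Y n (Y n x)| <= b ^+ 2 * `|x|.
  by rewrite (le_trans (ih _))// expr2 -(mulrA b) ler_wpM2l.
rewrite mulrC -(mulrAC _ _ 2^-1) ler_wpM2r ?invr_ge0//.
by rewrite (le_trans (ler_normD _ _))// mulrDl lerD.
Qed.

Let Y_diff n x : `|Y n.+1 x - Y n x| <= b ^+ n * `|x|.
Proof.
have /andP[b0 b1] := b01.
elim: n x => [x|n ih x].
  by rewrite subr0 expr0 (le_trans (Y_norm 1 x))// ler_wpM2r// ltW.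
(* Noncommutative difference of squares; with the norm bound b each half contributes b^(n+1). *)
have -> : Y n.+2 x - Y n.+1 x = 2^-1 *: (Y n.+1 (Y n.+1 x - Y n x) +
    (Y n.+1 (Y n x) - Y n (Y n x))).
  rewrite (lin_add (Y_lin n.+1)) (lin_opp (Y_lin n.+1)) addrA subrK.
  rewrite -scalerBr; congr (_ *: _).
  by rewrite opprD addrACA subrr add0r.
rewrite normrZ ger0_norm ?invr_ge0//.
have h1 : `|Y n.+1 (Y n.+1 x - Y n x)| <= b ^+ n.+1 * `|x|.
  by rewrite (le_trans (Y_norm _ _))// (exprS b n) -(mulrA b) ler_wpM2l.
have h2 : `|Y n.+1 (Y n x) - Y n (Y n x)| <= b ^+ n.+1 * `|x|.
  rewrite (le_trans (ih _))// exprSr -(mulrA (b ^+ n)) ler_wpM2l ?exprn_ge0//.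
have h3 := ler_normD (Y n.+1 (Y n.+1 x - Y n x)) (Y n.+1 (Y n x) - Y n (Y n x)).
move: h1 h2 h3; move: (`| _ |) (`|_|) (`| _ + _|) (b ^+ n.+1 * _) => u v w z; lra.
Qed.

Let S x : X := x - limn (fun n => Y n x).

Let Y_cvg x : Y n x @[n --> \oo] --> x - S x.
Proof.
have /andP[b0 b1] := b01.
suff : cvgn (fun n => Y n x) by rewrite /S opprB addrC subrK.
rewrite (_ : (fun n => _) = (fun n => Y 0 x + series (telescope (fun n => Y n x)) n)); last first.
  by apply/funext => n; exact: (eq_sum_telescope (fun n => Y n x)).
apply: is_cvgD; first exact: is_cvg_cst.
apply: normed_cvg.
apply: (@series_le_cvg R _ (geometric `|x| b)) => //.
- by move=> n; rewrite /= normr_ge0.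
- by move=> n; rewrite /geometric/= mulr_ge0// exprn_ge0.
- by move=> n; rewrite /geometric/= /telescope mulrC; exact: Y_diff.
- by apply: is_cvg_geometric_series; rewrite ger0_norm.
Qed.

Let Yl x := x - S x.

Let Yl_norm x : `|Yl x| <= b * `|x|.
Proof.
have h : `|Y n x| @[n --> \oo] --> `|Yl x| by apply: cvg_norm; exact: Y_cvg.
rewrite -(cvg_lim _ h)//; apply: limr_le; first by apply/cvg_ex; eexists; exact: h.
by apply: nearW => n; exact: Y_norm.
Qed.

Let Yl_lin a x y : Yl (a *: x + y) = a *: Yl x + Yl y.
Proof.
have h := @Y_cvg (a *: x + y).
rewrite /Yl -(cvg_lim _ h)//; apply: cvg_lim => //.
rewrite (_ : (fun n => Y n (a *: x + y)) = (fun n => a *: Y n x + Y n y)).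
  by apply: cvgD; [apply: cvgZr|]; exact: Y_cvg.
by apply/funext => n; exact: Y_lin.
Qed.

Let Yl_sym x y : inner (Yl x) y = inner x (Yl y).
Proof.
have h1 := cvg_inner_seq (h := y) (@Y_cvg x).
have h2 := cvg_inner_seq (h := x) (@Y_cvg y).
rewrite innerC -(cvg_lim _ h1)// -(cvg_lim _ h2)//.
by congr (limn _); apply/funext => n; rewrite innerC Y_sym.
Qed.

Let Yl_fix x : Yl x = 2^-1 *: (L x + Yl (Yl x)).
Proof.
have /andP[b0 b1] := b01.
have h := @Y_cvg x; rewrite -(cvg_shiftS _) in h.
rewrite {1}/Yl -(cvg_lim _ h)//; apply: cvg_lim => //=.
apply: cvgZr; apply: cvgD; first exact: cvg_cst.
rewrite (_ : (fun n => _) = (fun n => Y n (Y n x - Yl x) + Y n (Yl x))); last first.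
  by apply/funext => n; rewrite -(lin_add (Y_lin n)) subrK.
rewrite -[X in _ --> X]add0r; apply: cvgD; last exact: Y_cvg.
apply/norm_cvg0P; apply: (@squeeze_cvgr _ _ _ _ (cst 0) (fun n => b * `|Y n x - Yl x|)).
- by apply: nearW => n; rewrite normr_ge0/=; exact: Y_norm.
- exact: cvg_cst.
- rewrite -[X in _ --> X](mulr0 b); apply: cvgM; first exact: cvg_cst.
  apply/norm_cvg0P; rewrite -(subrr (Yl x)).
  by apply: cvgB; [exact: Y_cvg|exact: cvg_cst].
Qed.

(** No eigenbasis of L is at hand, so the root is S = 1 - Y with Y the limit of the fixed-point
    iteration. The norm of Y is at most b < 1, which makes S nonnegative. The last clause keeps S
    inside a closed subspace containing the range of L; it is used for the complement of the kernel
    of the covariance. *)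
Lemma sqrt_one_minus : exists S : X -> X,
  [/\ forall a x y, S (a *: x + y) = a *: S x + S y,
      forall x y, inner (S x) y = inner x (S y),
      forall x, 0 <= inner (S x) x,
      forall x, `|S x| <= 2 * `|x|
    & (forall x, S (S x) = x - L x) /\
      forall K : set X, (forall a x y, K x -> K y -> K (a *: x + y)) ->
        (forall (u : nat -> X) x, u @ \oo --> x -> (forall n, K (u n)) -> K x) ->
        (forall x, K (L x)) -> forall x, K x -> K (S x)].
Proof.
have /andP[b0 b1] := b01.
have SE x : S x = x - Yl x by rewrite /Yl opprB addrC subrK.
exists S; split.
- move=> a x y; by rewrite !SE Yl_lin opprD addrACA -scalerBr.
- by move=> x y; rewrite !SE innerBl innerBr Yl_sym.
- move=> x; rewrite SE innerBl inner_norm subr_ge0.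
  rewrite (le_trans (ler_norm _))// (le_trans (cauchy_schwarz _ _))//.
  rewrite expr2 ler_wpM2r// (le_trans (Yl_norm x))// -[leRHS]mul1r ler_wpM2r// ltW//.
- move=> x; rewrite SE (le_trans (ler_normB _ _))//.
  have := Yl_norm x; have : b * `|x| <= 1 * `|x| by rewrite ler_wpM2r// ltW.
  move: (`| _ |) (`| Yl x|) (b * _) => u v w; lra.
- split.
    move=> x; rewrite !SE (lin_add Yl_lin) (lin_opp Yl_lin).
    have -> : L x = Yl x + Yl x - Yl (Yl x).
      have e2 : Yl x + Yl x = L x + Yl (Yl x).
        by rewrite -mulr2n -scaler_nat {1}(Yl_fix x) scalerA divff ?scale1r.
      by rewrite e2 addrK.
    move: (Yl x) (Yl (Yl x)) => y1 y2; by rewrite !opprD !opprK !addrA.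
- move=> K Klin Kcl KL x Kx.
  have K0 : K 0 by have := KL 0; rewrite -{1}[0](scale0r 0) (lin_scale L_lin) scale0r.
  have KY n y : K (Y n y).
    elim: n y => [//|n ih y]; rewrite /= -[X in K X]addr0; apply: (Klin) => //.
    by rewrite -[L y]scale1r; exact: Klin.
  rewrite SE addrC -scaleN1r; apply: Klin => //.
  by apply: (Kcl _ _ (@Y_cvg x)) => n; exact: KY.
Qed.

End sqrt_one_minus.

(** * Operators between Cameron-Martin spaces, read on X *)

Section cameron_martin_operators.
Context {R : realType} {X : hilbertType R}.
Variables (Qm Qn : X -> X) (f g : nat -> X).
Hypotheses (hm : nonneg_operator ambient Qm) (hn : nonneg_operator ambient Qn).
Hypotheses (hf : eigenbasis Qm f) (hg : eigenbasis Qn g).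
Variable T : X -> X.
Let Hm := cameron_martin Qm.
Let Hn := cameron_martin Qn.
Hypothesis hT : bounded_operator Hm Hn T.

Let mh := sqrt_operator ambient Qm.
Let nh := sqrt_operator ambient Qn.
Let pm := pseudo_inverse mh.
Let pn := pseudo_inverse nh.
Let r := opnorm Hm Hn T.

Let Hm_mh x : carrier Hm (mh x). Proof. by exists x. Qed.
Let Hn_nh x : carrier Hn (nh x). Proof. by exists x. Qed.

Let T_mem x : carrier Hm x -> carrier Hn (T x).
Proof. by have [h _ _] := hT; exact: h. Qed.

Let T_lin a x y : carrier Hm x -> carrier Hm y -> T (a *: x + y) = a *: T x + T y.
Proof. by have [_ h _] := hT; exact: h. Qed.

Lemma cm_norm x : ipnorm Hm x = `|pm x|.
Proof. by rewrite /ipnorm/= inner_norm sqrtr_sqr normr_id. Qed.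

Let cm_norm' x : ipnorm Hn x = `|pn x|.
Proof. by rewrite /ipnorm/= inner_norm sqrtr_sqr normr_id. Qed.

(** T conjugated by the isometries between the Cameron-Martin spaces and the complements of the
    kernels in X, so that the inner product of X replaces the two others. *)
Definition lift_op x := pn (T (mh x)).
Let L := lift_op.

Lemma lift_op_lin a x y : L (a *: x + y) = a *: L x + L y.
Proof.
rewrite /L /lift_op /mh (cov_sqrt_lin hm hf) T_lin//.
by rewrite /pn (pinv_lin hn hg)//; exact: T_mem.
Qed.

Lemma lift_op_ker x : kernel_orth Qn (L x).
Proof. by have [] := pinv_spec hn hg (T_mem (Hm_mh x)). Qed.

Lemma lift_opK x : nh (L x) = T (mh x).
Proof. by have [] := pinv_spec hn hg (T_mem (Hm_mh x)). Qed.

Let opnorm_has_sup : has_sup [set ipnorm Hn (T x) | x in [set x | carrier Hm x /\ ipnorm Hm x <= 1]].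
Proof.
have [_ _ [M hM]] := hT.
split.
  exists (ipnorm Hn (T (mh 0))); exists (mh 0) => //; split => //.
  by rewrite cm_norm /pm (pinv_sqrt hm hf) (le_trans (proj_norm hf _))// normr0.
exists `|M| => _ [x [cx x1] <-]; rewrite (le_trans (hM _ cx))//.
rewrite (le_trans (ler_norm _))// normrM [X in _ * X]ger0_norm ?sqrtr_ge0//.
by rewrite -[leRHS]mulr1 ler_wpM2l.
Qed.

Lemma opnorm_ge0 : 0 <= r.
Proof.
have [[y [x cx xy]] ub] := opnorm_has_sup.
apply: le_trans (ub_le_sup ub _); last by exists x; [exact: cx|exact: xy].
by rewrite -xy sqrtr_ge0.
Qed.

(** [mh x] has Cameron-Martin norm |proj x| <= |x|, so the unit ball of X is sent into the ball over
    which [opnorm] is a supremum. *)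
Lemma lift_op_norm x : `|L x| <= r * `|x|.
Proof.
have [->|x0] := eqVneq x 0.
  by have := lin_scale lift_op_lin 0 0; rewrite !scale0r => ->; rewrite !normr0 mulr0.
have nx : 0 < `|x| by rewrite normr_gt0.
rewrite -ler_pdivrMr//.
have -> : `|L x| / `|x| = ipnorm Hn (T (mh (`|x|^-1 *: x))).
  rewrite cm_norm' -/(lift_op (`|x|^-1 *: x)) -/L (lin_scale lift_op_lin) normrZ.
  by rewrite ger0_norm ?invr_ge0// mulrC.
apply: ub_le_sup; first by have [] := opnorm_has_sup.
exists (mh (`|x|^-1 *: x)) => //; split => //.
rewrite cm_norm /pm (pinv_sqrt hm hf) (le_trans (proj_norm hf _))//.
by rewrite normrZ ger0_norm ?invr_ge0// mulVf// gt_eqF.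
Qed.

(** Almost norming vectors can be taken in the range of [mh], so that they come from continuous
    functionals <h, x>: the partial eigenvector sums of any almost norming vector are in that
    range. *)
Lemma opnorm_approx rho : 0 <= rho < r -> exists h, rho * `|mh h| < `|L (mh h)|.
Proof.
move=> /andP[rho0 rho1].
have d0 : 0 < r - rho by rewrite subr_gt0.
have [_ [x [cx x1] <-]] := sup_adherent d0 opnorm_has_sup.
rewrite -/(opnorm Hm Hn T) -/r opprB addrC subrK => hx.
have [kz zE] := pinv_spec hm hf cx.
set z := pseudo_inverse _ _ in kz zE.
have hz : rho * `|z| < `|L z|.
  rewrite /L /lift_op /mh zE; move: hx; rewrite cm_norm'; apply: le_lt_trans.
  by rewrite -[leRHS]mulr1 ler_wpM2l//; move: x1; rewrite cm_norm.
have zc := eigen_cvg hf kz.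
have c1 : `|L (partial_proj f m z)| - rho * `|partial_proj f m z| @[m --> \oo]
    --> `|L z| - rho * `|z|.
  apply: cvgB; first by apply: cvg_norm; exact: bounded_linear_cvg lift_op_lin lift_op_norm zc.
  by apply: cvgM; [exact: cvg_cst|exact: cvg_norm].
have d1 : 0 < `|L z| - rho * `|z| by rewrite subr_gt0.
have [m _ /(_ m (leqnn m))/=] := cvgr_gt _ c1 _ d1.
rewrite subr_gt0 => hm'.
(* A preimage of the partial sum under [mh]; at padding vectors the division by zero is harmless. *)
exists (\sum_(k < m) (inner z (f k) / Num.sqrt (eigval Qm f k)) *: f k).
rewrite (_ : mh _ = partial_proj f m z)//.
rewrite /mh (lin_sum (cov_sqrt_lin hm hf)) /partial_proj; apply: eq_bigr => k _.
rewrite (cov_sqrt_eigen hm hf) scalerA.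
have [->|fk] := eqVneq (f k) 0; first by rewrite !scaler0.
by rewrite divfK// gt_eqF// sqrtr_gt0 (eigval_gt0 hm hf).
Qed.

Let S0 := adjoint_op f L.

Let S0_spec x y : kernel_orth Qm x -> inner (L x) y = inner x (S0 y).
Proof.
move=> kx; apply: (adjoint_opE (eigen_norm hf) (eigen_orth hf) lift_op_lin lift_op_norm).
exact: (eigen_cvg hf kx).
Qed.

Let S0_ker y : kernel_orth Qm (S0 y).
Proof.
apply: (adjoint_op_closed (eigen_norm hf) (eigen_orth hf) lift_op_lin lift_op_norm (K := kernel_orth Qm)).
  move=> m z w Qw; rewrite inner_suml big1// => k _.
  by rewrite innerZl (eigen_ker hf k)// mulr0.
by move=> u x; exact: kernel_orth_cvg.
Qed.

Let Tstar := adjoint Hm Hn T.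

(** The choice in [adjoint] is justified by the adjoint of [L] on X, conjugated back to the
    Cameron-Martin spaces. *)
Lemma adjoint_spec : bounded_operator Hn Hm Tstar /\
  forall x y, carrier Hm x -> carrier Hn y -> ip Hn (T x) y = ip Hm x (Tstar y).
Proof.
suff: [set S : X -> X | bounded_operator Hn Hm S /\
    forall x y, carrier Hm x -> carrier Hn y ->
      ip Hn (T x) y = ip Hm x (S y)] Tstar by [].
apply: getPex; exists (fun y => mh (S0 (pn y))); split; first split.
- by move=> y _; exists (S0 (pn y)).
- move=> a x y cx cy; rewrite /pn (pinv_lin hn hg)//.
  rewrite /S0 (adjoint_op_lin (eigen_norm hf) (eigen_orth hf) lift_op_lin lift_op_norm).
  by rewrite /mh (cov_sqrt_lin hm hf).
- exists `|r| => y cy; rewrite cm_norm cm_norm' /pm (pinv_sqrt hm hf).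
  rewrite (le_trans (proj_norm hf _))//.
  exact: (adjoint_op_norm (eigen_norm hf) (eigen_orth hf) lift_op_lin lift_op_norm).
- move=> x y cx cy /=.
  have [kx xE] := pinv_spec hm hf cx.
  rewrite -{1}xE -/mh -/nh -/pn -/(lift_op _) -/L S0_spec//.
  by rewrite -/pm /pm (pinv_sqrtK hm hf).
Qed.

(** The adjoint of [L] for the inner product of X ([Sl_spec]). *)
Let Sl y := pm (Tstar (nh y)).

Let kproj_sym (Q : X -> X) (e : nat -> X) x y : eigenbasis Q e -> kernel_orth Q y ->
  inner (proj e x) y = inner x y.
Proof.
move=> he ky; rewrite /proj (diag_op_sym (eigen_norm he) (eigen_orth he) (C := 1)).
  by rewrite -/(proj e y) (proj_id he ky).
by move=> _; rewrite normr1.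
Qed.

Let Sl_ker y : kernel_orth Qm (Sl y).
Proof.
have [[c _ _] _] := adjoint_spec.
by have [] := pinv_spec hm hf (c _ (Hn_nh y)).
Qed.

Let Sl_spec x y : inner (L x) y = inner x (Sl y).
Proof.
have [_ h] := adjoint_spec.
have := h _ _ (Hm_mh x) (Hn_nh y).
rewrite /= -/mh -/nh -/pm -/pn {2}/pn (pinv_sqrt hn hg) {1}/pm (pinv_sqrt hm hf).
rewrite (kproj_sym _ hf)//; last exact: Sl_ker.
by rewrite -/(lift_op x) (innerC (lift_op x) (proj g y)) (kproj_sym _ hg) 1?innerC//; exact: lift_op_ker.
Qed.

Let P h := h - Tstar (T h).

Let Tstar_mem y : carrier Hn y -> carrier Hm (Tstar y).
Proof. by have [[h _ _] _] := adjoint_spec; exact: h. Qed.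

Let cm_sub x y : carrier Hm x -> carrier Hm y -> carrier Hm (x - y).
Proof.
by move=> cx cy; rewrite addrC -scaleN1r; exact: (range_lin hm hf).
Qed.

Let pm_sub x y : carrier Hm x -> carrier Hm y -> pm (x - y) = pm x - pm y.
Proof.
by move=> cx cy; rewrite addrC -scaleN1r /pm (pinv_lin hm hf)// scaleN1r addrC.
Qed.

Let pm_P x : carrier Hm x -> pm (P x) = pm x - Sl (L (pm x)).
Proof.
move=> cx; have [kx xE] := pinv_spec hm hf cx.
rewrite /P pm_sub//; last by apply: Tstar_mem; exact: T_mem.
by rewrite /Sl lift_opK /pm /mh xE.
Qed.

Hypothesis r1 : r < 1.

Let K x := Sl (L x).

Let K_lin a x y : K (a *: x + y) = a *: K x + K y.
Proof.
have [[c l _] _] := adjoint_spec.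
rewrite /K lift_op_lin /Sl /nh (cov_sqrt_lin hn hg) l//.
by rewrite /pm (pinv_lin hm hf)//; exact: c.
Qed.

Let K_sym x y : inner (K x) y = inner x (K y).
Proof. by rewrite innerC -Sl_spec -Sl_spec innerC. Qed.

Let K_norm x : `|K x| <= r ^+ 2 * `|x|.
Proof.
have r0 := opnorm_ge0.
have [->|k0] := eqVneq (K x) 0; first by rewrite normr0 mulr_ge0// sqr_ge0.
have kp : 0 < `|K x| by rewrite normr_gt0.
rewrite -(ler_pM2l kp) -expr2 -inner_norm {2}/K -Sl_spec.
rewrite (le_trans (ler_norm _))// (le_trans (cauchy_schwarz _ _))//.
rewrite (@le_trans _ _ ((r * `|K x|) * (r * `|x|)))//.
  by apply: ler_pM => //; exact: lift_op_norm.
by rewrite (_ : r * `|K x| * (r * `|x|) = `|K x| * (r ^+ 2 * `|x|))//; ring.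
Qed.

Let C := sqrt_operator Hm (fun h => h - Tstar (T h)).

(** A root is obtained by conjugating with [mh] the root of 1 - K, where K = [Sl] L has norm at most
    r^2 < 1; this root preserves the complement of the kernel of Qm, on which the conjugation is
    isometric. *)
Lemma sqrt_defect_spec : nonneg_operator Hm C /\ forall x, carrier Hm x -> C (C x) = P x.
Proof.
suff: [set S : X -> X | nonneg_operator Hm S /\
    forall x, carrier Hm x -> S (S x) = P x] C by [].
apply: getPex.
have r0 := opnorm_ge0.
have k01 : 0 <= r ^+ 2 < 1 by rewrite sqr_ge0/= expr_lt1.
have [S [Slin Ssym Sge0 Snorm [SS SK]]] := sqrt_one_minus k01 K_lin K_sym K_norm.
have Sker x : kernel_orth Qm x -> kernel_orth Qm (S x).
  apply: SK.
  - by move=> a u v; exact: kernel_orth_lin.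
  - by move=> u y; exact: kernel_orth_cvg.
  - by move=> y; exact: Sl_ker.
have pker x : carrier Hm x -> kernel_orth Qm (pm x).
  by move=> cx; have [] := pinv_spec hm hf cx.
have pK x : kernel_orth Qm x -> pm (mh x) = x by exact: (pinv_sqrtK hm hf).
exists (fun x => mh (S (pm x))); split; first split; first split.
- by move=> x _; exists (S (pm x)).
- move=> a x y cx cy; rewrite /pm (pinv_lin hm hf)// Slin.
  by rewrite /mh (cov_sqrt_lin hm hf).
- by exists 2 => x cx; rewrite !cm_norm pK//; apply: Sker; exact: pker.
- move=> x y cx cy /=; rewrite -/mh -/pm !pK//; [apply: Sker; exact: pker..].
- by move=> x cx /=; rewrite -/mh -/pm pK//; apply: Sker; exact: pker.
- move=> x cx; rewrite pK; last by apply: Sker; exact: pker.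
  rewrite SS -pm_P//.
  have cP : carrier Hm (P x).
    by apply: cm_sub => //; apply: Tstar_mem; exact: T_mem.
  by have [] := pinv_spec hm hf cP.
Qed.

(* ⟨h, T^* v⟩ and ⟨h, C v⟩ are inner products in the Cameron-Martin spaces. *)
Lemma inner_adjoint h v : carrier Hn v -> inner h (Tstar v) = inner (L (mh h)) (pn v).
Proof.
move=> cv; rewrite (inner_range hm hf); last exact: Tstar_mem.
have [_ e] := adjoint_spec.
have := e _ _ (Hm_mh (mh h)) cv; rewrite /= -/mh -/nh -/pm -/pn.
by rewrite -/(lift_op (mh h)) => ->; rewrite /pm (pinv_sqrtK hm hf)//; exact: (cov_sqrt_mem hm hf).
Qed.

Lemma inner_sqrt_defect h v : carrier Hm v -> inner h (C v) = inner (pm (C (Qm h))) (pm v).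
Proof.
move=> cv; have [[[c _ _] s _] _] := sqrt_defect_spec.
rewrite (inner_range hm hf); last exact: c.
have cQ : carrier Hm (Qm h) by exact: (range_cov hm hf).
by have := s _ _ cQ cv; rewrite /= -/mh -/pm => ->; rewrite /pm (pinv_cov hm hf).
Qed.

(** This is the variance of <h, B y>. By symmetry the left side is the Cameron-Martin product of Qm
    h with C (C (Qm h)), and C squared is the identity minus Tstar T. *)
Lemma norm_sqrt_defect h :
  `|pm (C (Qm h))| ^+ 2 = `|mh h| ^+ 2 - `|L (mh h)| ^+ 2.
Proof.
have [[[c _ _] s _] CC] := sqrt_defect_spec.
have cQ : carrier Hm (Qm h) by exact: (range_cov hm hf).
rewrite -!inner_norm.
have := s _ _ cQ (c _ cQ); rewrite /= -/mh -/pm => ->.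
rewrite CC// pm_P// /pm (pinv_cov hm hf) -/mh innerBr; congr (_ - _).
by rewrite -Sl_spec.
Qed.

Lemma sqrt_defect_ker h : kernel_orth Qm (pm (C (Qm h))).
Proof.
have [[[c _ _] _ _] _] := sqrt_defect_spec.
by have [] := pinv_spec hm hf (c _ (range_cov hm hf h)).
Qed.

End cameron_martin_operators.

(** * Characteristic functions of linear measurable versions *)

Section gaussian_law.
Context {R : realType} {X : hilbertType R}.
Hypothesis hX : separable_space X.
Variables (mu : probability (borel X) R) (Q : X -> X) (f : nat -> X).
Hypotheses (hmu : centered_gaussian mu Q) (hf : eigenbasis Q f).

Let hQ : nonneg_operator ambient Q. Proof. by have [] := hmu. Qed.
Let Qh := sqrt_operator ambient Q.
Let pinv := pseudo_inverse Qh.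

Lemma cov_sqrt_norm h : inner (Q h) h = `|Qh h| ^+ 2.
Proof.
have [_ QhQh] := cov_sqrt_spec hQ hf.
by rewrite -QhQh (cov_sqrt_sym hQ hf) inner_norm.
Qed.

Lemma gaussian_cos h : \int[mu]_x cos (inner h x) = expR (- (`|Qh h| ^+ 2 / 2)).
Proof. by have [_ _ hc _] := hmu; rewrite /Rintegral hc/= cov_sqrt_norm. Qed.

Lemma gaussian_sin h : \int[mu]_x sin (inner h x) = 0.
Proof. by have [_ _ _ hs] := hmu; rewrite /Rintegral hs. Qed.

Lemma gaussian_trace : exists2 e : nat -> X, orthonormal_basis setT e &
  cvgn (series (fun k => `|Qh (e k)| ^+ 2)).
Proof.
have [_ [e he ht] _ _] := hmu; exists e => //.
by under eq_fun do rewrite -cov_sqrt_norm.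
Qed.

Section version.
Variables (S : X -> X) (A : borel X -> borel X).
Hypothesis mA : measurable_fun setT A.
Hypothesis S_lin : forall a x y, range Qh x -> range Qh y -> S (a *: x + y) = a *: S x + S y.
Hypothesis SA : (\int[mu]_x (`|(A x : X) - S (partial_proj f m x)| ^+ 2)%:E)%E
  @[m --> \oo] --> 0%E.
Variables (h zeta : X).
Hypothesis zeta_ker : kernel_orth Q zeta.
Hypothesis zetaE : forall v, range Qh v -> inner h (S v) = inner zeta (pinv v).

Let range0 : range Qh 0. Proof. by exists 0 => //; exact: (cov_sqrt0 hQ hf). Qed.

Let range_sum (s : seq nat) (c : nat -> R) : range Qh (\sum_(k <- s) c k *: f k) /\
  S (\sum_(k <- s) c k *: f k) = \sum_(k <- s) c k *: S (f k).
Proof.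
elim: s => [|k s [ih1 ih2]].
  by rewrite !big_nil; split => //; have := S_lin (-1) range0 range0; rewrite scaler0 addr0 scaleN1r addNr.
rewrite !big_cons; split; first exact: (range_lin hQ hf) (range_eigen hQ hf k) ih1.
by rewrite S_lin ?ih2//; exact: (range_eigen hQ hf).
Qed.

Let proj_sum m x : partial_proj f m x = \sum_(0 <= k < m) inner x (f k) *: f k.
Proof. by rewrite /partial_proj (big_mkord xpredT (fun k => inner x (f k) *: f k)). Qed.

(** Represents the functional x -> <h, S (pi_m x)> ([inner_w]); its variance under mu is the squared
    norm of the m-th partial projection of [zeta] ([Qh_w]). *)
Let w m : X := \sum_(0 <= k < m) inner zeta (pinv (f k)) *: f k.

Let inner_w m x : inner h (S (partial_proj f m x)) = inner (w m) x.
Proof.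
have [_ e] := range_sum (index_iota 0 m) (fun k => inner x (f k)).
rewrite proj_sum e inner_sumr inner_suml; apply: eq_bigr => k _.
rewrite innerZr innerZl zetaE; last exact: (range_eigen hQ hf).
by rewrite mulrC (innerC x).
Qed.

Let Qh_w m : Qh (w m) = partial_proj f m zeta.
Proof.
rewrite /w /Qh (lin_sum (cov_sqrt_lin hQ hf)) proj_sum; apply: eq_bigr => k _.
rewrite (cov_sqrt_eigen hQ hf) scalerA; congr (_ *: _).
by rewrite -{2}(pinv_eigen hQ hf k) innerZr mulrC.
Qed.

Let cos_w : \int[mu]_x cos (inner (w m) x) @[m --> \oo] --> expR (- (`|zeta| ^+ 2 / 2)).
Proof.
under eq_fun do rewrite gaussian_cos Qh_w.
have zc := eigen_cvg hf zeta_ker.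
have h1 : `|partial_proj f m zeta| @[m --> \oo] --> `|zeta| by exact: cvg_norm.
have h2 : - (`|partial_proj f m zeta| ^+ 2 / 2) @[m --> \oo] --> - (`|zeta| ^+ 2 / 2).
  by apply: cvgN; apply: cvgM; [rewrite !expr2; exact: cvgM|exact: cvg_cst].
by apply: (continuous_cvg _ _ h2); exact: continuous_expR.
Qed.

Let mSp m : measurable_fun setT (fun x : borel X => (S (partial_proj f m x) : borel X)).
Proof.
have -> : (fun x : borel X => (S (partial_proj f m x) : borel X)) =
    (fun x : borel X => \sum_(0 <= k < m) inner (f k) x *: S (f k)).
  apply/funext => x; rewrite proj_sum.
  have [_ ->] := range_sum (index_iota 0 m) (fun k => inner x (f k)).
  by apply: eq_bigr => k _; rewrite innerC.
apply: measurable_borel_borel; elim: (index_iota 0 m) => [|k s ih].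
  by under eq_fun do rewrite big_nil; exact: cst_continuous.
under eq_fun do rewrite big_cons.
move=> x; apply: cvgD; last exact: ih.
by apply: cvgZr_tmp; exact: inner_continuous.
Qed.

(** A bounded 1-Lipschitz function turns the L^2 convergence of S pi_m to A into convergence of the
    integrals, by Jensen and Cauchy-Schwarz. *)
Let version_cvg (phi : R -> R) : continuous phi ->
  (forall a, `|phi a| <= 1) -> (forall a b, `|phi a - phi b| <= `|a - b|) ->
  \int[mu]_x phi (inner (w m) x) @[m --> \oo] --> \int[mu]_x phi (inner h (A x)).
Proof.
move=> cphi phi1 phil.
have mphi : measurable_fun setT phi by exact: continuous_measurable_fun.
have bw m : bmf (fun x : borel X => phi (inner (w m) x)).
  split; last by exists 1.
  by apply: measurableT_comp => //; exact: measurable_inner.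
have bA : bmf (fun x : borel X => phi (inner h (A x))).
  split; last by exists 1.
  apply: measurableT_comp => //; exact: (measurableT_comp (measurable_inner h) mA).
pose D m := \int[mu]_x phi (inner (w m) x) - \int[mu]_x phi (inner h (A x)).
pose I m := (\int[mu]_x (`|(A x : X) - S (partial_proj f m x)| ^+ 2)%:E)%E.
have mI m : measurable_fun setT (fun x : borel X => (`|(A x : X) - S (partial_proj f m x)| ^+ 2)%:E).
  apply/measurable_EFinP; apply: measurable_funX.
  apply: (measurableT_comp measurable_hnorm).
  apply: measurable_hadd => //.
  have := measurableT_comp (measurable_hscale (X := X) (-1)) (mSp m).
  by apply: eq_measurable_fun => x _ /=; rewrite scaleN1r.
have DI m : ((D m ^+ 2)%:E <= (`|h| ^+ 2)%:E * I m)%E.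
  rewrite /D -bmf_intB//.
  have bB : bmf (fun x : borel X => phi (inner (w m) x) - phi (inner h (A x))) by exact: bmfB.
  apply: (@le_trans _ _ (\int[mu]_x (phi (inner (w m) x) - phi (inner h (A x))) ^+ 2)%:E).
    by rewrite lee_fin; exact: sqr_int_le.
  rewrite -bmf_EFin_int; last exact: bmfX.
  rewrite /I -ge0_integralZl_EFin//.
  apply: ge0_le_integral => //.
  - by move=> x _; rewrite lee_fin sqr_ge0.
  - by apply/measurable_EFinP; have [] := bmfX 2 bB.
  - exact: measurable_funeM.
  - move=> x _; rewrite -EFinM lee_fin -exprMn -[leLHS]real_normK ?num_real//.
    rewrite ler_sqr ?nnegrE ?mulr_ge0// (le_trans (phil _ _))//.
    rewrite -inner_w -innerBr (le_trans (cauchy_schwarz _ _))//.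
    by rewrite distrC.
have D2 : D m ^+ 2 @[m --> \oo] --> (0 : R).
  suff : (D m ^+ 2)%:E @[m --> \oo] --> (0 : R)%:E by exact: fine_cvg.
  apply: (squeeze_cvge (f := cst 0%E) (h := fun m => ((`|h| ^+ 2)%:E * I m)%E)).
  - by apply: nearW => m; rewrite lee_fin sqr_ge0 DI.
  - exact: cvg_cst.
  - by rewrite -[X in _ --> X](mule0 (`|h| ^+ 2)%:E); apply: cvgeZl.
have D1 : D m @[m --> \oo] --> (0 : R).
  apply/norm_cvg0P; rewrite -[X in _ --> X](@sqrtr0 R).
  under eq_fun do rewrite -sqrtr_sqr.
  by apply: continuous_cvg => //; exact: sqrt_continuous.
rewrite -[X in _ --> X]add0r.
rewrite (_ : (fun m => _) = (fun m => D m + \int[mu]_x phi (inner h (A x)))).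
  by apply: cvgD => //; exact: cvg_cst.
by apply/funext => m; rewrite /D subrK.
Qed.

Lemma version_cos : \int[mu]_x cos (inner h (A x)) = expR (- (`|zeta| ^+ 2 / 2)).
Proof.
have c1 (a : R) : `|cos a| <= 1 by rewrite ler_norml cos_geN1 cos_le1.
have h1 := version_cvg (@continuous_cos R) c1 (@cos_lipschitz R).
by rewrite -(cvg_lim _ h1)// (cvg_lim _ cos_w).
Qed.

Lemma version_sin : \int[mu]_x sin (inner h (A x)) = 0.
Proof.
have c1 (a : R) : `|sin a| <= 1 by rewrite ler_norml sin_geN1 sin_le1.
have h1 := version_cvg (@continuous_sin R) c1 (@sin_lipschitz R).
rewrite -(cvg_lim _ h1)//; under eq_fun do rewrite gaussian_sin.
exact: lim_cst.
Qed.

End version.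
End gaussian_law.

(** * The L^p to L^q bound for bounded nonnegative functions *)

Section bounded_lp_bound.
Context {R : realType} {X : hilbertType R}.
Hypothesis hX : separable_space X.
Variables (mu nu : probability (borel X) R) (A B : borel X -> borel X) (r : R).
Hypotheses (mA : measurable_fun setT A) (mB : measurable_fun setT B).
Hypothesis r01 : 0 < r < 1.
Let P : probability _ R := pair_prob mu nu.
Let G := gamma mu A B.
Hypothesis G_int : forall f, bmf f -> \int[nu]_x G f x = \int[mu]_x f x.
Hypothesis hyper : forall (al be : R) (f g : borel X -> R), 0 < al < 1 -> 0 < be < 1 ->
  r ^+ 2 * (al * be) <= (1 - al) * (1 - be) ->
  bmf f -> bmf g -> (forall x, 0 <= f x) -> (forall x, 0 <= g x) ->
  \int[P]_z (f z.1 `^ al * g (pair_out A B z) `^ be) <=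
  (\int[nu]_x f x) `^ al * (\int[mu]_x g x) `^ be.

Let bG f : bmf f -> bmf (G f). Proof. exact: gamma_bmf. Qed.

Let G_ge0 f : bmf f -> (forall x, 0 <= f x) -> forall x, 0 <= G f x.
Proof. by move=> bf f0 x; apply: Rintegral_ge0 => y _. Qed.

Let pair_int_mul (u : borel X -> R) f : bmf u -> bmf f ->
  \int[P]_z (u z.1 * f (pair_out A B z)) = \int[nu]_x (u x * G f x).
Proof.
move=> bu bf.
have b1 : bmf (fun z : borel X * borel X => u z.1) by exact: (bmf_comp measurable_fst bu).
have b2 := bmf_out hX mA mB bf.
rewrite /P /pair_prob bmf_fubini1; last exact: bmfM.
apply: eq_Rintegral => x _ /=; rewrite bmf_intZ//.
exact: (bmf_pair1 b2 x).
Qed.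

(** Duality with (G f)^q as test function: al = 1 - 1/q and be = 1/p give I <= I^(1 - 1/q) J^(1/p),
    and I is cancelled. The case p = 1 forces q = 1 and is invariance of the integral. *)
Lemma gamma_powR_bound (p q : R) (f : borel X -> R) : 1 <= p -> 1 <= q ->
  q - 1 <= (p - 1) * r ^- 2 -> bmf f -> (forall x, 0 <= f x) ->
  \int[nu]_x (G f x `^ q) <= (\int[mu]_x (f x `^ p)) `^ (q / p).
Proof.
move=> p1 q1 qp bf f0.
have /andP[r0 r1] := r01.
have r2 : 0 < r ^+ 2 by rewrite exprn_gt0.
have qp' : (q - 1) * r ^+ 2 <= p - 1 by rewrite -ler_pdivlMr.
have p0 : 0 < p by exact: lt_le_trans p1.
have q0 : 0 < q by exact: lt_le_trans q1.
have Gf0 := G_ge0 bf f0.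
have [pE|pn1] := eqVneq p 1.
  have qE : q = 1.
    apply/eqP; rewrite eq_le q1 andbT -subr_le0.
    by move: qp; rewrite pE subrr mul0r.
  rewrite pE qE divr1 powRr1; last by apply: Rintegral_ge0 => x _; exact: powR_ge0.
  rewrite [leLHS](_ : _ = \int[nu]_x G f x); last by apply: eq_Rintegral => x _; rewrite powRr1.
  rewrite G_int// le_eqVlt; apply/orP; left; apply/eqP.
  by apply: eq_Rintegral => x _; rewrite powRr1.
have p1' : 1 < p by rewrite lt_def pn1.
have be01 : 0 < p^-1 < 1 by rewrite invr_gt0 p0 invf_lt1.
have bfp : bmf (fun x => f x `^ p) by apply: bmf_powR => //; exact: ltW.
have fp0 x : 0 <= f x `^ p by exact: powR_ge0.
have fpK x : (f x `^ p) `^ p^-1 = f x by rewrite -powRrM divff ?gt_eqF// powRr1.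
(* For q = 1 the dual exponent degenerates; the test function is 1, with al = 1 - 1/p. *)
have [qE|qn1] := eqVneq q 1.
  rewrite qE div1r [leLHS](_ : _ = \int[P]_z ((cst 1 z.1) `^ (1 - p^-1) * (f (pair_out A B z) `^ p) `^ p^-1)).
    apply: le_trans (hyper _ be01 _ (bmf_cst 1) bfp _ fp0) _ => //.
    - lra.
    - have -> : 1 - (1 - p^-1) = p^-1 by ring.
      rewrite [leRHS]mulrC -[leRHS]mul1r ler_wpM2r//.
        by move/andP : be01 => [b0 b1]; rewrite mulr_ge0 ?ltW// subr_gt0.
      by rewrite exprn_ile1// ltW.
    - by rewrite prob_int_cst powR1 mul1r.
  under [RHS]eq_Rintegral do rewrite fpK powR1.
  rewrite (pair_int_mul (bmf_cst 1) bf); apply: eq_Rintegral => x _.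
  by rewrite mul1r powRr1.
have q1' : 1 < q by rewrite lt_def qn1.
set I := \int[nu]_x _; set J := \int[mu]_x _.
have bGq : bmf (fun x => G f x `^ q) by apply: bmf_powR => //; [exact: ltW|exact: bG].
have I0 : 0 <= I by apply: Rintegral_ge0 => x _; exact: powR_ge0.
have J0 : 0 <= J by apply: Rintegral_ge0 => x _; exact: powR_ge0.
have al01 : 0 < (q - 1) / q < 1.
  by rewrite divr_gt0 ?subr_gt0//= ltr_pdivrMr// mul1r ltrBlDr ltrDl.
have key : I <= I `^ ((q - 1) / q) * J `^ p^-1.
  rewrite {1}(_ : I = \int[P]_z ((G f z.1 `^ q) `^ ((q - 1) / q) * (f (pair_out A B z) `^ p) `^ p^-1)).
    apply: hyper => //; last by move=> x; exact: powR_ge0.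
    have -> : 1 - (q - 1) / q = q^-1 by field; rewrite gt_eqF.
    have -> : 1 - p^-1 = (p - 1) / p by field; rewrite gt_eqF.
    rewrite (_ : r ^+ 2 * _ = (q^-1 * p^-1) * ((q - 1) * r ^+ 2)); last by ring.
    have -> : q^-1 * ((p - 1) / p) = (q^-1 * p^-1) * (p - 1) by ring.
    by rewrite ler_wpM2l// mulr_ge0 ?invr_ge0 ?ltW.
  under [RHS]eq_Rintegral do rewrite fpK -powRrM (mulrC q) divfK ?(gt_eqF q0)//.
  have bq1 : bmf (fun x => G f x `^ (q - 1)).
    by apply: bmf_powR => //; [rewrite subr_ge0|exact: bG].
  rewrite (pair_int_mul bq1 bf); apply: eq_Rintegral => x _.
  by rewrite mulrC mulr_powRB1// subr_gt0.
have [->|In0] := eqVneq I 0; first exact: powR_ge0.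
have Ip : 0 < I by rewrite lt_def In0.
have key2 : I `^ q^-1 <= J `^ p^-1.
  have Ia : 0 < I `^ ((q - 1) / q) by rewrite powR_gt0.
  rewrite -(ler_pM2l Ia) -powRD; last by rewrite In0 implybT.
  rewrite (_ : (q - 1) / q + q^-1 = 1); last by field; rewrite gt_eqF.
  by rewrite powRr1.
have -> : I = (I `^ q^-1) `^ q by rewrite -powRrM mulVf ?gt_eqF// powRr1.
rewrite mulrC powRrM ge0_ler_powR ?nnegrE ?powR_ge0//; exact: ltW.
Qed.

End bounded_lp_bound.

(** The limit of [u] may be infinite. Contrapositively, if the limit of the powers is below a^q, it
    is finite and its q-th root bounds all the u n. *)
Lemma limn_ereal_powR (R : realType) (u : nat -> R) (a q : R) : 0 < q -> 0 <= a ->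
  (forall n, 0 <= u n) -> {homo u : m n / (m <= n)%N >-> m <= n} ->
  (a%:E <= limn (EFin \o u))%E -> ((a `^ q)%:E <= limn (fun n => (u n `^ q)%:E))%E.
Proof.
move=> q0 a0 u0 ndu; apply: contraTT; rewrite -!ltNge => hq.
have q0' := ltW q0.
have nduq : {homo (fun n => (u n `^ q)%:E) : m n / (m <= n)%N >-> (m <= n)%E}.
  by move=> m n mn; rewrite lee_fin ge0_ler_powR ?nnegrE//; exact: ndu.
have uq n : ((u n `^ q)%:E <= limn (fun n => (u n `^ q)%:E))%E.
  apply: lime_ge; first exact: ereal_nondecreasing_is_cvgn.
  by exists n => // m; exact: nduq.
have : limn (fun n => (u n `^ q)%:E) \is a fin_num.
  rewrite ge0_fin_numE; first exact: lt_trans hq (ltry _).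
  by rewrite (le_trans _ (uq 0))// lee_fin powR_ge0.
move/fineK => lE; rewrite -lE in hq uq.
set l := fine _ in hq uq.
have l0 : 0 <= l by rewrite -lee_fin (le_trans _ (uq 0))// lee_fin powR_ge0.
apply: (@le_lt_trans _ _ (l `^ q^-1)%:E).
  apply: lime_le.
    apply: ereal_nondecreasing_is_cvgn => m n mn; rewrite lee_fin; exact: ndu.
  apply: nearW => n; rewrite lee_fin.
  have -> : u n = (u n `^ q) `^ q^-1 by rewrite -powRrM divff ?gt_eqF// powRr1.
  rewrite ge0_ler_powR ?nnegrE ?powR_ge0 ?invr_ge0//.
  by have := uq n; rewrite lee_fin.
rewrite lte_fin; have -> : a = (a `^ q) `^ q^-1 by rewrite -powRrM divff ?gt_eqF// powRr1.
by rewrite gt0_ltr_powR ?nnegrE ?invr_gt0// ?powR_ge0//; rewrite lte_fin in hq.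
Qed.

(** * From bounded to arbitrary measurable functions *)

Section lp_transfer.
Context {R : realType} {X : hilbertType R}.
Hypothesis hX : separable_space X.
Variables (mu nu : probability (borel X) R) (A B : borel X -> borel X).
Hypotheses (mA : measurable_fun setT A) (mB : measurable_fun setT B).
Variables p q : R.
Hypotheses (p1 : 1 <= p) (q1 : 1 <= q).
Let G := gamma mu A B.
Hypothesis bound : forall f : borel X -> R, bmf f -> (forall x, 0 <= f x) ->
  \int[nu]_x (G f x `^ q) <= (\int[mu]_x (f x `^ p)) `^ (q / p).

Let mpair x : measurable_fun setT (fun y : borel X => pair_out A B (x, y)).
Proof. by apply: measurableT_comp; [exact: measurable_pair_out|exact: measurable_pair1]. Qed.

(** The bounded case applies to the truncations of |k|, and monotone convergence carries it over.
    Dominating |h| by an extended integral makes sense even where k is not integrable. *)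
Lemma lp_transfer (h k : borel X -> R) : measurable_fun setT h -> measurable_fun setT k ->
  (forall x, (`|h x|%:E <= \int[mu]_y `|k (pair_out A B (x, y))|%:E)%E) ->
  ('N[nu]_q%:E[EFin \o h] <= 'N[mu]_p%:E[EFin \o k])%E.
Proof.
move=> mh mk hk.
have p0 : 0 < p by exact: lt_le_trans p1.
have q0 : 0 < q by exact: lt_le_trans q1.
have p0' := ltW p0; have q0' := ltW q0.
pose F n x := Num.min `|k x| n%:R.
have F0 n x : 0 <= F n x by rewrite /F le_min normr_ge0 ler0n.
have mF n : measurable_fun setT (F n).
  by apply: measurable_minr; [exact: measurableT_comp|exact: measurable_cst].
have bF n : bmf (F n).
  by split => //; exists n%:R => x; rewrite ger0_norm// /F ge_min lexx orbT.
have ndF x : {homo F ^~ x : m n / (m <= n)%N >-> m <= n}.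
  move=> m n mn; rewrite /F le_min !ge_min lexx/=.
  by apply/orP; right; rewrite ler_nat.
have limF x : limn (fun n => (F n x)%:E) = `|k x|%:E.
  apply: cvg_lim => //; apply: cvg_near_cst.
  have [N hN] : exists N : nat, `|k x| <= N%:R.
    exists (Num.bound `|k x|); rewrite ltW//.
    exact: archi_boundP.
  by exists N => // n /= Nn; rewrite /F min_l// (le_trans hN)// ler_nat.
have bFp n x : bmf (fun y => F n (pair_out A B (x, y))).
  exact: (bmf_comp (mpair x) (bF n)).
have GF0 n x : 0 <= G (F n) x by apply: Rintegral_ge0.
have bG n : bmf (G (F n)) by exact: gamma_bmf.
have ndG x : {homo (fun n => G (F n) x) : m n / (m <= n)%N >-> m <= n}.
  by move=> m n mn; apply: bmf_int_le => // y; exact: ndF.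
have limG x : limn (fun n => (G (F n) x)%:E) = (\int[mu]_y `|k (pair_out A B (x, y))|%:E)%E.
  under eq_fun do rewrite /G /gamma -bmf_EFin_int//.
  rewrite -monotone_convergence//.
  - by apply: eq_integral => y _; exact: limF.
  - by move=> n; apply/measurable_EFinP; have [] := bFp n x.
  - by move=> n y _; rewrite lee_fin.
  - by move=> y _ m n mn; rewrite lee_fin; exact: ndF.
pose J := (\int[mu]_x (`|k x| `^ p)%:E)%E.
have J0 : (0 <= J)%E by apply: integral_ge0 => x _; rewrite lee_fin powR_ge0.
have bGq n : bmf (fun x => G (F n) x `^ q) by apply: bmf_powR => //; exact: ltW.
have bFq n : bmf (fun x => F n x `^ p) by apply: bmf_powR => //; exact: ltW.
have Gbound n : (\int[nu]_x (G (F n) x `^ q)%:E <= J `^ (q / p))%E.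
  rewrite bmf_EFin_int//.
  apply: (@le_trans _ _ ((\int[mu]_x (F n x `^ p)%:E) `^ (q / p))%E).
    by rewrite bmf_EFin_int// poweR_EFin lee_fin; exact: bound.
  apply: gt0_ler_poweR.
  - by rewrite divr_ge0 ?ltW.
  - by rewrite in_itv/= leey andbT; apply: integral_ge0 => x _; rewrite lee_fin powR_ge0.
  - by rewrite in_itv/= leey andbT.
  - apply: ge0_le_integral => //.
    + by move=> x _; rewrite lee_fin powR_ge0.
    + by apply/measurable_EFinP; have [] := bFq n.
    + apply/measurable_EFinP; apply: (measurableT_comp (measurable_powR p)).
      exact: measurableT_comp.
    + move=> x _; rewrite lee_fin ge0_ler_powR ?nnegrE//.
      by rewrite /F ge_min lexx.
have main : (\int[nu]_x (`|h x| `^ q)%:E <= J `^ (q / p))%E.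
  apply: (@le_trans _ _ (\int[nu]_x limn (fun n => (G (F n) x `^ q)%:E))%E).
    apply: ge0_le_integral => //.
    - apply/measurable_EFinP; apply: (measurableT_comp (measurable_powR q)).
      by apply: measurableT_comp.
    - apply: (emeasurable_fun_cvg (fun n x => (G (F n) x `^ q)%:E)).
        by move=> n; apply/measurable_EFinP; have [] := bGq n.
      move=> x xT; apply: ereal_nondecreasing_is_cvgn => m n mn.
      rewrite lee_fin ge0_ler_powR ?nnegrE//; exact: ndG.
    - move=> x _; apply: limn_ereal_powR => //.
      by rewrite (_ : EFin \o _ = (fun n => (G (F n) x)%:E))// limG.
  have ndI : {homo (fun n => (\int[nu]_x (G (F n) x `^ q)%:E)%E) :
      m n / (m <= n)%N >-> (m <= n)%E}.
    move=> m n mn; change (\int[nu]_x (G (F m) x `^ q)%:E <= \int[nu]_x (G (F n) x `^ q)%:E)%E.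
    rewrite [leLHS](bmf_EFin_int (P := nu) (bGq m)) [leRHS](bmf_EFin_int (P := nu) (bGq n)) lee_fin.
    apply: (bmf_int_le (bGq m) (bGq n)) => x.
    rewrite ge0_ler_powR ?nnegrE//; exact: ndG.
  rewrite monotone_convergence//; last first.
  - move=> x _ m n mn; rewrite lee_fin ge0_ler_powR ?nnegrE//; exact: ndG.
  - by move=> n x _; rewrite lee_fin powR_ge0.
  - by move=> n; apply/measurable_EFinP; have [] := bGq n.
  apply: lime_le; last by apply: nearW => n; exact: Gbound.
  exact: ereal_nondecreasing_is_cvgn.
rewrite unlock /=.
have -> : (\int[nu]_x `|(h x)%:E| `^ q = \int[nu]_x (`|h x| `^ q)%:E)%E.
  by apply: eq_integral.
have -> : (\int[mu]_x `|(k x)%:E| `^ p = J)%E by apply: eq_integral.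
have -> : (J `^ p^-1 = (J `^ (q / p)) `^ q^-1)%E.
  by rewrite -poweRrM mulrAC divff ?mul1r// gt_eqF.
apply: gt0_ler_poweR => //.
- by rewrite invr_ge0 ltW.
- by rewrite in_itv/= leey andbT; apply: integral_ge0 => x _; rewrite lee_fin powR_ge0.
- by rewrite in_itv/= leey andbT poweR_ge0.
Qed.

End lp_transfer.

(** * Differences of real-valued integrals with default value 0 *)

Section Rintegral_difference.
Context d (T : measurableType d) (R : realType) (P : {measure set T -> \bar R}).
Implicit Types u v : T -> R.

Lemma Rintegral_nonintegrable u : measurable_fun setT u ->
  ~ P.-integrable setT (EFin \o u) -> \int[P]_x u x = 0.
Proof.
move=> mu ni; rewrite /Rintegral.
have mEu : measurable_fun setT (EFin \o u) by exact/measurable_EFinP.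
have : (\int[P]_x (u x)%:E)%E \isn't a fin_num.
  apply/negP; rewrite integralE fin_numB => /andP[fp fn]; apply: ni.
  apply/integrableP; split => //.
  rewrite -[X in (\int[P]_(x in _) X x)%E]/(abse \o (EFin \o u)) fune_abse.
  rewrite ge0_integralD//; [|exact: measurable_funepos|exact: measurable_funeneg].
  by rewrite lte_add_pinfty// ltey_eq ?fp ?fn.
by case: (\int[P]_x _)%E.
Qed.

(** If u - v is integrable, then u and v are both integrable or both not; in the second case both
    real integrals take the default value 0. *)
Lemma Rintegral_diff_le u v : measurable_fun setT u -> measurable_fun setT v ->
  (`|(\int[P]_x u x)%R - (\int[P]_x v x)%R|%:E <= \int[P]_x `|u x - v x|%:E)%E.
Proof.
move=> mu mv.
have [->|Iuv] := eqVneq (\int[P]_x `|u x - v x|%:E)%E +oo%E; first exact: leey.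
have muv : measurable_fun setT (fun x => u x - v x) by exact: measurable_funB.
have iuv : P.-integrable setT (EFin \o (fun x => u x - v x)).
  by apply/integrableP; split; [exact/measurable_EFinP|rewrite ltey].
have [iu|niu] := pselect (P.-integrable setT (EFin \o u)).
  have iv : P.-integrable setT (EFin \o v).
    have := integrableB measurableT iu iuv; apply: eq_integrable => // x _ /=.
    by rewrite -EFinB opprB addrC subrK.
  rewrite -RintegralB// (@le_trans _ _ (\int[P]_x `|u x - v x|)%:E)//.
    by rewrite lee_fin; exact: le_normr_Rintegral.
  rewrite /Rintegral fineK//; apply: integrable_fin_num => //.
  exact: (integrable_norm iuv).
have niv : ~ P.-integrable setT (EFin \o v).
  move=> iv; apply: niu.
  have := integrableD measurableT iv iuv; apply: eq_integrable => // x _ /=.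
  by rewrite -EFinD addrC subrK.
by rewrite !Rintegral_nonintegrable// subrr normr0; apply: integral_ge0 => x _; rewrite lee_fin.
Qed.

End Rintegral_difference.

Lemma cvg_poweR0 (R : realType) (I : nat -> \bar R) (p : R) : 0 < p ->
  (forall n, 0 <= I n)%E -> I @ \oo --> 0%E -> (fun n => (I n `^ p)%E) @ \oo --> 0%E.
Proof.
move=> p0 I0 Icvg.
have /fine_cvgP[finI fI] : I @ \oo --> 0%:E by [].
have h : (fun n => fine (I n) `^ p) @ \oo --> (0 : R).
  apply/cvgrPdist_le => e e0.
  have e1 : 0 < e `^ p^-1 by rewrite powR_gt0.
  move/cvgrPdist_le : fI => /(_ _ e1); apply: filterS => n /=.
  rewrite !sub0r !normrN ger0_norm ?fine_ge0// => h.
  rewrite ger0_norm ?powR_ge0//.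
  have -> : e = (e `^ p^-1) `^ p by rewrite -powRrM mulVf ?gt_eqF// powRr1// ltW.
  by rewrite ge0_ler_powR ?nnegrE ?fine_ge0 ?powR_ge0// ltW.
apply/fine_cvgP; split; last first.
  apply: cvg_trans h; apply: near_eq_cvg; near=> n => /=.
  have fn : I n \is a fin_num by near: n.
  by rewrite -[in RHS](fineK fn) poweR_EFin.
by move: finI; apply: filterS => n fn; rewrite fin_num_poweR.
Unshelve. all: by end_near. Qed.

Lemma clip_diff (R : realType) (n : nat) (x : R) : `|clip (- n%:R) n%:R x - x| <= `|x|.
Proof.
have n0 : (0 : R) <= n%:R by exact: ler0n.
rewrite /clip; have [xn|nx] := lerP x n%:R; last first.
  have e : `|n%:R - x| = x - n%:R by rewrite distrC gtr0_norm// subr_gt0.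
  rewrite max_r; last by rewrite (le_trans _ n0)// oppr_le0.
  by rewrite e gtr0_norm ?(le_lt_trans n0)// gerBl.
have [nx|xn'] := lerP (- n%:R) x; first by rewrite subrr normr0.
have x0 : x < 0 by rewrite (lt_le_trans xn')// oppr_le0.
by rewrite gtr0_norm ?subr_gt0// ltr0_norm// gerDr oppr_le0.
Qed.

(** * Truncation in L^p *)

Section Lnorm_limits.
Context d (T : measurableType d) (R : realType) (P : probability T R).

Lemma LnormE (f : T -> R) (p : R) :
  'N[P]_p%:E[EFin \o f]%E = ((\int[P]_x (`|f x| `^ p)%:E) `^ p^-1)%E.
Proof. by rewrite unlock. Qed.

Lemma Lfun_measurable (f : T -> R) (p : \bar R) : f \in Lfun P p -> measurable_fun setT f.
Proof. by move=> /andP[+ _]; rewrite inE. Qed.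

Lemma Lfun_finite (f : T -> R) (p : \bar R) : f \in Lfun P p -> ('N[P]_p[EFin \o f] < +oo)%E.
Proof. by move=> /andP[_]; rewrite inE. Qed.

Lemma mem_Lfun (f : T -> R) (p : \bar R) : measurable_fun setT f ->
  ('N[P]_p[EFin \o f] < +oo)%E -> f \in Lfun P p.
Proof. by move=> mf nf; apply/andP; split; rewrite inE. Qed.

Lemma Lnorm_truncation (f : T -> R) (p : R) : 1 <= p -> f \in Lfun P p%:E ->
  'N[P]_p%:E[EFin \o ((fun x => clip (- n%:R) n%:R (f x)) \- f)%R]%E @[n --> \oo] --> 0%E.
Proof.
move=> p1 fL; have mf := Lfun_measurable fL; have := Lfun_finite fL.
have p0 : 0 < p by exact: lt_le_trans p1.
rewrite LnormE => If.
pose t n x := clip (- n%:R) n%:R (f x) - f x.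
have mt n : measurable_fun setT (t n).
  apply: measurable_funB => //; apply: measurable_maxr; first exact: measurable_cst.
  by apply: measurable_minr => //; exact: measurable_cst.
have mpow (g : T -> R) : measurable_fun setT g -> measurable_fun setT (fun x => (`|g x| `^ p)%:E).
  move=> mg; apply/measurable_EFinP; apply: (measurableT_comp (measurable_powR p)).
  by apply: measurableT_comp.
have tle n x : `|t n x| <= `|f x| by exact: clip_diff.
have t0 x : \forall n \near \oo, t n x = 0.
  exists (Num.bound `|f x|) => // n /= fn; rewrite /t clip_id ?subrr//.
  rewrite -ler_norml ltW// (lt_le_trans (archi_boundP (normr_ge0 _)))//.
  by rewrite ler_nat.
have fint : P.-integrable setT (fun x => (`|f x| `^ p)%:E).
  apply/integrableP; split; first exact: mpow.
  under eq_integral do rewrite gee0_abs ?lee_fin ?powR_ge0//.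
  by apply: lty_poweRy If; rewrite invr_neq0// gt_eqF.
have [||_ _ cv] := @dominated_convergence _ _ _ P setT measurableT
  (fun n x => (`|t n x| `^ p)%:E) (cst 0%E) (fun x => (`|f x| `^ p)%:E)
  (fun n => mpow _ (mt n)) (measurable_cst _) _ fint _.
- apply/nearW => x _; apply: cvg_near_cst; move: (t0 x); apply: filterS => n ->.
  by rewrite normr0 powR0// gt_eqF.
- apply/nearW => x n _; rewrite gee0_abs ?lee_fin ?powR_ge0//.
  by rewrite ge0_ler_powR ?nnegrE// ltW.
under eq_fun do rewrite LnormE.
apply: cvg_poweR0; first by rewrite invr_gt0.
  by move=> n; apply: integral_ge0 => x _; rewrite lee_fin powR_ge0.
by move: cv; rewrite integral0.
Qed.

End Lnorm_limits.

(** * The extension of the integral formula to L^p *)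

Section second_quantization_extension.
Context {R : realType} {X : hilbertType R}.
Hypothesis hX : separable_space X.
Variables (mu nu : probability (borel X) R) (A B : borel X -> borel X).
Hypotheses (mA : measurable_fun setT A) (mB : measurable_fun setT B).
Variable p : R.
Hypothesis p1 : 1 <= p.
Let G := second_quantization mu (A : X -> X) (B : X -> X).

(** Stated for dominated pairs so that it applies to G f and also to G f - G g, where linearity may
    fail at points without integrability. *)
Definition lp_contractive (q : R) := forall h k : borel X -> R,
  measurable_fun setT h -> measurable_fun setT k ->
  (forall x, (`|h x|%:E <= \int[mu]_y `|k (pair_out A B (x, y))|%:E)%E) ->
  ('N[nu]_q%:E[EFin \o h] <= 'N[mu]_p%:E[EFin \o k])%E.

Hypothesis contr_p : lp_contractive p.

Let mpair x : measurable_fun setT (fun y : borel X => pair_out A B (x, y)).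
Proof. by apply: measurableT_comp; [exact: measurable_pair_out|exact: measurable_pair1]. Qed.

Lemma measurable_second_quantization f : measurable_fun setT f -> measurable_fun setT (G f).
Proof.
move=> mf.
pose F (z : borel X * borel X) := (f (pair_out A B z))%:E.
have mF : measurable_fun setT F.
  apply/measurable_EFinP; apply: measurableT_comp => //.
  exact: measurable_pair_out.
have m1 : measurable_fun setT (fubini_F mu (F^\+)%E).
  by apply: measurable_fun_fubini_tonelli_F => //; exact: measurable_funepos.
have m2 : measurable_fun setT (fubini_F mu (F^\-)%E).
  by apply: measurable_fun_fubini_tonelli_F => //; exact: measurable_funeneg.
rewrite (_ : G f = fine \o (fubini_F mu (F^\+)%E \- fubini_F mu (F^\-)%E)%E).
  apply: (measurableT_comp (fine_measurable measurableT)).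
  exact: emeasurable_funB.
apply/funext => x; rewrite /G /second_quantization /Rintegral integralE.
by congr (fine (_ - _)%E); apply: eq_integral => y _; rewrite ?funeposE ?funenegE.
Qed.

Let G_diff f g x : measurable_fun setT f -> measurable_fun setT g ->
  (`|(G f \- G g) x|%:E <= \int[mu]_y `|(f \- g) (pair_out A B (x, y))|%:E)%E.
Proof.
move=> mf mg; apply: (@Rintegral_diff_le _ _ _ mu
  (fun y => f (pair_out A B (x, y))) (fun y => g (pair_out A B (x, y)))).
- exact: (measurableT_comp mf (mpair x)).
- exact: (measurableT_comp mg (mpair x)).
Qed.

Let G_le f x : measurable_fun setT f ->
  (`|G f x|%:E <= \int[mu]_y `|f (pair_out A B (x, y))|%:E)%E.
Proof.
move=> mf; have := @Rintegral_diff_le _ _ _ mu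
  (fun y => f (pair_out A B (x, y))) (cst 0) (measurableT_comp mf (mpair x)) (measurable_cst _).
rewrite /cst prob_int_cst subr0 => /le_trans; apply.
by under eq_integral do rewrite subr0.
Qed.

Lemma second_quantization_Lnorm q f : lp_contractive q -> measurable_fun setT f ->
  ('N[nu]_q%:E[EFin \o G f] <= 'N[mu]_p%:E[EFin \o f])%E.
Proof.
move=> cq mf; apply: cq => //; first exact: measurable_second_quantization.
by move=> x; exact: G_le.
Qed.

Lemma second_quantization_Lnorm_diff f g : measurable_fun setT f -> measurable_fun setT g ->
  ('N[nu]_p%:E[EFin \o (G f \- G g)%R] <= 'N[mu]_p%:E[EFin \o (f \- g)%R])%E.
Proof.
move=> mf mg; apply: contr_p.
- by apply: measurable_funB; exact: measurable_second_quantization.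
- exact: measurable_funB.
- by move=> x; exact: G_diff.
Qed.

(** The integral formula itself realises the extension; the truncations of f are bounded, hence of
    exponential growth, and approximate f. *)
Lemma second_quantization_Lp_exists f : f \in Lfun mu p%:E ->
  second_quantization_Lp mu nu A B p f (G f).
Proof.
move=> fL; have mf := Lfun_measurable fL.
split=> //.
  apply: mem_Lfun; first exact: measurable_second_quantization.
  exact: le_lt_trans (second_quantization_Lnorm contr_p mf) (Lfun_finite fL).
pose u n (x : borel X) := clip (- n%:R) n%:R (f x).
have mu_ n : measurable_fun setT (u n).
  by apply: measurable_maxr => //; apply: measurable_minr.
have ucvg := Lnorm_truncation p1 fL.
exists u; split => //.
- move=> n; split => //; exists n.+1%:R, 1; split => // x.
  have n0 : (0 : R) <= n%:R by exact: ler0n.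
  have : - n%:R <= u n x <= n%:R by apply: clip_range; rewrite (le_trans _ n0)// oppr_le0.
  rewrite -ler_norml => /le_trans; apply.
  rewrite (@le_trans _ _ n.+1%:R)// ?ler_nat// ler_peMr//.
  by rewrite mul1r -[leLHS]expR0 ler_expR.
- apply: (squeeze_cvge (f := cst 0%E) _ (cvg_cst _) ucvg).
  by apply: nearW => n; rewrite Lnorm_ge0/=; exact: second_quantization_Lnorm_diff.
Qed.

(** Uniqueness of the extension: G (u n) tends in L^p(nu) to g by definition and to G f by
    contractivity. *)
Lemma second_quantization_Lp_ae f g : second_quantization_Lp mu nu A B p f g ->
  ae_eq nu setT g (G f).
Proof.
move=> [fL gL [u [ug uf Gug]]].
have mf := Lfun_measurable fL; have mg := Lfun_measurable gL.
have mGf := measurable_second_quantization mf.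
have mGu n : measurable_fun setT (G (u n)).
  by apply: measurable_second_quantization; have [] := ug n.
have mD : measurable_fun setT (g \- G f) by exact: measurable_funB.
have le n : ('N[nu]_p%:E[EFin \o (g \- G f)%R] <=
    'N[nu]_p%:E[EFin \o (G (u n) \- g)%R] + 'N[mu]_p%:E[EFin \o (u n \- f)%R])%E.
  apply: le_trans (leeD2l _ (second_quantization_Lnorm_diff (proj1 (ug n)) mf)).
  rewrite (_ : 'N[nu]_p%:E[EFin \o (G (u n) \- g)%R] = 'N[nu]_p%:E[EFin \o (g \- G (u n))%R])%E; last first.
    rewrite -oppe_Lnorm; congr Lnorm; apply/funext => x /=; congr (_%:E); ring.
  apply: le_trans (eminkowski _ _ _ _) => //.
  - rewrite le_eqVlt; apply/orP; left; apply/eqP; congr Lnorm; apply/funext => x /=; congr (_%:E); ring.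
  - exact: measurable_funB.
  - exact: measurable_funB.
have N0 : 'N[nu]_p%:E[EFin \o (g \- G f)%R]%E = 0%E.
  apply/eqP; rewrite eq_le Lnorm_ge0 andbT.
  have c : ('N[nu]_p%:E[EFin \o (G (u n) \- g)%R] + 'N[mu]_p%:E[EFin \o (u n \- f)%R])%E
      @[n --> \oo] --> 0%E.
    by rewrite -[X in _ --> X](adde0 0%E); apply: cvgeD.
  rewrite -(cvg_lim _ c)//; apply: lime_ge; first by apply/cvg_ex; exists 0%E.
  by apply: nearW => n; exact: le.
have p0 : (0 < p%:E)%E by rewrite lte_fin; exact: lt_le_trans p1.
have mED : measurable_fun setT (EFin \o (g \- G f)%R) by exact/measurable_EFinP.
have := Lnorm_eq0_eq0 mED p0 N0.
apply: filterS => x /= /(_ I) [] /eqP; rewrite subr_eq0 => /eqP e _.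
by rewrite e.
Qed.

Lemma second_quantization_Lp_contraction q f g : 1 <= q -> lp_contractive q ->
  second_quantization_Lp mu nu A B p f g ->
  g \in Lfun nu q%:E /\ ('N[nu]_q%:E[EFin \o g] <= 'N[mu]_p%:E[EFin \o f])%E.
Proof.
move=> q1 cq hfg; have ae := second_quantization_Lp_ae hfg.
have [fL gL _] := hfg.
have mf := Lfun_measurable fL; have mg := Lfun_measurable gL.
have mGf := measurable_second_quantization mf.
have mpow (h : borel X -> R) : measurable_fun setT h -> measurable_fun setT (fun x => (`|h x| `^ q)%:E).
  move=> mh; apply/measurable_EFinP; apply: (measurableT_comp (measurable_powR q)).
  by apply: measurableT_comp.
have le : ('N[nu]_q%:E[EFin \o g] <= 'N[mu]_p%:E[EFin \o f])%E.
  apply: le_trans (second_quantization_Lnorm cq mf).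
  rewrite !LnormE (ae_eq_integral (fun x => (`|G f x| `^ q)%:E) _ measurableT (mpow _ mg) (mpow _ mGf))//.
  by move: ae; apply: filterS => x /= /(_ I) -> _.
split => //; apply: mem_Lfun => //.
exact: le_lt_trans le (Lfun_finite fL).
Qed.

End second_quantization_extension.

(** * Gaussian integrals of cosh and of exponentials of squares *)

Lemma cosh_ge_partial (R : realType) (x : R) m :
  \sum_(0 <= k < m) x ^+ k.*2 / (k.*2)`!%:R <= cosh x.
Proof.
pose a n := (exp_coeff x n + exp_coeff (- x) n) / 2.
have aE n : a n = if odd n then 0 else x ^+ n / n`!%:R.
  rewrite /a /exp_coeff/= (exprNn x) -signr_odd.
  by case: odd; rewrite ?expr1 ?expr0 ?mulN1r ?mul1r ?mulNr ?subrr ?mul0r//; field;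
     rewrite pnatr_eq0 -lt0n fact_gt0.
have a0 n : 0 <= a n.
  rewrite aE; case: ifPn => // on; rewrite divr_ge0// -(odd_double_half n) (negbTE on) add0n.
  by rewrite -mul2n exprM exprn_ge0// sqr_ge0.
have ac : series a @ \oo --> cosh x.
  rewrite (_ : series a = (fun n => (series (exp_coeff x) n + series (exp_coeff (- x)) n) / 2)).
    by apply: cvgM; [apply: cvgD; exact: is_cvg_series_exp_coeff|exact: cvg_cst].
  by apply/funext => n; rewrite /series/= -big_split/= big_distrl.
have -> : \sum_(0 <= k < m) x ^+ k.*2 / (k.*2)`!%:R = series a m.*2.
  elim: m => [|m ih]; first by rewrite /series/= !big_nil.
  rewrite big_nat_recr//= ih doubleS /series/= 2?big_nat_recr//= !aE/= odd_double/=.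
  by rewrite addr0.
rewrite -(cvg_lim _ ac)//; apply: nondecreasing_cvgn_le; last by apply/cvg_ex; eexists; exact: ac.
by apply: nondecreasing_series => n _ _; exact: a0.
Qed.

Lemma fact_double_le k : ((k.*2)`! <= 4 ^ k * (k`! * k`!))%N.
Proof.
elim: k => // k ih; rewrite doubleS !factS expnS.
rewrite (@leq_trans (k.+1.*2 * (k.+1.*2 * (4 ^ k * (k`! * k`!))))%N)//.
  rewrite -doubleS leq_mul// leq_mul//; by rewrite doubleS.
rewrite leq_eqVlt; apply/orP; left; apply/eqP; rewrite -mul2n; ring.
Qed.

Section gaussian_exponentials.
Context d {T : measurableType d} {R : realType} {P : probability T R}.
Variables (phi : T -> R) (v : R).
Hypothesis mphi : measurable_fun setT phi.
Hypothesis moment : forall k,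
  P.-integrable setT (EFin \o (fun s => phi s ^+ k.*2 / (k.*2)`!%:R)) /\
  \int[P]_s (phi s ^+ k.*2 / (k.*2)`!%:R) = (v / 2) ^+ k / k`!%:R.

Let mphi_pow c k : measurable_fun setT (fun s => (c * (phi s ^+ k.*2 / (k.*2)`!%:R))%:E).
Proof.
apply/measurable_EFinP; apply: measurable_funM => //; apply: measurable_funM => //.
exact: measurable_funX.
Qed.

Let pow_ge0 k s : 0 <= phi s ^+ k.*2 / (k.*2)`!%:R.
Proof. by rewrite divr_ge0// -mul2n exprM exprn_ge0// sqr_ge0. Qed.

Let moment_int k : (\int[P]_s (phi s ^+ k.*2 / (k.*2)`!%:R)%:E = ((v / 2) ^+ k / k`!%:R)%:E)%E.
Proof.
have [i e] := moment k; rewrite -e /Rintegral fineK//; exact: integrable_fin_num.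
Qed.

Let sum_moment (c : nat -> R) m : (forall k, 0 <= c k) ->
  (\int[P]_s (\sum_(0 <= k < m) c k * (phi s ^+ k.*2 / (k.*2)`!%:R))%:E =
   (\sum_(0 <= k < m) c k * ((v / 2) ^+ k / k`!%:R))%:E)%E.
Proof.
move=> c0; under eq_integral do rewrite -sumEFin.
rewrite ge0_integral_sum//; last by move=> k s _; rewrite lee_fin mulr_ge0.
rewrite -sumEFin; apply: eq_bigr => k _.
under eq_integral do rewrite EFinM.
rewrite ge0_integralZl_EFin//; first by rewrite moment_int.
- by move=> s _; rewrite lee_fin.
- by have := mphi_pow 1 k; under eq_fun do rewrite mul1r.
Qed.

(** Partial sums of the cosh series lie below cosh, and the moments integrate them to the partial
    sums of the exponential series. *)
Lemma cosh_int_ge a : ((expR (a ^+ 2 * v / 2))%:E <= \int[P]_s (cosh (a * phi s))%:E)%E.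
Proof.
have mcosh : measurable_fun setT (fun s => (cosh (a * phi s))%:E).
  apply/measurable_EFinP; apply: measurable_funM => //; apply: measurable_funD.
    apply: measurableT_comp => //; exact: measurable_funM.
  by apply: measurableT_comp => //; apply: measurableT_comp => //; exact: measurable_funM.
have ecvg : (\sum_(0 <= k < n) (a ^+ 2 * v / 2) ^+ k / k`!%:R)%:E @[n --> \oo]
    --> (expR (a ^+ 2 * v / 2))%:E.
  by apply: cvg_EFin; [exact: nearW|exact: is_cvg_series_exp_coeff].
rewrite -(cvg_lim _ ecvg)//; apply: lime_le; first by apply/cvg_ex; eexists; exact: ecvg.
apply: nearW => m.
have -> : \sum_(0 <= k < m) (a ^+ 2 * v / 2) ^+ k / k`!%:R =
    \sum_(0 <= k < m) (a ^+ 2) ^+ k * ((v / 2) ^+ k / k`!%:R).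
  by apply: eq_bigr => k _; rewrite -(mulrA _ v) (exprMn k (a ^+ 2)) mulrA.
rewrite -sum_moment; last by move=> k; rewrite exprn_ge0// sqr_ge0.
apply: ge0_le_integral => //.
- move=> s _; rewrite lee_fin sumr_ge0// => k _.
  by rewrite mulr_ge0// exprn_ge0// sqr_ge0.
- under eq_fun do rewrite -sumEFin.
  by apply: emeasurable_sum => k; exact: mphi_pow.
- move=> s _; rewrite lee_fin (le_trans _ (cosh_ge_partial _ m))// le_eqVlt.
  apply/orP; left; apply/eqP; apply: eq_bigr => k _.
  by rewrite (exprMn k.*2 a) mulrA -exprM mul2n.
Qed.

(** The k-th term of the exponential series integrates to c^k (2k)! / (4^k k!^2) <= c^k, so the
    integral is at most 1 / (1 - c). *)
Lemma exp_sqr_int_finite c : v = 1 -> 0 < c < 1 ->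
  (\int[P]_s (expR (c * phi s ^+ 2 / 2))%:E < +oo)%E.
Proof.
move=> v1 /andP[cp c1]; have c0 := ltW cp.
pose g m s := (\sum_(0 <= k < m) (c / 2) ^+ k * (k.*2)`!%:R / k`!%:R *
  (phi s ^+ k.*2 / (k.*2)`!%:R))%:E.
have fneq0 n : (n`!%:R : R) != 0 by rewrite pnatr_eq0 -lt0n fact_gt0.
have co0 k : 0 <= (c / 2) ^+ k * (k.*2)`!%:R / k`!%:R :> R.
  by rewrite divr_ge0// mulr_ge0// exprn_ge0// divr_ge0.
have gE m s : g m s = (series (exp_coeff (c * phi s ^+ 2 / 2)) m)%:E.
  congr EFin; apply: eq_bigr => k _; rewrite /exp_coeff/=.
  rewrite -(mulrAC c) (exprMn k (c / 2)) -exprM mul2n.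
  move: (phi s ^+ _) ((c / 2) ^+ k) => x y; field.
  by rewrite !fneq0.
have glim s : limn (g ^~ s) = (expR (c * phi s ^+ 2 / 2))%:E.
  apply: cvg_lim => //; under eq_fun do rewrite gE.
  by apply: cvg_EFin; [exact: nearW|exact: is_cvg_series_exp_coeff].
under eq_integral do rewrite -glim.
rewrite monotone_convergence//; last first.
- move=> s _ m n mn; rewrite lee_fin (big_cat_nat (leq0n m) mn)//= lerDl.
  by rewrite sumr_ge0// => k _; rewrite mulr_ge0.
- by move=> m s _; rewrite lee_fin sumr_ge0// => k _; rewrite mulr_ge0.
- move=> m; rewrite /g; under eq_fun do rewrite -sumEFin.
  by apply: emeasurable_sum => k; exact: mphi_pow.
have gi m : (\int[P]_s g m s <= ((1 - c)^-1)%:E)%E.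
  rewrite /g sum_moment// lee_fin.
  rewrite (@le_trans _ _ (\sum_(0 <= k < m) c ^+ k))//.
    apply: ler_sum => k _; rewrite v1 div1r.
    have := fact_double_le k; rewrite -(ler_nat R) !natrM natrX => h.
    have -> : (c / 2) ^+ k * (k.*2)`!%:R / k`!%:R * (2^-1 ^+ k / k`!%:R) =
       c ^+ k * ((k.*2)`!%:R / (4 ^+ k * (k`!%:R * k`!%:R))) :> R.
      rewrite (exprMn k c) (_ : 4 = 2 * 2 :> R); last by ring.
      rewrite (exprMn k 2) !exprVn.
      have : (2 : R) ^+ k != 0 by rewrite expf_neq0.
      move: (c ^+ k) (2 ^+ k : R) => x y y0; field.
      by rewrite fneq0.
    rewrite -[leRHS]mulr1 ler_wpM2l ?exprn_ge0// ler_pdivrMr ?mul1r//.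
  have := @geometric_le_lim R m 1 c ler01 cp; rewrite ger0_norm// mul1r => /(_ c1).
  by rewrite /series/=; under eq_bigr do rewrite mul1r.
apply: le_lt_trans (ltry ((1 - c)^-1)).
have ndI : {homo (fun m => (\int[P]_s g m s)%E) : m n / (m <= n)%N >-> (m <= n)%E}.
  move=> m n mn; rewrite /g (sum_moment m co0) (sum_moment n co0) lee_fin.
  rewrite (big_cat_nat (leq0n m) mn)//= lerDl sumr_ge0// => k _; rewrite mulr_ge0//.
  by rewrite divr_ge0// exprn_ge0// v1 divr_ge0.
apply: lime_le; first exact: ereal_nondecreasing_is_cvgn.
by apply: nearW => m; exact: gi.
Qed.

End gaussian_exponentials.

Lemma nonneg_law d1 d2 (T1 : measurableType d1) (T2 : measurableType d2)
    (R : realType) (X : hilbertType R) (P : probability T1 R) (Q : probability T2 R)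
    (a : T1 -> borel X) (b : T2 -> borel X) (F : borel X -> R) :
  measurable_fun setT a -> measurable_fun setT b ->
  (forall f : borel X -> R, bmf f -> \int[P]_t f (a t) = \int[Q]_t f (b t)) ->
  measurable_fun setT F -> (forall x, 0 <= F x) ->
  (\int[P]_t (F (a t))%:E = \int[Q]_t (F (b t))%:E)%E.
Proof.
move=> ma mb ab mF F0.
pose g n x := Num.min (F x) n%:R.
have g0 n x : 0 <= g n x by rewrite /g le_min F0 ler0n.
have mg n : measurable_fun setT (g n) by apply: measurable_minr.
have bg n : bmf (g n).
  by split => //; exists n%:R => x; rewrite ger0_norm// /g ge_min lexx orbT.
have ndg x : {homo g ^~ x : m n / (m <= n)%N >-> m <= n}.
  move=> m n mn; rewrite /g le_min !ge_min lexx/=.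
  by apply/orP; right; rewrite ler_nat.
have limg x : limn (fun n => (g n x)%:E) = (F x)%:E.
  apply: cvg_lim => //; apply: cvg_near_cst.
  exists (Num.bound (F x)) => // n /= Nn; rewrite /g min_l//.
  by rewrite ltW// (lt_le_trans (archi_boundP (F0 x)))// ler_nat.
have mct d (T : measurableType d) (M : probability T R) (c : T -> borel X) : measurable_fun setT c ->
    (\int[M]_t (F (c t))%:E)%E = limn (fun n => (\int[M]_t g n (c t))%:E).
  move=> mc; have bgc n := bmf_comp mc (bg n).
  under eq_integral do rewrite -limg.
  rewrite monotone_convergence//.
  - by congr (limn _); apply/funext => n; rewrite (bmf_EFin_int (P := M) (bgc n)).
  - by move=> n; apply/measurable_EFinP; have [] := bgc n.
  - by move=> n t _; rewrite lee_fin.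
  - by move=> t _ m n mn; rewrite lee_fin; exact: ndg.
rewrite (mct _ _ _ _ ma) (mct _ _ _ _ mb).
by under eq_fun do rewrite ab//.
Qed.

(** Completing the square bounds the exponent th s^2 / 2 below by the lines n s - n^2 / (2 th) and -
    n s - n^2 / (2 th); average the two exponentials. The free parameter n is sent to infinity in
    the end. *)
Lemma exp_sqr_ge_cosh (R : realType) (th n s : R) : 0 < th ->
  expR (- (n ^+ 2 / (2 * th))) * cosh (n * s) <= expR (th * s ^+ 2 / 2).
Proof.
move=> th0.
have h (e : R) : e ^+ 2 = 1 -> expR (- (n ^+ 2 / (2 * th)) + e * (n * s)) <= expR (th * s ^+ 2 / 2).
  move=> e1; rewrite ler_expR -subr_ge0.
  have -> : th * s ^+ 2 / 2 - (- (n ^+ 2 / (2 * th)) + e * (n * s)) =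
      (th * s - e * n) ^+ 2 / (2 * th).
    have thn : th != 0 by rewrite gt_eqF.
    have -> : (th * s - e * n) ^+ 2 = th ^+ 2 * s ^+ 2 - 2 * th * s * e * n + e ^+ 2 * n ^+ 2 by ring.
    by rewrite e1; field.
  by rewrite divr_ge0 ?sqr_ge0// mulr_ge0// ltW.
have e1 : (-1) ^+ 2 = 1 :> R by rewrite sqrrN expr1n.
have := h (-1) e1; have := h 1 (expr1n _ _); rewrite mul1r mulN1r !expRD /cosh.
set a := expR (- (n ^+ 2 / _)); set b := expR (n * s); set c := expR (- (n * s)).
move: (expR (th * _ / _)) => d' h1 h2.
have -> : a * ((b + c) / 2) = (a * b + a * c) / 2 by field.
lra.
Qed.

Lemma coshD_coshB (R : realType) (x y : R) :
  cosh (x + y) + cosh (x - y) = 2 * (cosh x * cosh y).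
Proof.
rewrite /cosh !opprD !opprK !expRD.
by move: (expR x) (expR (- x)) (expR y) (expR (- y)) => a b c d'; field.
Qed.

Lemma cosh_powR (R : realType) (q s : R) : 0 < q ->
  2^-1 `^ q * cosh (q * s) <= cosh s `^ q.
Proof.
move=> q0; have c0 : 0 < cosh s by rewrite divr_gt0// addr_gt0// expR_gt0.
have h (x : R) : expR x / 2 <= cosh x.
  by rewrite /cosh ler_pM2r ?invr_gt0// lerDl expR_ge0.
have coshN (x : R) : cosh (- x) = cosh x by rewrite /cosh opprK addrC.
have h1 (e : R) : cosh e = cosh s -> 2^-1 `^ q * expR (q * e) <= cosh s `^ q.
  move=> es; have := h e; rewrite es => h2.
  have -> : 2^-1 `^ q * expR (q * e) = (expR e / 2) `^ q.
    by rewrite powRM ?expR_ge0// mulrC -expRM (mulrC q).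
  by rewrite ge0_ler_powR ?nnegrE ?divr_ge0 ?expR_ge0// ltW.
have := h1 s erefl; have := h1 (- s) (coshN s); rewrite [cosh (q * s)]/cosh mulrN.
move: (expR (q * s)) (expR (- (q * s))) (2^-1 `^ q) (cosh s `^ q) => a b c d' hb ha.
have -> : c * ((a + b) / 2) = (c * a + c * b) / 2 by field.
lra.
Qed.

(** * A Gaussian peak whose image leaves L^q *)

Section gaussian_blow_up.
Context {R : realType} {X : hilbertType R}.
Hypothesis hX : separable_space X.
Variables (mu nu : probability (borel X) R) (A B : borel X -> borel X).
Hypotheses (mA : measurable_fun setT A) (mB : measurable_fun setT B).
Variables (W Z : X -> X).
Hypothesis W_lin : forall a x y, W (a *: x + y) = a *: W x + W y.
Hypothesis Z_lin : forall a x y, Z (a *: x + y) = a *: Z x + Z y.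
Hypothesis cos_mu : forall h, \int[mu]_x cos (inner h x) = expR (- (`|W h| ^+ 2 / 2)).
Hypothesis sin_mu : forall h, \int[mu]_x sin (inner h x) = 0.
Hypothesis cos_A : forall h, \int[nu]_x cos (inner h (A x)) = expR (- (`|Z h| ^+ 2 / 2)).
Hypothesis sin_A : forall h, \int[nu]_x sin (inner h (A x)) = 0.
Hypothesis cos_B : forall h,
  \int[mu]_x cos (inner h (B x)) = expR (- ((`|W h| ^+ 2 - `|Z h| ^+ 2) / 2)).
Hypothesis sin_B : forall h, \int[mu]_x sin (inner h (B x)) = 0.
Let P : probability _ R := pair_prob mu nu.

Variable h : X.
Hypothesis Wh : `|W h| = 1.
Let z := `|Z h| ^+ 2.
Hypothesis z1 : z <= 1.

Let mh : measurable_fun setT (fun x : borel X => inner h x).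
Proof. exact: measurable_inner. Qed.
Let mhA : measurable_fun setT (fun x : borel X => inner h (A x)).
Proof. exact: (measurableT_comp mh mA). Qed.
Let mhB : measurable_fun setT (fun x : borel X => inner h (B x)).
Proof. exact: (measurableT_comp mh mB). Qed.

Let norm_scale (L : X -> X) t : (forall a x y, L (a *: x + y) = a *: L x + L y) ->
  `|L (t *: h)| ^+ 2 = t ^+ 2 * `|L h| ^+ 2.
Proof.
by move=> Ll; rewrite (lin_scale Ll) normrZ exprMn real_normK ?num_real.
Qed.

Let moment_mu k :
  mu.-integrable setT (EFin \o (fun x : borel X => inner h x ^+ k.*2 / (k.*2)`!%:R)) /\
  \int[mu]_x (inner h x ^+ k.*2 / (k.*2)`!%:R) = (1 / 2) ^+ k / k`!%:R.
Proof.
apply: gaussian_moment => // t; under eq_Rintegral do rewrite -innerZl.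
by rewrite cos_mu norm_scale// Wh expr1n.
Qed.

Let moment_A k :
  nu.-integrable setT (EFin \o (fun x : borel X => inner h (A x) ^+ k.*2 / (k.*2)`!%:R)) /\
  \int[nu]_x (inner h (A x) ^+ k.*2 / (k.*2)`!%:R) = (z / 2) ^+ k / k`!%:R.
Proof.
apply: gaussian_moment => //; first exact: sqr_ge0.
move=> t; under eq_Rintegral do rewrite -innerZl.
by rewrite cos_A norm_scale.
Qed.

Let moment_B k :
  mu.-integrable setT (EFin \o (fun x : borel X => inner h (B x) ^+ k.*2 / (k.*2)`!%:R)) /\
  \int[mu]_x (inner h (B x) ^+ k.*2 / (k.*2)`!%:R) = ((1 - z) / 2) ^+ k / k`!%:R.
Proof.
apply: gaussian_moment => //; first by rewrite subr_ge0.
move=> t; under eq_Rintegral do rewrite -innerZl.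
by rewrite cos_B !norm_scale// Wh expr1n -mulrBr.
Qed.

Let mNB : measurable_fun setT (fun x : borel X => (- (B x : X) : borel X)).
Proof.
have := measurableT_comp (measurable_hscale (X := X) (-1)) mB.
by apply: eq_measurable_fun => x _ /=; rewrite scaleN1r.
Qed.

Let B_sym (F : borel X -> R) : measurable_fun setT F -> (forall x, 0 <= F x) ->
  (\int[mu]_y (F (B y))%:E = \int[mu]_y (F (- (B y : X) : borel X))%:E)%E.
Proof.
apply: nonneg_law => //; apply: charfun_unique => // k.
  by under [RHS]eq_Rintegral do rewrite innerNr cosN.
under [RHS]eq_Rintegral do rewrite innerNr sinN -mulN1r.
rewrite bmf_intZ; last by apply: bmf_sin; exact: (measurableT_comp (measurable_inner k) mB).
by rewrite sin_B mulr0.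
Qed.

Variable th : R.
Hypothesis th0 : 0 < th.
Hypothesis th1 : th < 1.

Definition gaussian_peak (x : borel X) : R := expR (th * inner h x ^+ 2 / 2).
Let f := gaussian_peak.

Let mf : measurable_fun setT f.
Proof.
apply: measurableT_comp => //; apply: measurable_funM => //; apply: measurable_funM => //.
exact: measurable_funX.
Qed.

Let f0 x : 0 <= f x. Proof. exact: expR_ge0. Qed.

Lemma gaussian_peak_Lfun p : 1 <= p -> p * th < 1 -> f \in Lfun mu p%:E.
Proof.
move=> p1 pth; have p0 : 0 < p by exact: lt_le_trans p1.
apply: mem_Lfun => //; rewrite LnormE.
have -> : (\int[mu]_x (`|f x| `^ p)%:E = \int[mu]_x (expR (p * th * inner h x ^+ 2 / 2))%:E)%E.
  apply: eq_integral => x _; rewrite ger0_norm// -expRM; congr (expR _)%:E; ring.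
apply: poweR_lty; apply: (exp_sqr_int_finite mh moment_mu) => //.
by rewrite mulr_gt0.
Qed.

Let f_int : (\int[mu]_x (f x)%:E < +oo)%E.
Proof. by apply: (exp_sqr_int_finite mh moment_mu) => //; rewrite th0. Qed.

Let F x : \bar R := (\int[mu]_y (f (pair_out A B (x, y)))%:E)%E.

Let mfz : measurable_fun setT (fun t : borel X * borel X => (f (pair_out A B t))%:E).
Proof.
apply/measurable_EFinP; apply: measurableT_comp => //.
exact: measurable_pair_out.
Qed.

Let mF : measurable_fun setT F.
Proof.
have -> : F = fubini_F mu (fun t : borel X * borel X => (f (pair_out A B t))%:E) by [].
by apply: measurable_fun_fubini_tonelli_F => // t; rewrite lee_fin.
Qed.

(** Where the extended integral is infinite, [second_quantization] has the value 0 and the lower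
    bound [F_lower] would be lost; this happens only on a null set, since the nu-integral of F is
    the mu-integral of f. *)
Let F_fin : \forall x \ae nu, F x \is a fin_num.
Proof.
suff iF : nu.-integrable setT F by have := integrable_ae measurableT iF; apply: filterS => x; exact.
have F0 x : (0 <= F x)%E by apply: integral_ge0 => y _; rewrite lee_fin.
apply/integrableP; split => //; under eq_integral do rewrite gee0_abs//.
have -> : (\int[nu]_x F x = \int[P]_t (f (pair_out A B t))%:E)%E.
  by rewrite /P /pair_prob fubini_tonelli1// => t; rewrite lee_fin.
have law (k : borel X -> R) : bmf k -> \int[P]_t k (pair_out A B t) = \int[mu]_x k (idfun x).
  exact: (pair_out_law hX mA mB cos_mu sin_mu cos_A sin_A cos_B sin_B).
rewrite (nonneg_law (measurable_pair_out hX mA mB) (@measurable_id _ _ setT) law mf f0).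
exact: f_int.
Qed.

(** Average over B y and - B y, which have the same law, apply [exp_sqr_ge_cosh] to both and factor
    the sum of the cosh; the integral of cosh (n <h, B y>) is at least exp(n^2 (1 - z) / 2). *)
Let F_lower (n : R) x :
  ((expR (- (n ^+ 2 / (2 * th)) + n ^+ 2 * (1 - z) / 2) * cosh (n * inner h (A x)))%:E <= F x)%E.
Proof.
pose K (y : borel X) := f ((A x : X) + (y : X) : borel X).
have mtr : measurable_fun setT (fun y : borel X => ((A x : X) + (y : X) : borel X)).
  by apply: measurable_hadd => //; exact: measurable_cst.
have mK : measurable_fun setT K by exact: measurableT_comp mf mtr.
have mKB : measurable_fun setT (fun y => (K (B y))%:E).
  by apply/measurable_EFinP; exact: measurableT_comp mK mB.
have mKNB : measurable_fun setT (fun y => (K (- (B y : X) : borel X))%:E).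
  by apply/measurable_EFinP; exact: measurableT_comp mK mNB.
have K0 y : 0 <= K y by exact: f0.
have F1 : F x = (\int[mu]_y (K (B y))%:E)%E by [].
have F2 : F x = (\int[mu]_y (K (- (B y : X) : borel X))%:E)%E by rewrite F1 B_sym.
have FF : (F x + F x = \int[mu]_y (K (B y) + K (- (B y : X) : borel X))%:E)%E.
  rewrite {1}F1 F2 -ge0_integralD//; last 2 first.
  - by move=> y _; rewrite lee_fin.
  - by move=> y _; rewrite lee_fin.
set s := inner h (A x).
set c := expR (- (n ^+ 2 / (2 * th))).
have mch : measurable_fun setT (fun y => (cosh (n * inner h (B y)))%:E).
  apply/measurable_EFinP; apply: measurable_funM => //; apply: measurable_funD.
    apply: measurableT_comp => //; exact: measurable_funM.
  by apply: measurableT_comp => //; apply: measurableT_comp => //; exact: measurable_funM.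
have cosh0 (t : R) : 0 <= cosh t by rewrite divr_ge0// addr_ge0// expR_ge0.
have low : ((c * 2 * cosh (n * s))%:E * \int[mu]_y (cosh (n * inner h (B y)))%:E <= F x + F x)%E.
  rewrite FF -ge0_integralZl_EFin//; last first.
  - by rewrite mulr_ge0// mulr_ge0// expR_ge0.
  - by move=> y _; rewrite lee_fin.
  apply: ge0_le_integral => //.
  - by move=> y _; rewrite -EFinM lee_fin mulr_ge0// mulr_ge0// mulr_ge0// expR_ge0.
  - exact: measurable_funeM.
  - by under eq_fun do rewrite EFinD; exact: emeasurable_funD.
  - move=> y _; rewrite -EFinM lee_fin.
    have h1 := @exp_sqr_ge_cosh R th n (s + inner h (B y)) th0.
    have h2 := @exp_sqr_ge_cosh R th n (s - inner h (B y)) th0.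
    rewrite /K /f /gaussian_peak !innerDr innerNr -/s.
    have := lerD h1 h2; rewrite -mulrDr (mulrDr n) (mulrBr n) coshD_coshB -/c.
    by rewrite (mulrA c) !mulrA.
have cB := cosh_int_ge (v := 1 - z) mhB moment_B n.
have z1' : 0 <= 1 - z by rewrite subr_ge0.
rewrite -(@lee_pmul2l _ 2%:E)// [leRHS]mule_natl mule2n.
apply: le_trans low; rewrite expRD -EFinM.
rewrite -/c -/s; set c' := expR (_ / 2); set ch := cosh (n * s).
have -> : 2 * (c * c' * ch) = c * 2 * ch * c' by ring.
by rewrite EFinM lee_wpmul2l// lee_fin mulr_ge0// mulr_ge0// expR_ge0.
Qed.

(** Raise [F_lower] to the power q and integrate: cosh (q n <h, A x>) contributes exp(q^2 n^2 z /
    2), so the q-th power integral exceeds a constant times exp(kap n^2) for every n. *)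
Lemma gaussian_peak_blow_up q : 1 <= q -> 1 < th * (1 + (q - 1) * z) ->
  second_quantization mu (A : X -> X) (B : X -> X) f \notin Lfun nu q%:E.
Proof.
move=> q1 qz; have q0 : 0 < q by exact: lt_le_trans q1.
set G := second_quantization _ _ _ _; apply/negP => GL.
have mG := Lfun_measurable GL; have := Lfun_finite GL; rewrite LnormE.
have qn0 : q^-1 != 0 by rewrite invr_neq0// gt_eqF.
move=> /(lty_poweRy qn0) Gfin.
set C := (\int[nu]_x (`|G x| `^ q)%:E)%E in Gfin.
have z0 : 0 <= z by exact: sqr_ge0.
pose D : R := 2^-1 `^ q.
have D0 : 0 < D by rewrite powR_gt0.
(* The coefficient of n^2, namely - q / (2 th) + q (1 - z) / 2 + q^2 z / 2. *)
pose kap : R := q / 2 * (1 + (q - 1) * z - th^-1).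
have kap0 : 0 < kap.
  by rewrite mulr_gt0 ?divr_gt0// subr_gt0 -[th^-1]mul1r ltr_pdivrMr// mulrC.
have low (n : R) : ((D * expR (n ^+ 2 * kap))%:E <= C)%E.
  pose c := expR (- (n ^+ 2 / (2 * th)) + n ^+ 2 * (1 - z) / 2).
  have c0 : 0 <= c by exact: expR_ge0.
  have cosh0 (t : R) : 0 <= cosh t by rewrite divr_ge0// addr_ge0// expR_ge0.
  have mch (t : R) : measurable_fun setT (fun x : borel X => (cosh (t * inner h (A x)))%:E).
    apply/measurable_EFinP; apply: measurable_funM => //; apply: measurable_funD.
      by apply: measurableT_comp => //; exact: measurable_funM.
    by apply: measurableT_comp => //; apply: measurableT_comp => //; exact: measurable_funM.
  have cA := cosh_int_ge mhA moment_A (q * n).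
  have -> : D * expR (n ^+ 2 * kap) = c `^ q * D * expR ((q * n) ^+ 2 * z / 2).
    rewrite /c -expRM [RHS]mulrAC -expRD [LHS]mulrC; congr (expR _ * _); rewrite /kap.
    by field; rewrite gt_eqF.
  have cD0 : 0 <= c `^ q * D by rewrite mulr_ge0 ?powR_ge0.
  apply: (@le_trans _ _ ((c `^ q * D)%:E * \int[nu]_x (cosh (q * n * inner h (A x)))%:E)%E).
    by rewrite EFinM; apply: lee_wpmul2l => //; rewrite lee_fin.
  rewrite -ge0_integralZl_EFin//; last by move=> x _; rewrite lee_fin.
  apply: ae_ge0_le_integral; first exact: measurableT.
  - by move=> x _; rewrite -EFinM lee_fin mulr_ge0.
  - exact: measurable_funeM.
  - by move=> x _; rewrite lee_fin powR_ge0.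
  - apply/measurable_EFinP; apply: (measurableT_comp (measurable_powR q)).
    exact: measurableT_comp.
  - move: F_fin; apply: filterS => x Ffin _.
    have GE : (G x)%:E = F x by rewrite -(fineK Ffin).
    have := F_lower n x; rewrite -GE lee_fin -/c => h1.
    rewrite -EFinM lee_fin -mulrA.
    have h2 : 0 <= c * cosh (n * inner h (A x)) by rewrite mulr_ge0.
    rewrite (@le_trans _ _ ((c * cosh (n * inner h (A x))) `^ q))//.
      rewrite powRM// -(mulrA (c `^ q)) ler_wpM2l ?powR_ge0//; exact: cosh_powR.
    rewrite ge0_ler_powR ?nnegrE//; first exact: ltW.
    exact: le_trans h1 (ler_norm _).
have Cfin : C \is a fin_num.
  by rewrite ge0_fin_numE// integral_ge0// => x _; rewrite lee_fin powR_ge0.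
(* For n >= 1, exp(n^2 kap) >= n^2 kap >= n kap, so n > C / (D kap) contradicts [low]. *)
pose n : R := (Num.bound (`|fine C / (D * kap)|))%:R.
have nC : `|fine C / (D * kap)| < n by exact: archi_boundP.
have Dk : 0 < D * kap by rewrite mulr_gt0.
have n1 : 1 <= n.
  by have := le_lt_trans (normr_ge0 _) nC; rewrite ltr0n -(ler_nat R 1).
have := low n; rewrite -(fineK Cfin) lee_fin; apply/negP; rewrite -ltNge.
move: (le_lt_trans (ler_norm _) nC); rewrite ltr_pdivrMr// => /lt_le_trans; apply.
have e1 := expR_ge1Dx (n ^+ 2 * kap).
rewrite mulrCA ler_pM2l//.
apply: le_trans (le_trans _ e1); last exact: lexx.
rewrite (@le_trans _ _ (n ^+ 2 * kap))// ?lerDr//.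
by rewrite ler_pM2r// expr2 ler_peMl// (le_trans _ n1).
Qed.

End gaussian_blow_up.

Unset Implicit Arguments.

Theorem proposition4p12 (R : realType) (X : hilbertType R)
    (hX : separable_space X)
    (mu nu : probability (borel X) R) (Qmu Qnu : X -> X)
    (hmu : centered_gaussian mu Qmu) (hnu : centered_gaussian nu Qnu)
    (T : X -> X) :
  let Hmu := cameron_martin Qmu in
  let Hnu := cameron_martin Qnu in
  let normT := opnorm Hmu Hnu T in
  let Tstar := adjoint Hmu Hnu T in
  forall (hT : bounded_operator Hmu Hnu T)
    (hT0 : 0 < normT) (hT1 : normT < 1)
    (A B : X -> X)
    (hA : linear_version nu Qnu Tstar A)
    (hB : linear_version mu Qmu
            (sqrt_operator Hmu (fun h => h - Tstar (T h))) B)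
    (p : R) (hp : 1 <= p),
  let q0 := 1 + (p - 1) * normT ^- 2 in
  (forall q : R, 1 <= q <= q0 ->
     forall f : borel X -> R, f \in Lfun mu p%:E ->
       (exists g, second_quantization_Lp mu nu A B p f g) /\
       (forall g, second_quantization_Lp mu nu A B p f g ->
          g \in Lfun nu q%:E /\
          ('N[nu]_q%:E[EFin \o g] <= 'N[mu]_p%:E[EFin \o f])%E)) /\
  (forall q : R, q0 < q ->
     exists f g : borel X -> R,
       second_quantization_Lp mu nu A B p f g /\ g \notin Lfun nu q%:E).
Proof.
move=> Hmu Hnu r Tstar hT r0 r1 A B hA hB p p1 q0.
have [mA [VA [mVA PVA VA0 VAlin Alin]] [g hg cvgA]] := hA.
have [mB [VB [mVB PVB VB0 VBlin Blin]] [f hf cvgB]] := hB.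
have [hm _ _ _] := hmu; have [hn _ _ _] := hnu.
pose W := sqrt_operator ambient Qmu; pose V := sqrt_operator ambient Qnu.
(* |Z h|^2 is the variance of <h, A x> under nu, to be compared with the variance |W h|^2 of <h, x>
   under mu. *)
pose Z h := lift_op Qmu Qnu T (W h).
have W_lin : forall a x y, W (a *: x + y) = a *: W x + W y := cov_sqrt_lin hm hf.
have V_lin : forall a x y, V (a *: x + y) = a *: V x + V y := cov_sqrt_lin hn hg.
have L_lin := lift_op_lin hm hn hf hg hT.
have Z_lin a x y : Z (a *: x + y) = a *: Z x + Z y by rewrite /Z W_lin L_lin.
have cos_mu := gaussian_cos hmu hf; have sin_mu := gaussian_sin hmu.
have cos_nu := gaussian_cos hnu hg; have sin_nu := gaussian_sin hnu.
have [[_ Tstar_lin _] _] := adjoint_spec hm hn hf hg hT.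
have [[[_ C_lin _] _ _] _] := sqrt_defect_spec hm hn hf hg hT r1.
have Z_ker h : kernel_orth Qnu (Z h) by exact: (lift_op_ker hn hg hT).
have cos_A h : \int[nu]_x cos (inner h (A x)) = expR (- (`|Z h| ^+ 2 / 2)).
  exact: (version_cos hX hnu hg mA Tstar_lin cvgA (Z_ker h) (@inner_adjoint _ _ _ _ _ _ hm hn hf hg _ hT h)).
have sin_A h : \int[nu]_x sin (inner h (A x)) = 0.
  exact: (version_sin hX hnu hg mA Tstar_lin cvgA (@inner_adjoint _ _ _ _ _ _ hm hn hf hg _ hT h)).
have cos_B h : \int[mu]_x cos (inner h (B x)) = expR (- ((`|W h| ^+ 2 - `|Z h| ^+ 2) / 2)).
  rewrite -(norm_sqrt_defect hm hn hf hg hT r1 h).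
  exact: (version_cos hX hmu hf mB C_lin cvgB (@sqrt_defect_ker _ _ _ _ _ _ hm hn hf hg _ hT r1 h)
    (@inner_sqrt_defect _ _ _ _ _ _ hm hn hf hg _ hT r1 h)).
have sin_B h : \int[mu]_x sin (inner h (B x)) = 0.
  exact: (version_sin hX hmu hf mB C_lin cvgB
    (@inner_sqrt_defect _ _ _ _ _ _ hm hn hf hg _ hT r1 h)).
have ZW h : `|Z h| <= r * `|W h| := lift_op_norm hm hn hf hg hT (W h).
have [e he te] := gaussian_trace hmu hf.
have [e' he' te'] := gaussian_trace hnu hg.
have r01 : 0 < r < 1 by rewrite r0.
have r01' : 0 <= r <= 1 by rewrite !ltW.
have contr q : 1 <= q -> q - 1 <= (p - 1) * r ^- 2 -> lp_contractive mu nu A B p q.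
  move=> q1 qp h k mh mk hk.
  apply: (lp_transfer hX mA mB p1 q1) => // F bF F0.
  apply: (gamma_powR_bound hX mA mB r01) => //.
    by move=> u bu; exact: (gamma_int hX mA mB cos_mu sin_mu cos_A sin_A cos_B sin_B).
  move=> al be u v al01 be01 alber bu bv u0 v0.
  exact: (pair_hypercontractive hX mA mB r01' W_lin V_lin Z_lin cos_mu sin_mu cos_nu sin_nu
    cos_A sin_A cos_B sin_B ZW he he' te te' mVA mVB PVA PVB VAlin VBlin VA0 VB0 Alin Blin).
(* Since r < 1, the exponent p itself is admissible; this yields existence and uniqueness of the
   extension to L^p. *)
have contr_p : lp_contractive mu nu A B p p.
  apply: contr => //; rewrite ler_peMr ?subr_ge0//.
  by rewrite invf_ge1 ?exprn_gt0// exprn_ile1 ?ltW.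
split.
  move=> q /andP[q1 qq0] F FL; split.
    by exists (second_quantization mu A B F); exact: second_quantization_Lp_exists.
  move=> G; apply: second_quantization_Lp_contraction => //.
  by apply: contr => //; rewrite lerBlDl.
move=> q qq0.
have q1 : 1 < q.
  by apply: le_lt_trans qq0; rewrite lerDl mulr_ge0 ?subr_ge0// invr_ge0 sqr_ge0.
have q10 : 0 < q - 1 by rewrite subr_gt0.
have hr : (p - 1) / (q - 1) < r ^+ 2.
  rewrite ltr_pdivrMr// mulrC -ltr_pdivrMr ?exprn_gt0//.
  by move: qq0; rewrite /q0 -ltrBrDl.
(* q > q0 means (p - 1) / (q - 1) < r^2; rho^2 is the midpoint, so an almost norming h for rho has z
   > (p - 1) / (q - 1). *)
pose rho := Num.sqrt (((p - 1) / (q - 1) + r ^+ 2) / 2).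
have avg0 : 0 <= ((p - 1) / (q - 1) + r ^+ 2) / 2.
  by rewrite divr_ge0// addr_ge0 ?sqr_ge0// divr_ge0 ?subr_ge0// ltW.
have rho2 : rho ^+ 2 = ((p - 1) / (q - 1) + r ^+ 2) / 2 by rewrite sqr_sqrtr.
have rho_r : 0 <= rho < r.
  rewrite sqrtr_ge0/= -ltr_sqr ?nnegrE ?sqrtr_ge0 ?ltW// rho2.
  by move: hr; move: (_ / _) (r ^+ 2) => u v huv; lra.
have [h0 hh0] := opnorm_approx hm hn hf hg hT rho_r.
rewrite -/W -/(Z h0) in hh0.
have W0 : 0 < `|W h0|.
  rewrite lt_def normr_ge0 andbT; apply/eqP => W00.
  have := ZW h0; rewrite W00 mulr0 leNgt => /negP; apply.
  by move: hh0; rewrite W00 mulr0.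
pose h := `|W h0|^-1 *: h0.
have Wh : `|W h| = 1.
  by rewrite /h (lin_scale W_lin) normrZ ger0_norm ?invr_ge0// mulVf// gt_eqF.
have Zh : rho < `|Z h|.
  rewrite /h (lin_scale Z_lin) normrZ ger0_norm ?invr_ge0//.
  by rewrite mulrC ltr_pdivlMr.
pose z := `|Z h| ^+ 2.
have z1 : z <= 1.
  rewrite /z exprn_ile1//; apply: le_trans (ZW h) _; rewrite Wh mulr1; exact: ltW.
have pz : p < 1 + (q - 1) * z.
  rewrite -ltrBlDl mulrC -ltr_pdivrMr//.
  apply: (@lt_trans _ _ (rho ^+ 2)).
    by rewrite rho2; move: hr; move: (_ / _) (r ^+ 2) => u v huv; lra.
  by rewrite /z ltr_sqr ?nnegrE// sqrtr_ge0.
pose s := 1 + (q - 1) * z; rewrite -/s in pz.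
have p0 : 0 < p by exact: lt_le_trans p1.
(* The reciprocal of the midpoint of p and s, which gives p th < 1 < s th. *)
pose th := 2 / (p + s).
have ps : 0 < p + s by rewrite addr_gt0// (lt_trans p0).
have th0 : 0 < th by rewrite divr_gt0.
have pth : p * th < 1.
  by rewrite /th mulrA ltr_pdivrMr// mul1r; lra.
have sth : 1 < th * s.
  by rewrite /th mulrAC ltr_pdivlMr// mul1r; lra.
have th1 : th < 1 by apply: le_lt_trans pth; rewrite ler_peMl// ltW.
exists (gaussian_peak h th), (second_quantization mu A B (gaussian_peak h th)); split.
  apply: second_quantization_Lp_exists => //.
  exact: (gaussian_peak_Lfun W_lin cos_mu Wh th0).
exact: (gaussian_peak_blow_up hX mA mB W_lin Z_lin cos_mu sin_mu cos_A sin_A cos_B sin_B Wh z1 th0 th1 (ltW q1)).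
Qed.
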